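(* On the standard unit sphere $S^2\subset\mathbb{R}^3$ let $V_1=\{\zeta\in L^2(S^2):\int_{S^2}\zeta\,dS=0,\ X_3\zeta=i\zeta\}$, and let $M_1:V_1\to V_1$ be $$M_1\zeta=A(x_3)\zeta+B(x_3)\Delta^{-1}\zeta,\qquad A(x_3)=x_3,\quad B(x_3)=\Omega+6x_3 .$$ If $\Omega=0$, then $M_1$ has only real spectrum on $V_1$.
   Context: $L^2(S^2)$ consists of complex-valued functions. $\Delta$ is the Laplace–Beltrami operator on $S^2$; $\Delta^{-1}$ annihilates constants and has range orthogonal to constants. $X_3$ is the vector field generating the $2\pi$-periodic rotation about the $x_3$-axis. The eigenvalues of $-\Delta$ are $\lambda_\ell=\ell(\ell+1)$, and $6=\lambda_2$. (In terms of the orthonormal basis $\{\zeta_\ell\}_{\ell\ge1}$ of $V_1$ of normalized spherical harmonics with $\Delta\zeta_\ell=-\lambda_\ell\zeta_\ell$, one has $x_3\zeta_\ell=a_\ell\zeta_{\ell-1}+a_{\ell+1}\zeta_{\ell+1}$, $a_\ell=\sqrt{\tfrac{(\ell+1)(\ell-1)}{(2\ell+1)(2\ell-1)}}$, $\zeta_0=0$.) *)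

(* Defs.v *)
From HB Require Import structures.
From mathcomp Require Import all_boot all_order all_algebra.
From mathcomp Require Import all_classical all_reals all_analysis.
From mathcomp Require Import measurable_realfun complex.

Set Implicit Arguments.
Unset Strict Implicit.
Unset Printing Implicit Defensive.

Import Order.TTheory GRing.Theory Num.Theory.
Import numFieldNormedType.Exports.

Local Open Scope classical_set_scope.
Local Open Scope ring_scope.
Local Open Scope complex_scope.

(* Points of R^3 are triples ((x_1, x_2), x_3). *)
Notation space3 R := (R * R * R)%type.

Section SurfaceMeasure.
Variable R : realType.

(* Colatitude p.1 (measured from the north pole (0,0,1)) and longitude p.2. *)
Definition spherical (p : R * R) : space3 R :=
  (sin p.1 * cos p.2, sin p.1 * sin p.2, cos p.1).

Definition coord_rect : set (R * R) := `[0, pi]%classic `*` `[0, pi *+ 2]%classic.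

(* The surface measure dS = sin(theta) dtheta dphi of the unit sphere, as a
   Borel measure on R^3 carried by the sphere (see area_off_sphere): a function
   on S^2 modulo dS is the same as a function on R^3 modulo [area], and only
   values on the sphere matter below. *)
Definition area (A : set (space3 R)) : \bar R :=
  (\int[lebesgue_measure \x lebesgue_measure]_(p in coord_rect `&` spherical @^-1` A)
     (sin p.1)%:E)%E.

Lemma measurable_spherical : measurable_fun [set: R * R] spherical.
Proof.
have ms : measurable_fun [set: R] (@sin R).
  by apply: continuous_measurable_fun; exact: continuous_sin.
have mc : measurable_fun [set: R] (@cos R).
  by apply: continuous_measurable_fun; exact: continuous_cos.
apply/measurable_fun_pair; last exact: measurableT_comp.
by apply/measurable_fun_pair; apply: measurable_funM; exact: measurableT_comp.
Qed.

Let mrect : measurable coord_rect.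
Proof. by apply: measurableX; exact: measurable_itv. Qed.

Let mpre A : measurable A -> measurable (coord_rect `&` spherical @^-1` A).
Proof.
move=> mA; apply: measurableI; first exact: mrect.
by rewrite -[X in measurable X]setTI; exact: measurable_spherical.
Qed.

Let sin_rect A p : (coord_rect `&` spherical @^-1` A) p -> (0 <= (sin p.1)%:E)%E.
Proof.
by move=> [] [/= + _] _; rewrite in_itv/= => p1; rewrite lee_fin sin_ge0_pi.
Qed.

Let area0 : area set0 = 0%E.
Proof. by rewrite /area preimage_set0 setI0 integral_set0. Qed.

Let area_ge0 A : (0 <= area A)%E.
Proof. by apply: integral_ge0 => p; exact: sin_rect. Qed.

Let area_sigma_additive : semi_sigma_additive area.
Proof.
move=> F mF tF mUF; rewrite /area preimage_bigcup setI_bigcupr.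
rewrite ge0_integral_bigcup//=.
- apply: is_cvg_ereal_nneg_natsum_cond => n _ _; exact: area_ge0.
- by move=> n; exact: mpre.
- apply/measurable_EFinP; apply: measurable_funTS.
  apply: measurableT_comp => //.
  by apply: continuous_measurable_fun; exact: continuous_sin.
- by move=> p [n _] /sin_rect.
- apply/trivIsetP => i j _ _ ij; rewrite setIACA setIid -preimage_setI.
  by move/trivIsetP : tF => /(_ _ _ _ _ ij) ->//; rewrite preimage_set0 setI0.
Qed.

HB.instance Definition _ :=
  isMeasure.Build _ _ _ area area0 area_ge0 area_sigma_additive.

Definition sphere2 : set (space3 R) :=
  [set x | x.1.1 ^+ 2 + x.1.2 ^+ 2 + x.2 ^+ 2 = 1].

Lemma area_off_sphere : area (~` sphere2) = 0%E.
Proof.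
rewrite /area (_ : spherical @^-1` _ = set0) ?setI0 ?integral_set0//.
apply/seteqP; split => // p /=; apply.
rewrite /sphere2/= !exprMn -mulrDr cos2Dsin2.
by rewrite mulr1 addrC cos2Dsin2.
Qed.

End SurfaceMeasure.

Section SquareIntegrable.
Variable R : realType.
Implicit Types f g : space3 R -> R[i].

Definition L2 f : Prop :=
  ((fun x => complex.Re (f x)) \in Lfun (@area R) 2%:E) /\
  ((fun x => complex.Im (f x)) \in Lfun (@area R) 2%:E).

Definition L2norm f : R :=
  fine (Lnorm (@area R) 2%:E (fun x => (Normc.normc (f x))%:E)).

(* Elements of L^2(S^2) are classes of functions for this relation. *)
Definition ae_equal f g : Prop := {ae @area R, forall x, f x = g x}.

Definition integral_sphere f : R[i] :=
  (\int[@area R]_x complex.Re (f x)) +i* (\int[@area R]_x complex.Im (f x)).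

Definition mean f : R[i] :=
  integral_sphere f / (fine (@area R [set: space3 R]))%:C.

End SquareIntegrable.

Section TestFunctions.
Variable R : realType.
Implicit Types Phi Psi : space3 R -> R.

Fixpoint n_smooth (n : nat) Phi : Prop :=
  if n is m.+1 then
    (forall x, differentiable Phi x) /\ (forall v, n_smooth m ('D_v Phi))
  else continuous Phi.

(* C^oo functions on R^3; the smooth functions on S^2 are their restrictions. *)
Definition smooth Phi : Prop := forall n, n_smooth n Phi.

(* Psi = Delta Phi on S^2: the formula
   |g|^(-1/2) d_i (|g|^(1/2) g^(ij) d_j Phi) for the round metric
   g = dtheta^2 + sin(theta)^2 dphi^2.  The two poles, where the chart
   degenerates, are reached by continuity of Psi. *)
Definition laplace_beltrami Phi Psi : Prop :=
  forall theta phi : R, 0 < theta < pi ->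
    Psi (spherical (theta, phi)) =
      (sin theta)^-1 *
        derive1 (fun s => sin s *
          derive1 (fun r => Phi (spherical (r, phi))) s) theta
      + (sin theta ^+ 2)^-1 *
        derive1n 2 (fun s => Phi (spherical (theta, s))) phi.

Definition rotation3 (t : R) (x : space3 R) : space3 R :=
  (cos t * x.1.1 - sin t * x.1.2, sin t * x.1.1 + cos t * x.1.2, x.2).

Definition X3 Phi : space3 R -> R :=
  fun x => derive1 (fun t => Phi (rotation3 t x)) 0.

End TestFunctions.

Section Operators.
Variable R : realType.
Implicit Types f g u zeta : space3 R -> R[i].

(* X_3 f = g and Delta u = f in the sense of distributions on S^2: X_3 is
   divergence free and Delta is symmetric.  Real test functions suffice, the
   pairing being bilinear. *)
Definition weak_X3 f g : Prop :=
  forall Phi : space3 R -> R, smooth Phi ->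
    integral_sphere (fun x => f x * (X3 Phi x)%:C) =
    - integral_sphere (fun x => g x * (Phi x)%:C).

Definition weak_laplacian u f : Prop :=
  forall Phi Psi : space3 R -> R, smooth Phi -> smooth Psi ->
    laplace_beltrami Phi Psi ->
    integral_sphere (fun x => u x * (Psi x)%:C) =
    integral_sphere (fun x => f x * (Phi x)%:C).

(* Delta^{-1} f is the (a.e. unique) mean-zero u in L^2(S^2) with
   Delta u = f - mean f; a representative of its class is selected, which
   depends only on the class of f.  The default value 0 is irrelevant for f in
   L^2(S^2), where such a u exists. *)
Definition inv_laplacian f : space3 R -> R[i] :=
  xget (cst 0)
    [set u | [/\ L2 u, integral_sphere u = 0 &
                 weak_laplacian u (fun x => f x - mean f)]].

Definition V1 : set (space3 R -> R[i]) :=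
  [set zeta | [/\ L2 zeta, integral_sphere zeta = 0 &
                  weak_X3 zeta (fun x => (0 +i* 1) * zeta x)]].

Definition coefA (x3 : R) : R := x3.

Definition coefB (Omega x3 : R) : R := Omega + 6 * x3.

Definition M1 (Omega : R) zeta : space3 R -> R[i] :=
  fun x => (coefA x.2)%:C * zeta x + (coefB Omega x.2)%:C * inv_laplacian zeta x.

End Operators.

Section Spectrum.
Variable R : realType.
Variables (V : set (space3 R -> R[i])).
Variable T : (space3 R -> R[i]) -> (space3 R -> R[i]).

Definition shifted (lambda : R[i]) (f : space3 R -> R[i]) : space3 R -> R[i] :=
  fun x => T f x - lambda * f x.

(* T - lambda maps V to V, induces a bijection of V modulo a.e. equality, and
   the inverse of that bijection is bounded for the L^2 norm. *)
Definition resolvent_set : set R[i] :=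
  [set lambda |
    [/\ forall f, V f -> V (shifted lambda f),
        forall f1 f2, V f1 -> V f2 ->
          (ae_equal (shifted lambda f1) (shifted lambda f2) <-> ae_equal f1 f2),
        forall g, V g -> exists2 f, V f & ae_equal (shifted lambda f) g &
        exists C : R, forall f, V f -> L2norm f <= C * L2norm (shifted lambda f)]].

Definition spectrum : set R[i] := ~` resolvent_set.

End Spectrum.

(* Main.v *)
Require Import Defs.
From HB Require Import structures.
From mathcomp Require Import all_boot all_order all_algebra.
From mathcomp Require Import all_classical all_reals all_analysis.
From mathcomp Require Import measurable_realfun complex.
From mathcomp Require Import ring lra zify.

(** For Omega = 0 the operator is M zeta = x_3 (1 + 6 Delta^-1) zeta. Write X for
the multiplication by x_3, which is symmetric with norm at most one. The operator
1 + 6 Delta^-1 is diagonal on the basis zeta_l of V_1, with the eigenvalues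
1 - 6 / lambda_l: it equals -2 on zeta_1, 0 on zeta_2 because lambda_2 = 6, and
lies between 0 and 1 on the others.

If it were nonnegative, M would be the product of a symmetric operator and a
nonnegative one, hence symmetric for the form they define, and its spectrum would
be real. The defect is confined to zeta_1. Let P be the orthogonal projection on
zeta_1 and D = 1 + 6 Delta^-1 + 2 P, so that 0 <= D <= 1. Then M = T - 2 X P with
T = X D. Now X zeta_1 is a multiple of zeta_2, which D annihilates: T X P = 0, and
the range of T is orthogonal to zeta_1. Therefore M - lambda acts on the component
along zeta_1 as - lambda, and once this component is known the equation
(M - lambda) f = g becomes (T - lambda) f = g + 2 X P f with known right-hand side
(Ml_onto, Ml_bound).

The operator T - lambda, with lambda = a + i b and b nonzero, is inverted by means
of the form d(f, g) = <D f, g>, for which T is symmetric. One has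
b^2 d(f, f) <= d((T - lambda) f, (T - lambda) f) and |T f|^2 <= d(f, f), which
bound f by (T - lambda) f (XDl_bound). For surjectivity, the operator
T^2 - 2 a T + |lambda|^2 is symmetric and bounded below by b^2 for d, so that an
iteration solves the corresponding equation (XDq_onto); composing with
T - conj lambda solves (T - lambda) f = g (XDl_onto). Complex functions are pairs of
real functions here, and the multiplication by i is a real operator.

To apply this, V_1 needs an orthogonal basis on which Delta^-1 is diagonal. The
functions (x_1 + i x_2) q_n(x_3), where q_n are the eigenpolynomials of a
differential operator triangular on monomials (legendre_poly), are
eigenfunctions of Delta, and Green's formula in spherical coordinates (green_x1,
green_x2) gives their orthogonality. They are total in V_1 (rotation_total): the
relation X_3 f = i f annihilates the moments of f against (x_1 + i x_2)^m p(x_3)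
and its conjugate for m different from 1, orthogonality to the basis annihilates
those with m = 1, these functions span the polynomials on the sphere, and a
density with vanishing polynomial moments is zero (poly_moments_ae0). Finally
Delta^-1 is characterized by a weak equation: a solution is built diagonally on
the basis (poisson_exists), and it is unique because the Laplacian maps a
homogeneous polynomial of degree N to - N (N + 1) times itself plus a polynomial
of degree N - 2 (laplacian_injective). *)

Set Implicit Arguments.
Unset Strict Implicit.
Unset Printing Implicit Defensive.

Import Order.TTheory GRing.Theory Num.Theory.
Import numFieldNormedType.Exports.

Local Open Scope classical_set_scope.
Local Open Scope ring_scope.

(** * Semi-inner product spaces *)

Section SemiInner.
Variables (R : realType) (E : lmodType R).

(** Subspaces are predicates on an ambient vector space and a vector of norm zero
need not vanish: the vectors below are functions, defined everywhere, and two of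
them represent the same class when their difference has norm zero. *)
Record submodule (W : set E) : Prop := {
  subsp0 : W 0;
  subspS : forall (a : R) f g, W f -> W g -> W (a *: f + g) }.

Record semi_inner (W : set E) (ip : E -> E -> R) : Prop := {
  si_lin : forall a f g h, W f -> W g -> W h ->
    ip (a *: f + g) h = a * ip f h + ip g h;
  si_sym : forall f g, W f -> W g -> ip f g = ip g f;
  si_ge0 : forall f, W f -> 0 <= ip f f }.

Definition complete_for (W : set E) (ip : E -> E -> R) :=
  forall u : nat -> E, (forall n, W (u n)) ->
    (forall e, 0 < e -> exists N, forall m n, (N <= m)%N -> (N <= n)%N ->
        ip (u m - u n) (u m - u n) < e) ->
    exists2 f, W f & (fun n => ip (u n - f) (u n - f)) @ \oo --> (0 : R).

Section SemiInnerTheory.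
Variables (W : set E) (ip : E -> E -> R).
Hypotheses (WS : submodule W) (si : semi_inner W ip).
Notation Q f := (ip f f).

Lemma subspZ a f : W f -> W (a *: f).
Proof. by move=> Wf; rewrite -[X in W X]addr0; apply: WS.(subspS) => //; exact: WS.(subsp0). Qed.
Lemma subspD f g : W f -> W g -> W (f + g).
Proof. by move=> Wf Wg; rewrite -[f]scale1r; exact: WS.(subspS). Qed.
Lemma subspN f : W f -> W (- f).
Proof. by move=> Wf; rewrite -scaleN1r; apply: subspZ. Qed.
Lemma subspB f g : W f -> W g -> W (f - g).
Proof. by move=> Wf Wg; apply: subspD => //; apply: subspN. Qed.
Lemma subsp_sum I (r : seq I) (P : pred I) F :
  (forall i, P i -> W (F i)) -> W (\sum_(i <- r | P i) F i).
Proof. by move=> WF; apply: big_ind => //; [exact: WS.(subsp0)|move=> f g; exact: subspD]. Qed.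

Lemma ipDl f g h : W f -> W g -> W h -> ip (f + g) h = ip f h + ip g h.
Proof. by move=> Wf Wg Wh; rewrite -[f]scale1r si.(si_lin)// mul1r scale1r. Qed.
Lemma ip0l h : W h -> ip 0 h = 0.
Proof.
by move=> Wh; move: (ipDl WS.(subsp0) WS.(subsp0) Wh); rewrite addr0; lra.
Qed.
Lemma ipZl a f h : W f -> W h -> ip (a *: f) h = a * ip f h.
Proof. by move=> Wf Wh; rewrite -[_ *: f]addr0 si.(si_lin) ?ip0l ?addr0//; exact: WS.(subsp0). Qed.
Lemma ipNl f h : W f -> W h -> ip (- f) h = - ip f h.
Proof. by move=> Wf Wh; rewrite -scaleN1r ipZl// mulN1r. Qed.
Lemma ipBl f g h : W f -> W g -> W h -> ip (f - g) h = ip f h - ip g h.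
Proof. by move=> Wf Wg Wh; rewrite ipDl ?ipNl//; apply: subspN. Qed.
Lemma ipDr f g h : W f -> W g -> W h -> ip h (f + g) = ip h f + ip h g.
Proof.
by move=> Wf Wg Wh; rewrite si.(si_sym) ?ipDl ?(si.(si_sym) Wh)//; apply: subspD.
Qed.
Lemma ipZr a f h : W f -> W h -> ip h (a *: f) = a * ip h f.
Proof.
by move=> Wf Wh; rewrite si.(si_sym) ?ipZl ?(si.(si_sym) Wh)//; apply: subspZ.
Qed.
Lemma ipNr f h : W f -> W h -> ip h (- f) = - ip h f.
Proof. by move=> Wf Wh; rewrite -scaleN1r ipZr// mulN1r. Qed.
Lemma ipBr f g h : W f -> W g -> W h -> ip h (f - g) = ip h f - ip h g.
Proof. by move=> Wf Wg Wh; rewrite ipDr ?ipNr//; apply: subspN. Qed.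
Lemma ip_suml I (r : seq I) (P : pred I) F h : W h ->
  (forall i, P i -> W (F i)) ->
  ip (\sum_(i <- r | P i) F i) h = \sum_(i <- r | P i) ip (F i) h.
Proof.
move=> Wh WF; elim: r => [|i r IH]; first by rewrite !big_nil ip0l.
rewrite !big_cons; case: ifPn => Pi//; rewrite ipDl ?IH//; [exact: WF|exact: subsp_sum].
Qed.

(** The quadratic polynomial t |-> Q (f - t g) is nonnegative. *)
Lemma cauchy_schwarz f g : W f -> W g -> ip f g ^+ 2 <= Q f * Q g.
Proof.
move=> Wf Wg.
have H t : 0 <= Q f - 2 * t * ip f g + t ^+ 2 * Q g.
  have Wtg := subspZ t Wg; have := si.(si_ge0) (subspB Wf Wtg).
  rewrite ipBl ?ipBr ?ipZl ?ipZr//; last exact: subspB.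
  by rewrite (si.(si_sym) Wg Wf); congr (_ <= _); ring.
have := si.(si_ge0) Wf; have := si.(si_ge0) Wg.
(* If Q g = 0 the polynomial is affine, so that its slope vanishes; otherwise
evaluate it at its minimum. *)
rewrite le_eqVlt => /predU1P[g0|g0] f0.
  have := H ((Q f + 1) * ip f g); rewrite -g0 mulr0 addr0 mulr0 => h.
  have p0 := sqr_ge0 (ip f g).
  have : 0 <= Q f - 2 * (Q f + 1) * ip f g ^+ 2 by move: h; congr (_ <= _); ring.
  case: (ltrP 0 (ip f g ^+ 2)) => // p1 h2.
  have := H ((Q f + 1) / (ip f g)).
  have n0 : ip f g != 0 by move: p1; rewrite exprn_even_gt0.
  rewrite -g0 mulr0 addr0 -mulrA divfK//; lra.
have := H (ip f g / Q g).
have -> : Q f - 2 * (ip f g / Q g) * ip f g + (ip f g / Q g) ^+ 2 * Q g =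
  (Q f * Q g - ip f g ^+ 2) / Q g by field; rewrite gt_eqF.
by rewrite pmulr_lge0 ?invr_gt0// subr_ge0.
Qed.

Lemma QD_le f g : W f -> W g -> Q (f + g) <= 2 * Q f + 2 * Q g.
Proof.
move=> Wf Wg; have := si.(si_ge0) (subspB Wf Wg).
rewrite ipBl ?ipBr// ?ipDl ?ipDr//; [|exact: subspD|exact: subspB].
rewrite (si.(si_sym) Wg Wf); lra.
Qed.

Lemma QN f : W f -> Q (- f) = Q f.
Proof. by move=> Wf; rewrite ipNl ?ipNr ?opprK//; apply: subspN. Qed.

Lemma QZ a f : W f -> Q (a *: f) = a ^+ 2 * Q f.
Proof. by move=> Wf; rewrite ipZl ?ipZr//; [ring|apply: subspZ]. Qed.

Lemma QB_le f g : W f -> W g -> Q (f - g) <= 2 * Q f + 2 * Q g.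
Proof. by move=> Wf Wg; rewrite -(QN Wg); apply: QD_le => //; apply: subspN. Qed.

Lemma QBC f g : W f -> W g -> Q (f - g) = Q (g - f).
Proof. by move=> Wf Wg; rewrite -QN ?opprB//; apply: subspB. Qed.

(** By the Cauchy-Schwarz inequality, a form that is only semi-definite still
descends to classes modulo null vectors. *)
Lemma null_ip f h : W f -> W h -> Q f = 0 -> ip f h = 0.
Proof.
move=> Wf Wh f0; have := cauchy_schwarz Wf Wh; rewrite f0 mul0r => h0.
by apply/eqP; rewrite -sqrf_eq0 eq_le h0 sqr_ge0.
Qed.

(** Equality modulo null vectors, in the weak form in which adjoints act on it. *)
Definition eqv f g := forall h, W h -> ip f h = ip g h.

Lemma eqvP f g : W f -> W g -> eqv f g <-> Q (f - g) = 0.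
Proof.
move=> Wf Wg; split=> [fg|fg0 h Wh].
  by rewrite ipBl ?fg ?subrr//; apply: subspB.
by apply/eqP; rewrite -subr_eq0 -ipBl// null_ip//; apply: subspB.
Qed.

Lemma eqv_Q f g : W f -> W g -> eqv f g -> Q f = Q g.
Proof. by move=> Wf Wg fg; rewrite fg// si.(si_sym)// fg. Qed.

End SemiInnerTheory.
End SemiInner.

(** * Products of a nonnegative and a symmetric operator *)

(** T = X D, with X symmetric of norm at most one and 0 <= D <= 1, is symmetric
for the semi-definite form <D f, g>. J is the multiplication by i, so that
lambda = a + i b acts as a + b J; X and D commute with it. *)
Section Symmetrizable.
Variables (R : realType) (E : lmodType R) (V : set E) (ip : E -> E -> R).
Hypotheses (VS : submodule V) (si : semi_inner V ip).
Hypothesis cV : complete_for V ip.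
Variables (D X J : E -> E).
Hypotheses (VD : forall f, V f -> V (D f)) (VX : forall f, V f -> V (X f))
  (VJ : forall f, V f -> V (J f)).
Hypothesis Dsym : forall f g, V f -> V g -> ip (D f) g = ip f (D g).
Hypothesis Xsym : forall f g, V f -> V g -> ip (X f) g = ip f (X g).
Hypothesis Jasym : forall f g, V f -> V g -> ip (J f) g = - ip f (J g).
Hypothesis JJ : forall f, V f -> J (J f) = - f.
Hypothesis DJ : forall f g, V f -> V g -> ip (D (J f)) g = ip (J (D f)) g.
Hypothesis XJ : forall f g, V f -> V g -> ip (X (J f)) g = ip (J (X f)) g.
Hypothesis D_ge0 : forall f, V f -> 0 <= ip (D f) f.
Hypothesis D_le1 : forall f, V f -> ip (D f) f <= ip f f.
Hypothesis X_le1 : forall f, V f -> ip (X f) (X f) <= ip f f.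

Definition XD f := X (D f).
Definition Dform f g := ip (D f) g.
Notation T := XD.
Notation dip := Dform.

Let VT f : V f -> V (T f). Proof. by move=> Vf; apply/VX/VD. Qed.
Let V0 : V 0. Proof. exact: (subsp0 VS). Qed.
Let vZ a f : V f -> V (a *: f). Proof. exact: (subspZ VS). Qed.
Let vD f g : V f -> V g -> V (f + g). Proof. exact: (subspD VS). Qed.
Let vN f : V f -> V (- f). Proof. exact: (subspN VS). Qed.
Ltac inV := solve [repeat first [assumption | match goal with
  | |- V 0 => exact V0
  | |- V (_ *: _) => apply vZ
  | |- V (_ + _) => apply vD
  | |- V (- _) => apply vN
  | |- V (T _) => apply VT
  | |- V (D _) => apply VD
  | |- V (X _) => apply VX
  | |- V (J _) => apply VJ end]].
Tactic Notation "rw" uconstr(l) := rewrite l; [|inV..].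
Ltac ip_expand s := do ?[rw (ipDl s)|rw (ipDr VS s)|rw (ipNl VS s)|
  rw (ipNr VS s)|rw (ipZl VS s)|rw (ipZr VS s)].

Lemma Dform_semi_inner : semi_inner V dip.
Proof.
rewrite /Dform; split=> [a f g h Vf Vg Vh|f g Vf Vg|f Vf].
- by rw Dsym; rw si.(si_lin); rw (Dsym Vf); rw (Dsym Vg).
- by rw Dsym; rw si.(si_sym).
- exact: D_ge0.
Qed.
Let ds := Dform_semi_inner.

Lemma XD_adj f g : V f -> V g -> ip (T f) g = ip f (D (X g)).
Proof. by move=> Vf Vg; rewrite /XD; rw Xsym; rw Dsym. Qed.

Lemma XD_lin a f g h : V f -> V g -> V h ->
  ip (T (a *: f + g)) h = a * ip (T f) h + ip (T g) h.
Proof. by move=> Vf Vg Vh; do 3 rw XD_adj; rw si.(si_lin). Qed.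

Lemma XD_sym f g : V f -> V g -> dip (T f) g = dip f (T g).
Proof. by move=> Vf Vg; rewrite /Dform; rw Dsym; rw XD_adj; rw Dsym. Qed.

Lemma eqv_Dform f g : V f -> V g -> eqv V ip f g -> eqv V dip f g.
Proof.
by move=> Vf Vg fg h Vh; rewrite /Dform; rw (Dsym Vf); rw (Dsym Vg); rw fg.
Qed.

(** |X D f|^2 <= |D f|^2 <= <D f, f>, the last step being the Cauchy-Schwarz
inequality for the form of D: T turns the weak form of D into the norm. *)
Lemma XD_le_Dform f : V f -> ip (T f) (T f) <= dip f f.
Proof.
move=> Vf; apply: le_trans (X_le1 _) _; first inV.
have := cauchy_schwarz VS ds Vf (VD Vf).
have := D_le1 (VD Vf); have := D_ge0 (VD Vf); have := D_ge0 Vf.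
have -> : dip f (D f) = ip (D f) (D f) by [].
rewrite -/(dip _ _) -/(dip (D f) (D f)).
move: (dip f f) (dip (D f) (D f)) (ip (D f) (D f)) => x y z x0 y0 yz xy.
have [z0|z0] := leP z 0; first exact: le_trans z0 x0.
have : z * z <= x * z by rewrite -expr2 (le_trans xy)// ler_wpM2l.
by rewrite ler_pM2r.
Qed.

Lemma Dform_le f : V f -> dip f f <= ip f f. Proof. exact: D_le1. Qed.

Lemma Dform_XD_le f : V f -> dip (T f) (T f) <= dip f f.
Proof. by move=> Vf; apply: le_trans (XD_le_Dform Vf); apply: Dform_le; inV. Qed.

Lemma Dform_J f : V f -> dip f (J f) = 0.
Proof.
move=> Vf; have : dip f (J f) = - dip f (J f); last by lra.
by rewrite {1}/Dform; rw Dsym; rw si.(si_sym); rw DJ; rw Jasym.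
Qed.

Lemma Dform_XD_J f : V f -> dip (T f) (J f) = 0.
Proof.
move=> Vf; rewrite /Dform; rw Dsym; rw si.(si_sym); rw DJ; rw Jasym.
apply/eqP; rewrite oppr_eq0; apply/eqP.
have : ip (D f) (J (T f)) = - ip (D f) (J (T f)); last by lra.
by rewrite {1}(si.(si_sym) (VD Vf) (VJ (VT Vf))); rewrite {1}/XD -XJ; [|inV..];
  rw Xsym; rw Jasym.
Qed.

Lemma Dform_JJ f : V f -> dip (J f) (J f) = dip f f.
Proof.
by move=> Vf; rewrite /Dform; rw DJ; rw Jasym; rw JJ; rw (ipNr VS si); rewrite opprK.
Qed.

Lemma ip_JJ f : V f -> ip (J f) (J f) = ip f f.
Proof. by move=> Vf; rw Jasym; rw JJ; rw (ipNr VS si); rewrite opprK. Qed.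

Lemma ip_J f : V f -> ip f (J f) = 0.
Proof.
move=> Vf; have : ip f (J f) = - ip f (J f); last by lra.
by rewrite {1}(si.(si_sym) Vf (VJ Vf)); rw Jasym.
Qed.

Section Lambda.
Variables a b : R.
Hypothesis b0 : b != 0.
Let m := a ^+ 2 + b ^+ 2.
Let b2 : 0 < b ^+ 2. Proof. by rewrite exprn_even_gt0. Qed.
Let m0 : 0 < m. Proof. by rewrite ltr_wpDl// sqr_ge0. Qed.

Definition XDl f := T f - a *: f - b *: J f.

(** In the form of D the operator T - a is symmetric and b J is antisymmetric and
commutes with it, so that the squares of the two parts add up. *)
Lemma XDl_Dform_ge f : V f -> b ^+ 2 * dip f f <= dip (XDl f) (XDl f).
Proof.
move=> Vf; rewrite /XDl.
have -> : dip (T f - a *: f - b *: J f) (T f - a *: f - b *: J f) =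
    dip (T f - a *: f) (T f - a *: f) + b ^+ 2 * dip f f.
  have := Dform_J Vf; have := Dform_XD_J Vf; have := Dform_JJ Vf.
  ip_expand ds. rw (ds.(si_sym) (VJ Vf) Vf); rw (ds.(si_sym) (VJ Vf) (VT Vf)).
  by move=> -> -> ->; ring.
by rewrite lerDr; apply: ds.(si_ge0); inV.
Qed.

(** The previous bound controls <D f, f>, hence T f; the rest of f is recovered
from lambda f = T f - (T - lambda) f. *)
Lemma XDl_bound f : V f -> ip f f <= (2 / b ^+ 2 + 2) / m * ip (XDl f) (XDl f).
Proof.
move=> Vf; have VTl : V (XDl f) by rewrite /XDl; inV.
have d0 := D_ge0 Vf.
have H1 : dip f f <= ip (XDl f) (XDl f) / b ^+ 2.
  by rewrite ler_pdivlMr// mulrC (le_trans (XDl_Dform_ge Vf))// Dform_le.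
have e : ip (a *: f + b *: J f) (a *: f + b *: J f) = m * ip f f.
  have := ip_J Vf; have := ip_JJ Vf; ip_expand si; rw (si.(si_sym) (VJ Vf) Vf).
  by move=> -> ->; rewrite /m; ring.
have {}e : m * ip f f <= 2 * ip (T f) (T f) + 2 * ip (XDl f) (XDl f).
  rewrite -e (_ : a *: f + b *: J f = T f - XDl f).
    by apply: (QB_le VS si); inV.
  by rewrite /XDl -addrA -opprD subKr.
have H2 := XD_le_Dform Vf.
rewrite mulrAC ler_pdivlMr// [leLHS]mulrC (le_trans e)//.
rewrite (_ : (2 / b ^+ 2 + 2) * _ =
  2 * (ip (XDl f) (XDl f) / b ^+ 2) + 2 * ip (XDl f) (XDl f)); last by ring.
by move: H1 H2; move: (_ / _ ^+ 2) => z; lra.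
Qed.

(** (T - lambda)(T - conj lambda), a real operator, symmetric for the form of D. *)
Definition XDq f := T (T f) - (2 * a) *: T f + m *: f.
Notation S := XDq.

Let VS' f : V f -> V (S f). Proof. by move=> Vf; rewrite /S; inV. Qed.

Lemma XDq_sym f g : V f -> V g -> dip (S f) g = dip f (S g).
Proof.
move=> Vf Vg; rewrite /XDq; ip_expand ds.
by rewrite (XD_sym (VT Vf) Vg) (XD_sym Vf (VT Vg)) (XD_sym Vf Vg).
Qed.

Lemma XDq_lin c f g h : V f -> V g -> V h ->
  dip (S (c *: f + g)) h = c * dip (S f) h + dip (S g) h.
Proof.
move=> Vf Vg Vh; rewrite (XDq_sym Vf Vh) (XDq_sym Vg Vh).
rewrite XDq_sym; [|inV..]; apply: ds.(si_lin) => //; exact: VS'.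
Qed.

(** The quadratic polynomial is (T - a)^2 + b^2. *)
Lemma XDq_coercive f : V f -> b ^+ 2 * dip f f <= dip (S f) f.
Proof.
move=> Vf; have Vg : V (T f - a *: f) by inV.
have := ds.(si_ge0) Vg; rewrite /XDq; ip_expand ds.
rewrite (XD_sym (VT Vf) Vf) (XD_sym Vf Vf) /m; lra.
Qed.

(** B comes from |u - v + w|^2 <= 4 |u|^2 + 4 |v|^2 + 2 |w|^2 and |T f| <= |f| in
the form of D. The step tau = b^2 / B minimizes the contraction factor
1 - 2 tau b^2 + tau^2 B, whose value is then q. *)
Let B := 4 + 16 * a ^+ 2 + 2 * m ^+ 2.

Lemma XDq_bounded f : V f -> dip (S f) (S f) <= B * dip f f.
Proof.
move=> Vf; rewrite /XDq.
have H1 := QD_le VS ds (vD (VT (VT Vf)) (vN (vZ (2 * a) (VT Vf)))) (vZ m Vf).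
have H2 := QB_le VS ds (VT (VT Vf)) (vZ (2 * a) (VT Vf)).
rewrite !(QZ VS ds) // in H1 H2; last exact: VT.
have := Dform_XD_le Vf; have := Dform_XD_le (VT Vf); rewrite /B.
have : 0 <= a ^+ 2 by apply: sqr_ge0.
move: H1 H2.
move: (dip (T f) (T f)) (dip (T (T f)) (T (T f))) (dip f f) => x y z.
move: (dip _ _) (dip _ _) => u v H1 H2 a2 yx xz.
have := ler_wpM2l a2 xz; rewrite exprMn in H2; lra.
Qed.

Lemma XDq_coercive2 f : V f -> b ^+ 4 * dip f f <= dip (S f) (S f).
Proof.
move=> Vf; have := cauchy_schwarz VS ds (VS' Vf) Vf.
have := XDq_coercive Vf; have := ds.(si_ge0) Vf; have := ds.(si_ge0) (VS' Vf).
move: (dip (S f) (S f)) (dip (S f) f) (dip f f) => x y z x0 z0 zy yx.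
have [z1|z1] := leP z 0.
  by have -> : z = 0 by [apply/eqP; rewrite eq_le z0 z1]; rewrite mulr0.
rewrite -(ler_pM2r z1); apply: le_trans yx.
have -> : b ^+ 4 * z * z = (b ^+ 2 * z) ^+ 2 by ring.
have bz0 : 0 <= b ^+ 2 * z by rewrite mulr_ge0// ltW.
by rewrite ler_sqr// nnegrE (le_trans bz0).
Qed.

Let tau := b ^+ 2 / B.
Let B0 : 0 < B.
Proof. by rewrite /B; have := sqr_ge0 a; have := sqr_ge0 m; lra. Qed.
Let q := 1 - b ^+ 4 / B.
Let q0 : 0 <= q.
Proof.
rewrite /q subr_ge0 ler_pdivrMr// mul1r /B /m.
have h1 := sqr_ge0 a; have h2 := sqr_ge0 (b ^+ 2); have h3 := sqr_ge0 (a ^+ 2).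
have : 0 <= a ^+ 2 * b ^+ 2 by rewrite mulr_ge0// sqr_ge0.
by move: h2 h3; rewrite sqrrD -!exprM => h2 h3 h4; lra.
Qed.
Let q1 : q < 1.
Proof. by rewrite /q ltrBlDr ltrDl divr_gt0// exprn_even_gt0. Qed.

(** One step of the iteration r |-> r - tau S r contracts, because S is
symmetric, bounded by B and bounded below by b^2 for the form of D. *)
Lemma XDq_contract r : V r ->
  dip (r - tau *: S r) (r - tau *: S r) <= q * dip r r.
Proof.
move=> Vr; have VSr := VS' Vr.
have H1 := XDq_coercive Vr; have H2 := XDq_bounded Vr.
move: (S r) VSr H1 H2 => s Vs H1 H2.
ip_expand ds; rw (ds.(si_sym) Vr Vs).
have t0 : 0 < tau by rewrite divr_gt0.
have {H1} := ler_wpM2l (ltW t0) H1.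
have t2 : 0 <= tau * tau by rewrite mulr_ge0// ltW.
have {H2} := ler_wpM2l t2 H2.
have -> : tau * tau * (B * dip r r) = b ^+ 4 / B * dip r r.
  by rewrite /tau; field; rewrite gt_eqF.
have -> : tau * (b ^+ 2 * dip r r) = b ^+ 4 / B * dip r r.
  by rewrite /tau; field; rewrite gt_eqF.
rewrite /q mulrBl mul1r.
move: (dip r r) (dip s r) (dip s s) => x y z; move: (b ^+ 4 / B * x) (tau) => w t; lra.
Qed.

(** The iteration makes the residuals S u - g tend to 0 for the form of D only,
and V need not be complete for that form. But S = T (T - 2 a) + m and T is
bounded from the form of D to the norm: T (T - 2 a) u converges in norm to
some w, and S h = g forces h = (g - w) / m. *)
Lemma XDq_onto g : V g -> exists2 h, V h & eqv V ip (S h) g.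
Proof.
move=> Vg.
(* Richardson iteration from 0, with r k the residual. *)
pose u := fix u k := if k is k'.+1 then u k' - tau *: (S (u k') - g) else 0.
have Vu k : V (u k).
  elim: k => [|k IH] /=; first exact: V0.
  by have := VS' IH; move: (S _) => s Vs; inV.
pose r k := S (u k) - g.
have Vr k : V (r k) by rewrite /r; have := VS' (Vu k); move: (S _) => s Vs; inV.
have rS k : dip (r k.+1) (r k.+1) <= q * dip (r k) (r k).
  apply: le_trans (XDq_contract (Vr k)); rewrite le_eqVlt; apply/orP; left.
  have Vsr := VS' (Vr k).
  apply/eqP/(eqv_Q ds) => //; first by move: (Vr k) (S _) Vsr => Vrk s Vs; inV.
  move=> x Vx; rewrite {1}/r /=.
  have Vsu := VS' (Vu k.+1).
  rewrite (ipBl VS ds) // /u -/u.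
  rewrite (_ : u k - _ = (- tau) *: r k + u k); last first.
    by rewrite scaleNr addrC.
  rewrite XDq_lin // (ipBl VS ds) //; last by inV.
  rewrite (ipZl VS ds) // {2}/r (ipBl VS ds) //; last exact: VS'.
  by rewrite mulNr; ring.
have r0 : (fun k => dip (r k) (r k)) @ \oo --> (0 : R).
  have H : (fun k => q ^+ k * dip (r 0%N) (r 0%N)) @ \oo --> (0 : R).
    rewrite -[X in _ --> X](mul0r (dip (r 0%N) (r 0%N))); apply: cvgMl.
    by apply: cvg_expr; rewrite ger0_norm.
  apply: (squeeze_cvgr _ _ H); last exact: cvg_cst.
  apply: nearW => k; rewrite ds.(si_ge0)//=.
  elim: k => [|k IH]; first by rewrite expr0 mul1r.
  by rewrite (le_trans (rS _))// exprS -mulrA ler_wpM2l.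
(* Coercivity makes u Cauchy for the form of D, hence G u Cauchy in norm. *)
pose G f := T (T f - (2 * a) *: f).
have VG f : V f -> V (G f) by move=> Vf; rewrite /G; inV.
have GE f x : V f -> V x ->
    ip (G f) x = ip (T (T f)) x - 2 * a * ip (T f) x.
  move=> Vf Vx; rewrite /G addrC -scaleNr XD_lin; [|inV..].
  by rewrite mulNr addrC.
have SE f x : V f -> V x -> ip (S f) x = ip (G f) x + m * ip f x.
  by move=> Vf Vx; rewrite GE // /XDq; ip_expand si; rewrite -!mulrA.
have GQ f : V f -> ip (G f) (G f) <= (2 + 8 * a ^+ 2) * dip f f.
  move=> Vf; rewrite /G; apply: le_trans (XD_le_Dform _) _; first by inV.
  apply: le_trans (QB_le VS ds _ _) _; [inV..|].
  rewrite (QZ VS ds)//; have := Dform_XD_le Vf.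
  by rewrite exprMn; lra.
have GB f h : V f -> V h -> eqv V ip (G (f - h)) (G f - G h).
  move=> Vf Vh x Vx; have VGf := VG _ Vf; have VGh := VG _ Vh.
  rewrite (ipBl VS si)// !GE//; last by inV.
  do 6 (rw XD_adj); do 3 (rw XD_adj).
  by rewrite !(ipBl VS si)//; first [ring|inV].
have GD f h : V f -> V h ->
    ip (G f - G h) (G f - G h) <= (2 + 8 * a ^+ 2) * dip (f - h) (f - h).
  move=> Vf Vh; rewrite -(eqv_Q si _ _ (GB _ _ Vf Vh)).
  - by apply: GQ; inV.
  - by apply: VG; inV.
  - by apply: (subspB VS); apply: VG.
have a2 : 0 <= a ^+ 2 by apply: sqr_ge0.
have uC f h : V f -> V h -> b ^+ 4 * dip (f - h) (f - h) <=
    2 * dip (S f - g) (S f - g) + 2 * dip (S h - g) (S h - g).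
  move=> Vf Vh; have VSf := VS' Vf; have VSh := VS' Vh.
  have VSfh : V (S (f - h)) by apply: VS'; inV.
  have Vsub : V (S f - S h) by apply: (subspB VS).
  apply: le_trans (XDq_coercive2 _) _; first by inV.
  rewrite (eqv_Q ds (g := S f - S h))//; last first.
    move=> x Vx; rewrite (ipBl VS ds)// (_ : f - h = (-1) *: h + f).
      by rewrite XDq_lin// mulN1r addrC.
    by rewrite scaleN1r addrC.
  rewrite (_ : S f - S h = (S f - g) - (S h - g)).
    by apply: (QB_le VS ds); apply: (subspB VS).
  by rewrite opprB addrA subrK.
have b4 : 0 < b ^+ 4 by rewrite exprn_even_gt0.
have [w Vw wP] : exists2 w, V w &
    (fun n => ip (G (u n) - w) (G (u n) - w)) @ \oo --> (0 : R).
  apply: cV => [n|e e0]; first exact: VG.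
  pose c := (2 + 8 * a ^+ 2) / b ^+ 4 * 4.
  have c0 : 0 < c by rewrite mulr_gt0// divr_gt0//; lra.
  have /cvgrPdist_lt/(_ (e / c)) := r0; rewrite divr_gt0// => /(_ isT) [N _ NP].
  exists N => i j Ni Nj; apply: le_lt_trans (GD _ _ (Vu i) (Vu j)) _.
  have := uC _ _ (Vu i) (Vu j); rewrite -/(r i) -/(r j).
  have := NP _ Ni; have := NP _ Nj.
  rewrite !sub0r !normrN !ger0_norm; [|exact: ds.(si_ge0)..].
  rewrite !ltr_pdivlMr// => Rj Ri C.
  have : dip (u i - u j) (u i - u j) <=
    (2 * dip (r i) (r i) + 2 * dip (r j) (r j)) / b ^+ 4.
    by rewrite ler_pdivlMr// mulrC.
  have k0 : 0 <= 2 + 8 * a ^+ 2 by lra.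
  move/(ler_wpM2l k0) => /le_lt_trans; apply.
  move: Ri Rj; rewrite /c; move: (dip _ _) (dip (r j) _) => x y Ri Rj.
  rewrite (_ : _ * (_ / _) = (x * ((2 + 8 * a ^+ 2) / b ^+ 4 * 4) + y * ((2 + 8 * a ^+ 2) / b ^+ 4 * 4)) / 2).
    by lra.
  by field.
pose h := m^-1 *: (g - w).
have Vh : V h by rewrite /h; inV.
have hw : m *: h = g - w by rewrite /h scalerA divff ?scale1r// gt_eqF.
exists h => // x Vx; rewrite SE// -(ipZl VS si)// hw (ipBl VS si)//.
suff -> : ip (G h) x = ip w x by ring.
move: x Vx; apply/(eqvP VS si) => //; first exact: VG.
have m2 : 0 < m ^+ 2 by rewrite exprn_gt0.
(* m (u - h) = r - (G u - w), so that u tends to h for the form of D. *)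
have hu n : m ^+ 2 * dip (u n - h) (u n - h) <=
    2 * dip (r n) (r n) + 2 * ip (G (u n) - w) (G (u n) - w).
  have VGu := VG _ (Vu n); have VSu := VS' (Vu n); have Vun := Vu n.
  rewrite -(QZ VS ds); last by inV.
  have Vd : V (G (u n) - w) by inV.
  have Vrn := Vr n.
  rewrite (eqv_Q ds (g := r n - (G (u n) - w))); [|inV..|].
    apply: le_trans (QB_le VS ds Vrn Vd) _.
    by rewrite lerD2l ler_pM2l//; apply: Dform_le.
  apply: eqv_Dform; [inV..|] => x Vx.
  rewrite scalerBr hw.
  rewrite (ipBl VS si (f := m *: u n)); [|inV..].
  rewrite (ipBl VS si (f := r n))// /r !(ipBl VS si)// SE// (ipZl VS si)//.
  ring.
have lim : (fun n => 2 * ((2 + 8 * a ^+ 2) / m ^+ 2 * (2 * dip (r n) (r n) +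
    2 * ip (G (u n) - w) (G (u n) - w))) + 2 * ip (G (u n) - w) (G (u n) - w))
    @ \oo --> (0 : R).
  rewrite [X in _ --> X](_ : 0 = 2 * ((2 + 8 * a ^+ 2) / m ^+ 2 * (2 * 0 + 2 * 0)) + 2 * 0 :> R).
    by apply: cvgD; apply: cvgMr => //; apply: cvgMr; apply: cvgD; apply: cvgMr.
  by ring.
have VGh := VG _ Vh; have VGw : V (G h - w) by inV.
apply/eqP; rewrite eq_le si.(si_ge0)// andbT.
apply: (cvgr_to_ge lim); apply: nearW => n.
have Vun := Vu n; have VGu := VG _ Vun; have Vd : V (G (u n) - w) by inV.
rewrite (_ : G h - w = (G (u n) - w) - (G (u n) - G h)); last first.
  by rewrite opprB [RHS]addrC addrA subrK.
have VG2 : V (G (u n) - G h) by inV.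
apply: le_trans (QB_le VS si Vd VG2) _; rewrite addrC lerD2r ler_pM2l//.
apply: le_trans (GD _ _ Vun Vh) _; rewrite -mulrA.
have k0 : 0 <= 2 + 8 * a ^+ 2 by lra.
by apply: ler_wpM2l => //; rewrite ler_pdivlMl.
Qed.

(** The factorization (T - lambda)(T - conj lambda) = T^2 - 2aT + |lambda|^2
turns a solution of the quadratic equation into one of the linear equation. *)
Lemma XDl_onto g : V g -> exists2 f, V f & eqv V ip (XDl f) g.
Proof.
move=> Vg; have [h Vh hg] := XDq_onto Vg.
have VTh := VT Vh; have VJh := VJ Vh.
exists (T h - a *: h + b *: J h); first by inV.
move=> x Vx; rewrite -hg// /XDl /XDq.
have TJ : ip (T (J h)) x = ip (J (T h)) x.
  rewrite /XD; rw Xsym; rw (DJ Vh (VX Vx)); rewrite -Xsym; [|inV..].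
  by rw XJ.
have JL : ip (J (T h - a *: h + b *: J h)) x =
    ip (J (T h)) x - a * ip (J h) x - b * ip h x.
  by rw Jasym; ip_expand si; rw Jasym; rw Jasym; rw Jasym; rw JJ; ip_expand si; ring.
have TL : ip (T (T h - a *: h + b *: J h)) x =
    ip (T (T h)) x - a * ip (T h) x + b * ip (J (T h)) x.
  rewrite -TJ; rw XD_adj; ip_expand si.
  by do 3 (rewrite -XD_adj; [|inV..]).
ip_expand si; rewrite JL TL /m; ring.
Qed.
End Lambda.
End Symmetrizable.

(** * Orthogonal expansions *)

(** Some e n may be null: the divisions by h n then return 0, which is the right
coefficient because null vectors are orthogonal to everything. *)
Section OrthogonalExpansion.
Variables (R : realType) (E : lmodType R) (W : set E) (ip : E -> E -> R).
Hypotheses (WS : submodule W) (si : semi_inner W ip).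
Hypothesis cW : complete_for W ip.
Variables (V : set E) (e : nat -> E).
Hypotheses (VS : submodule V) (VW : V `<=` W).
Hypothesis Vclosed : forall u f, (forall n, V (u n)) -> W f ->
  (fun n => ip (u n - f) (u n - f)) @ \oo --> (0 : R) -> V f.
Hypothesis Ve : forall n, V (e n).
Hypothesis orth : forall m n, m != n -> ip (e m) (e n) = 0.
Hypothesis total : forall f, V f -> (forall n, ip f (e n) = 0) -> ip f f = 0.

Let h n := ip (e n) (e n).
Let We n : W (e n). Proof. exact: VW. Qed.
Let h0 n : 0 <= h n. Proof. exact: si.(si_ge0). Qed.

Definition psum (al : nat -> R) n := \sum_(k < n) al k *: e k.

Lemma psum_V al n : V (psum al n).
Proof. by apply: (subsp_sum VS) => i _; apply: (subspZ VS). Qed.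
Let psum_W al n : W (psum al n). Proof. exact/VW/psum_V. Qed.

Lemma ip_psum al n w : W w -> ip (psum al n) w = \sum_(k < n) al k * ip (e k) w.
Proof.
move=> Ww; rewrite (ip_suml WS si)//; last by move=> i _; apply: (subspZ WS).
by apply: eq_bigr => i _; rewrite (ipZl WS si).
Qed.

Lemma ip_psum_e al n m : ip (psum al n) (e m) = if (m < n)%N then al m * h m else 0.
Proof.
rewrite ip_psum//; case: ifPn => mn.
  rewrite (bigD1 (Ordinal mn))//= big1 ?addr0// => i im.
  by rewrite orth ?mulr0//; apply: contra im => /eqP ime; apply/eqP/val_inj.
rewrite big1// => i _; rewrite orth ?mulr0//.
by apply: contra mn => /eqP <-.
Qed.

Lemma ip_psum_psum al be n m : (n <= m)%N ->
  ip (psum al n) (psum be m) = \sum_(k < n) al k * be k * h k.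
Proof.
move=> nm; rewrite ip_psum//; apply: eq_bigr => i _.
rewrite si.(si_sym)// ip_psum_e (leq_trans (ltn_ord i) nm) -mulrA; ring.
Qed.

Lemma coef0 f k : W f -> h k = 0 -> ip f (e k) = 0.
Proof. by move=> Wf hk; rewrite si.(si_sym)// (null_ip WS si). Qed.

Lemma coef_divK f k : W f -> ip f (e k) / h k * h k = ip f (e k).
Proof.
move=> Wf; have [h00|hk] := eqVneq (h k) 0; last by rewrite divfK.
by rewrite coef0// mul0r mul0r.
Qed.

Lemma bessel f n : W f -> \sum_(k < n) (ip f (e k) / h k) ^+ 2 * h k <= ip f f.
Proof.
move=> Wf; pose al k := ip f (e k) / h k.
have Ws := psum_W al n.
have := si.(si_ge0) (subspB WS Wf Ws).
rewrite (ipBl WS si)// ?(ipBr WS si)//; last exact: (subspB WS).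
have fs : ip (psum al n) f = \sum_(k < n) al k ^+ 2 * h k.
  rewrite ip_psum//; apply: eq_bigr => k _.
  by rewrite si.(si_sym)// -[in LHS](coef_divK k Wf) -/(al k); ring.
rewrite (si.(si_sym) Wf Ws) fs ip_psum_psum//.
under [in X in _ - (_ - X)]eq_bigr do rewrite -expr2.
by rewrite subrr subr0 subr_ge0.
Qed.

Lemma riesz_fischer (al : nat -> R) M : (forall n, \sum_(k < n) al k ^+ 2 * h k <= M) ->
  exists2 u, V u & (forall m, ip u (e m) = al m * h m) /\
    (fun n => ip (psum al n - u) (psum al n - u)) @ \oo --> (0 : R).
Proof.
move=> aM; pose s n := \sum_(k < n) al k ^+ 2 * h k.
have Qs m n : (n <= m)%N -> ip (psum al m - psum al n) (psum al m - psum al n) = s m - s n.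
  move=> nm; have Wm := psum_W al m; have Wn := psum_W al n.
  rewrite (ipBl WS si)// ?(ipBr WS si)//; last exact: (subspB WS).
  rewrite (si.(si_sym) Wm Wn) !ip_psum_psum// subrr subr0 /s.
  by congr (_ - _); apply: eq_bigr => k _; rewrite expr2.
have snd : nondecreasing_seq s.
  apply/nondecreasing_seqP => n; rewrite /s big_ord_recr/= lerDl.
  by rewrite mulr_ge0// sqr_ge0.
have scv : cvgn s.
  apply: nondecreasing_is_cvgn => //; exists M => _ [n _ <-]; exact: aM.
have [u Wu uP] : exists2 u, W u &
    (fun n => ip (psum al n - u) (psum al n - u)) @ \oo --> (0 : R).
  apply: cW => // eps eps0.
  have /cvgrPdist_lt/(_ (eps / 2)) := scv; rewrite divr_gt0// => /(_ isT) [N _ NP].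
  exists N => m n Nm Nn.
  wlog nm : m n Nm Nn / (n <= m)%N.
    move=> H; case/orP: (leq_total n m) => nm; first exact: H.
    by rewrite (QBC WS si)//; exact: H.
  rewrite Qs//; have := NP _ Nm; have := NP _ Nn => /=.
  by rewrite !ltr_norml => /andP[? ?] /andP[? ?]; lra.
have Vu : V u by apply: (Vclosed (u := psum al)) => // n; apply: psum_V.
exists u => //; split=> // m; apply/eqP; rewrite -subr_eq0 -sqrf_eq0 eq_le sqr_ge0 andbT.
have lim : (fun n => ip (psum al n - u) (psum al n - u) * h m) @ \oo --> (0 : R).
  by rewrite -[X in _ --> X](mul0r (h m)); apply: cvgMl.
apply: (cvgr_to_ge lim); near=> n.
have Wn := psum_W al n.
have -> : ip u (e m) - al m * h m = - ip (psum al n - u) (e m).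
  rewrite (ipBl WS si)// ip_psum_e ifT ?opprB//.
  by near: n; exists m.+1.
by rewrite sqrrN; apply: (cauchy_schwarz WS si) => //; apply: (subspB WS).
Unshelve. all: end_near. Qed.

(** The sum of the expansion has the same coefficients as f, so that it equals f
modulo null vectors by totality. *)
Lemma expansion f : V f -> let al k := ip f (e k) / h k in
  (fun n => ip (psum al n - f) (psum al n - f)) @ \oo --> (0 : R).
Proof.
move=> Vf al; have Wf := VW Vf.
have [u Vu [uE uc]] := @riesz_fischer al _ (fun n => bessel n Wf).
have Wu := VW Vu.
suff fu : eqv W ip f u.
  apply: cvg_trans uc; apply: near_eq_cvg; apply: nearW => n.
  have Wn := psum_W al n.
  apply: (eqv_Q si); [exact: (subspB WS)..|] => x Wx.
  by rewrite !(ipBl WS si)// fu.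
apply/(eqvP WS si) => //; apply: total; first exact: (subspB VS).
by move=> n; rewrite (ipBl WS si)// uE coef_divK// subrr.
Qed.

Lemma parseval f w : V f -> W w ->
  (fun n => \sum_(k < n) ip f (e k) / h k * ip w (e k)) @ \oo --> ip f w.
Proof.
move=> Vf Ww; have Wf := VW Vf.
set al := fun k => ip f (e k) / h k.
have H n : \sum_(k < n) ip f (e k) / h k * ip w (e k) = ip (psum al n) w.
  by rewrite ip_psum//; apply: eq_bigr => k _; rewrite (si.(si_sym) Ww).
under eq_fun do rewrite H.
have lim : (fun n => ip (psum al n - f) (psum al n - f) * ip w w) @ \oo --> (0 : R).
  by rewrite -[X in _ --> X](mul0r (ip w w)); apply: cvgMl; apply: expansion.
apply/cvgrPdist_lt => eps eps0.
have eps2 : 0 < eps ^+ 2 by rewrite exprn_gt0.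
have /cvgrPdist_lt/(_ _ eps2) := lim; apply: filterS => n.
have Wn := psum_W al n; have Wd : W (psum al n - f) by exact: (subspB WS).
rewrite sub0r normrN ger0_norm ?mulr_ge0 ?si.(si_ge0)// => Hn.
rewrite distrC -(ipBl WS si)// -(@ltr_pXn2r _ 2%N)// ?nnegrE ?(ltW eps0)//.
by rewrite real_normK ?num_real// (le_lt_trans _ Hn)//; apply: (cauchy_schwarz WS si).
Qed.

(** Identities and inequalities between diagonal operators reduce to their
eigenvalues. The vectors w and w' are not in V: they will be test functions. *)
Lemma parseval_eq f g w w' : V f -> V g -> W w -> W w' ->
  (forall k, ip f (e k) * ip w (e k) = ip g (e k) * ip w' (e k)) ->
  ip f w = ip g w'.
Proof.
move=> Vf Vg Ww Ww' H; have := parseval Vg Ww'.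
have -> : (fun n => \sum_(k < n) ip g (e k) / h k * ip w' (e k)) =
    (fun n => \sum_(k < n) ip f (e k) / h k * ip w (e k)).
  by apply/funext => n; apply: eq_bigr => k _; rewrite mulrAC -H mulrAC.
by move=> H'; rewrite -(cvg_lim _ (parseval Vf Ww))// -(cvg_lim _ H').
Qed.

Lemma parseval_le f g w w' : V f -> V g -> W w -> W w' ->
  (forall k, ip f (e k) * ip w (e k) <= ip g (e k) * ip w' (e k)) ->
  ip f w <= ip g w'.
Proof.
move=> Vf Vg Ww Ww' H.
apply: (ler_cvg_to (parseval Vf Ww) (parseval Vg Ww')).
apply: nearW => n; apply: ler_sum => k _; rewrite mulrAC [leRHS]mulrAC.
by rewrite ler_wpM2r ?invr_ge0.
Qed.

(** Bessel's inequality makes the rescaled coefficients square summable. *)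
Lemma diagonal_exists (ka : nat -> R) f : (forall n, `|ka n| <= 1) -> V f ->
  exists2 u, V u & forall m, ip u (e m) = ka m * ip f (e m).
Proof.
move=> ka1 Vf; have Wf := VW Vf.
have [|u Vu [uE _]] := @riesz_fischer (fun k => ka k * (ip f (e k) / h k)) (ip f f).
  move=> n; apply: le_trans (bessel n Wf); apply: ler_sum => k _.
  rewrite ler_wpM2r// exprMn ler_piMl ?sqr_ge0// -[ka k ^+ 2]real_normK ?num_real//.
  by rewrite expr_le1.
by exists u => // m; rewrite uE -mulrA coef_divK.
Qed.

End OrthogonalExpansion.

(** * Invertibility of x_3 (1 + 6 K) - lambda, abstractly *)

(** X is the multiplication by x_3, K the inverse Laplacian, z n a multiple of
zeta_{n+1} and J the multiplication by i. *)
Section RealSpectrum.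
Variables (R : realType) (E : lmodType R) (W : set E) (ip : E -> E -> R).
Hypotheses (WS : submodule W) (siW : semi_inner W ip).
Hypothesis cW : complete_for W ip.
Variables (V : set E) (z : nat -> E) (J X K : E -> E).
Hypotheses (VS : submodule V) (VW : V `<=` W).
Hypothesis Vclosed : forall u f, (forall n, V (u n)) -> W f ->
  (fun n => ip (u n - f) (u n - f)) @ \oo --> (0 : R) -> V f.
Hypotheses (VX : forall f, V f -> V (X f))
  (VJ : forall f, V f -> V (J f)) (VK : forall f, V f -> V (K f)).
Hypothesis Xsym : forall f g, V f -> V g -> ip (X f) g = ip f (X g).
Hypothesis Jasym : forall f g, V f -> V g -> ip (J f) g = - ip f (J g).
Hypothesis JJ : forall f, J (J f) = - f.
Hypothesis XJ : forall f, X (J f) = J (X f).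
Hypothesis X_le1 : forall f, V f -> ip (X f) (X f) <= ip f f.
Hypothesis Xlin : linear X.
Hypothesis Jlin : linear J.

(** Over the reals, each complex direction z n contributes z n and i z n. *)
Definition zJ n := if odd n then J (z n./2) else z n./2.

Hypothesis Vz : forall n, V (z n).
Hypothesis orth : forall m n, m != n -> ip (zJ m) (zJ n) = 0.
Hypothesis total : forall f, V f -> (forall n, ip f (zJ n) = 0) -> ip f f = 0.

Let lam n : R := (n./2.+1 * n./2.+2)%:R.
Hypothesis KE : forall f n, V f -> ip (K f) (zJ n) = - (lam n)^-1 * ip f (zJ n).
Variable c : R.
Hypothesis Xz0 : X (z 0%N) = c *: z 1%N.

Let si : semi_inner V ip.
Proof.
split=> [a f g h Vf Vg Vh|f g Vf Vg|f Vf].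
- by apply: siW.(si_lin); apply: VW.
- by apply: siW.(si_sym); apply: VW.
- by apply: siW.(si_ge0); apply: VW.
Qed.

Let cV : complete_for V ip.
Proof.
move=> u Vu uC; have [f Wf fP] := cW (fun n => VW (Vu n)) uC.
by exists f => //; apply: (Vclosed Vu Wf fP).
Qed.

Let Ve n : V (zJ n). Proof. by rewrite /zJ; case: ifP => _; [apply: VJ|]. Qed.

Let h0 := ip (z 0%N) (z 0%N).
(** lead is the projection P on z 0. The operator 1 + 6 K has the eigenvalues
1 - 6 / lambda_l, which are -2, 0, 1/2, ...; adding 2 P moves the only negative
one to 0, and D satisfies 0 <= D <= 1. *)
Definition lead f := (ip f (z 0%N) / h0) *: z 0%N + (ip f (J (z 0%N)) / h0) *: J (z 0%N).
Definition Dpos f := f + 6 *: K f + 2 *: lead f.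
Definition Mop f := X (f + 6 *: K f).
Notation D := Dpos.
Notation T := (XD Dpos X).

Let V0 : V 0. Proof. exact: (subsp0 VS). Qed.
Let vZ a f : V f -> V (a *: f). Proof. exact: (subspZ VS). Qed.
Let vD f g : V f -> V g -> V (f + g). Proof. exact: (subspD VS). Qed.
Let vN f : V f -> V (- f). Proof. exact: (subspN VS). Qed.
Let Vlead f : V f -> V (lead f).
Proof. by move=> Vf; rewrite /lead; apply: vD; apply: vZ => //; apply: VJ. Qed.
Let VD f : V f -> V (D f).
Proof.
by move=> Vf; rewrite /D; apply: vD; [apply: vD => //|]; apply: vZ; [apply: VK|apply: Vlead].
Qed.
Let VM f : V f -> V (Mop f).
Proof. by move=> Vf; apply: VX; apply: vD => //; apply: vZ; apply: VK. Qed.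
Let VT f : V f -> V (T f). Proof. by move=> Vf; apply/VX/VD. Qed.

Ltac inV := solve [repeat first [assumption | match goal with
  | |- V 0 => exact V0
  | |- V (_ *: _) => apply vZ
  | |- V (_ + _) => apply vD
  | |- V (- _) => apply vN
  | |- V (XD _ _ _) => apply VT
  | |- V (Dpos _) => apply VD
  | |- V (lead _) => apply Vlead
  | |- V (Mop _) => apply VM
  | |- V (z _) => apply Vz
  | |- V (zJ _) => apply Ve
  | |- V (X _) => apply VX
  | |- V (K _) => apply VK
  | |- V (J _) => apply VJ end]].
Tactic Notation "rw" uconstr(l) := rewrite l; [|inV..].
Ltac ip_expand s := do ?[rw (ipDl s)|rw (ipDr VS s)|rw (ipNl VS s)|
  rw (ipNr VS s)|rw (ipZl VS s)|rw (ipZr VS s)].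

Definition dcoef n : R := if (n < 2)%N then 0 else 1 - 6 / lam n.

Let h1 : ip (J (z 0%N)) (J (z 0%N)) = h0.
Proof. by rw Jasym; rewrite JJ; rw (ipNr VS si); rewrite opprK. Qed.

Lemma lead_coef f n : V f -> ip (lead f) (zJ n) = if (n < 2)%N then ip f (zJ n) else 0.
Proof.
move=> Vf; have e0 : zJ 0 = z 0%N by []. have e1 : zJ 1 = J (z 0%N) by [].
have Wf := VW Vf.
rewrite /lead; ip_expand si.
rewrite -[ip (z 0%N) (zJ n)]/(ip (zJ 0) (zJ n)) -[ip (J _) (zJ n)]/(ip (zJ 1) (zJ n)).
have c0 := coef_divK WS siW VW Ve 0%N Wf; have c1 := coef_divK WS siW VW Ve 1%N Wf.
rewrite /= e0 e1 h1 -/h0 in c0 c1.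
case: n => [|[|n]] /=.
- by rewrite (orth (m := 1%N) (n := 0%N))// mulr0 addr0.
- by rewrite (orth (m := 0%N) (n := 1%N))// mulr0 add0r e1 h1.
- by rewrite !orth// !mulr0 addr0.
Qed.

Lemma D_coef f n : V f -> ip (D f) (zJ n) = dcoef n * ip f (zJ n).
Proof.
move=> Vf; have := lead_coef n Vf; have := Vlead Vf; rewrite /D.
move: (lead f) => l Vl lE; ip_expand si; rewrite KE// lE /dcoef.
case: n lE => [|[|n]]/= _; rewrite /lam/=.
- by field.
- by field.
- by ring.
Qed.

Lemma dcoef_ge0 n : 0 <= dcoef n.
Proof.
rewrite /dcoef; case: ltnP => // n2; rewrite subr_ge0 ler_pdivrMr ?ltr0n//.
rewrite mul1r /lam ler_nat; have : (1 <= n./2)%N by exact: (half_leq n2).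
by case: n./2 => // k _; rewrite (@leq_mul 2 3).
Qed.

Lemma dcoef_le1 n : dcoef n <= 1.
Proof. by rewrite /dcoef; case: ifP => // _; rewrite gerBl divr_ge0. Qed.

Lemma D_sym f g : V f -> V g -> ip (D f) g = ip f (D g).
Proof.
move=> Vf Vg.
apply: (parseval_eq WS siW cW VS VW Vclosed Ve orth total); [inV|inV|by apply: VW; inV..|].
by move=> k; rewrite !D_coef//; ring.
Qed.

Lemma K_sym f g : V f -> V g -> ip (K f) g = ip f (K g).
Proof.
move=> Vf Vg.
apply: (parseval_eq WS siW cW VS VW Vclosed Ve orth total); [inV|inV|by apply: VW; inV..|].
by move=> k; rewrite !KE//; ring.
Qed.

Lemma D_ge0 f : V f -> 0 <= ip (D f) f.
Proof.
move=> Vf; rewrite -(ip0l WS siW (VW Vf)).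
apply: (parseval_le WS siW cW VS VW Vclosed Ve orth total); [inV|inV|by apply: VW; inV..|].
move=> k; rewrite D_coef// (ip0l VS si (Ve k)) mul0r -mulrA.
by rewrite mulr_ge0 ?dcoef_ge0// -expr2 sqr_ge0.
Qed.

Lemma D_le1 f : V f -> ip (D f) f <= ip f f.
Proof.
move=> Vf.
apply: (parseval_le WS siW cW VS VW Vclosed Ve orth total); [inV|inV|by apply: VW; inV..|].
by move=> k; rewrite D_coef// -mulrA ler_piMl ?dcoef_le1// -expr2 sqr_ge0.
Qed.

Lemma eqv_coef f g : V f -> V g -> (forall n, ip f (zJ n) = ip g (zJ n)) -> eqv V ip f g.
Proof.
move=> Vf Vg fg; apply/(eqvP VS si) => //; apply: total; first by inV.
by move=> n; ip_expand si; rewrite fg subrr.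
Qed.

Lemma J_zJ n : J (zJ n) = zJ (if odd n then n.-1 else n.+1) \/
  J (zJ n) = - zJ (if odd n then n.-1 else n.+1).
Proof.
rewrite /zJ; case: ifPn => on.
  by right; case: n on => //= n on; rewrite (negbTE on) JJ uphalf_half (negbTE on).
by left => /=; rewrite on uphalf_half (negbTE on).
Qed.

Lemma D_J f g : V f -> V g -> ip (D (J f)) g = ip (J (D f)) g.
Proof.
move=> Vf; move: g; apply: eqv_coef; [inV..|] => n.
rw D_coef; rw Jasym; rw Jasym.
have dn : dcoef (if odd n then n.-1 else n.+1) = dcoef n.
  have hp : (if odd n then n.-1 else n.+1)./2 = n./2.
    case: ifPn => on; last by rewrite /= uphalf_half (negbTE on).
    by case: n on => //= n on; rewrite uphalf_half (negbTE on).
  have lt2 k : (k < 2)%N = (k./2 == 0)%N by case: k => [|[|]].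
  by rewrite /dcoef !lt2 /lam hp.
have VDf := VD Vf; case: (J_zJ n) => ->; last do 2 (rw (ipNr VS si));
  by rewrite D_coef// dn; ring.
Qed.

(** D vanishes on z 1, because lambda_2 = 6. *)
Let D_0 f : V f -> (forall n, (n == 2%N) || (n == 3%N) || (ip f (zJ n) == 0)) ->
  forall g, V g -> ip (D f) g = 0.
Proof.
move=> Vf f0 g Vg; rewrite -[RHS](ip0l VS si Vg).
move: g Vg; apply: eqv_coef; [inV..|] => n.
rw D_coef; rw (ip0l VS si).
case/orP: (f0 n) => [/orP[|]/eqP->|/eqP->]; last by rewrite mulr0.
  by rewrite /dcoef /lam/= [X in X * _](_ : _ = 0) ?mul0r//; field.
by rewrite /dcoef /lam/= [X in X * _](_ : _ = 0) ?mul0r//; field.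
Qed.

(** X P has range spanned by th and Jth, multiples of z 1 and i z 1. *)
Let th := X (z 0%N).
Let Jth := X (J (z 0%N)).
Let Vth : V th. Proof. by rewrite /th; inV. Qed.
Let VJth : V Jth. Proof. by rewrite /Jth; inV. Qed.

Let thE n : n != 2%N -> ip th (zJ n) = 0.
Proof.
move=> n2; rewrite /th Xz0; ip_expand si.
by rewrite -[z 1%N]/(zJ 2) orth ?mulr0// eq_sym.
Qed.

Let JthE n : n != 3%N -> ip Jth (zJ n) = 0.
Proof.
move=> n2; rewrite /Jth XJ Xz0 -[_ *: _]addr0 Jlin.
have J0 : J 0 = 0 by have := Jlin (-1) 0 0; rewrite addr0 !scaleN1r oppr0 addNr.
rewrite J0 addr0; ip_expand si.
by rewrite -[J (z 1%N)]/(zJ 3) orth ?mulr0// eq_sym.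
Qed.

Let Dth g : V g -> ip (D th) g = 0.
Proof. by apply: D_0 => // n; case: eqVneq => //= n2; rewrite thE// eqxx orbT. Qed.
Let DJth g : V g -> ip (D Jth) g = 0.
Proof.
by apply: D_0 => // n; case: (eqVneq n 3%N) => [|n3]; rewrite ?orbT// JthE// eqxx orbT.
Qed.

Let Rop f := (ip f (z 0%N) / h0) *: th + (ip f (J (z 0%N)) / h0) *: Jth.
Let VR f : V f -> V (Rop f).
Proof. by move=> Vf; rewrite /Rop; apply: vD; apply: vZ. Qed.

Let X0 : X 0 = 0.
Proof. by have := Xlin (-1) 0 0; rewrite addr0 !scaleN1r oppr0 addNr. Qed.
Let XZ a f : X (a *: f) = a *: X f.
Proof. by rewrite -[a *: f]addr0 Xlin X0 addr0. Qed.
Let XDd f g : X (f + g) = X f + X g.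
Proof. by rewrite -[f in LHS]scale1r Xlin scale1r. Qed.

(** Hence Mop = X (D - 2 P) = T - 2 X P, where T X P = 0. *)
Let ME f : Mop f = T f - 2 *: Rop f.
Proof.
rewrite /Mop /XD /Dpos; move: (f + 6 *: K f) => u.
by rewrite XDd XZ /lead XDd !XZ -/th -/Jth -/(Rop f) addrK.
Qed.

(** The range of T is orthogonal to z 0 and i z 0, since X z 0 is in the kernel
of D. So is the range of X P, and Mop - lambda acts as - lambda on the
coefficients of z 0. *)
Let T_z0 f : V f -> ip (T f) (z 0%N) = 0.
Proof.
by move=> Vf; rewrite /XD; rw Xsym; rw D_sym; rw si.(si_sym); apply: Dth.
Qed.
Let T_Jz0 f : V f -> ip (T f) (J (z 0%N)) = 0.
Proof.
by move=> Vf; rewrite /XD; rw Xsym; rw D_sym; rw si.(si_sym); apply: DJth.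
Qed.

Let th_z0 : ip th (z 0%N) = 0. Proof. by rewrite -[z 0%N]/(zJ 0) thE. Qed.
Let th_Jz0 : ip th (J (z 0%N)) = 0.
Proof. by rewrite -[J (z 0%N)]/(zJ 1) thE. Qed.
Let Jth_z0 : ip Jth (z 0%N) = 0. Proof. by rewrite -[z 0%N]/(zJ 0) JthE. Qed.
Let Jth_Jz0 : ip Jth (J (z 0%N)) = 0.
Proof. by rewrite -[J (z 0%N)]/(zJ 1) JthE. Qed.


Section Lambda.
Variables a b : R.
Hypothesis b0 : b != 0.
Let m := a ^+ 2 + b ^+ 2.
Let m0 : 0 < m. Proof. by rewrite ltr_wpDl ?sqr_ge0// exprn_even_gt0. Qed.

Definition Ml f := Mop f - a *: f - b *: J f.
Notation Tl := (XDl Dpos X J a b).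

Let VTl f : V f -> V (Tl f). Proof. by move=> Vf; rewrite /XDl; inV. Qed.
Let VMl f : V f -> V (Ml f). Proof. by move=> Vf; rewrite /Ml; inV. Qed.

Let MlE f : Ml f = Tl f - 2 *: Rop f.
Proof. by rewrite /Ml ME /XDl (addrAC (T f)) [LHS]addrAC. Qed.

(** The pairings of f with z 0 and i z 0, recovered from those of g = Ml f by
dividing by - lambda. Thus rho g = 2 X P f, and Ml f = g amounts to
(T - lambda) f = g + rho g, with an explicit right-hand side. *)
Let xc g := - (a * ip g (z 0%N) + b * ip g (J (z 0%N))) / m.
Let yc g := (b * ip g (z 0%N) - a * ip g (J (z 0%N))) / m.
Let rho g := (2 * xc g / h0) *: th + (2 * yc g / h0) *: Jth.
Let Vrho g : V (rho g). Proof. by rewrite /rho; apply: vD; apply: vZ. Qed.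

Let Tl_coef f : V f -> xc (Tl f) = ip f (z 0%N) /\ yc (Tl f) = ip f (J (z 0%N)).
Proof.
move=> Vf; rewrite /xc /yc /XDl; ip_expand si.
rewrite T_z0// T_Jz0//; rw (Jasym Vf (Vz 0)); rw (Jasym Vf (VJ (Vz 0))).
rewrite JJ; rw (ipNr VS si); rewrite /m.
have n0 : a ^+ 2 + b ^+ 2 != 0 by rewrite gt_eqF.
by split; field.
Qed.

Let rho_coef g : ip (rho g) (z 0%N) = 0 /\ ip (rho g) (J (z 0%N)) = 0.
Proof.
rewrite /rho; ip_expand si; rewrite th_z0 Jth_z0 th_Jz0 Jth_Jz0; split; ring.
Qed.

Let Rop_rho f : V f -> 2 *: Rop f = rho (Tl f).
Proof.
move=> Vf; have [xE yE] := Tl_coef Vf.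
by rewrite /rho xE yE /Rop scalerDr !scalerA !mulrA.
Qed.

Let rho_eq g g' : V g -> V g' -> ip g (z 0%N) = ip g' (z 0%N) ->
  ip g (J (z 0%N)) = ip g' (J (z 0%N)) -> rho g = rho g'.
Proof. by move=> Vg Vg' e1 e2; rewrite /rho /xc /yc e1 e2. Qed.

Let h0_ge0 : 0 <= h0. Proof. exact: si.(si_ge0). Qed.

Let coef_le g : V g -> xc g ^+ 2 + yc g ^+ 2 <= 2 * h0 / m * ip g g.
Proof.
move=> Vg.
have -> : xc g ^+ 2 + yc g ^+ 2 = (ip g (z 0%N) ^+ 2 + ip g (J (z 0%N)) ^+ 2) / m.
  rewrite /xc /yc /m; have n0 : a ^+ 2 + b ^+ 2 != 0 by rewrite gt_eqF.
  by field.
rewrite mulrAC ler_pM2r ?invr_gt0//.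
have := cauchy_schwarz VS si Vg (Vz 0); have := cauchy_schwarz VS si Vg (VJ (Vz 0)).
rewrite h1 -/h0; lra.
Qed.

Let rho_le : exists2 C, 0 <= C & forall g, V g -> ip (rho g) (rho g) <= C * ip g g.
Proof.
pose k := 2 * (2 / h0) ^+ 2; pose S := ip th th + ip Jth Jth.
have k0 : 0 <= k by rewrite mulr_ge0// sqr_ge0.
have t0 := si.(si_ge0) Vth; have j0 := si.(si_ge0) VJth.
exists (k * S * (2 * h0 / m)).
  have S0 : 0 <= S by rewrite /S addr_ge0.
  by apply: mulr_ge0; [exact: mulr_ge0|apply: divr_ge0; [exact: mulr_ge0|exact: ltW]].
move=> g Vg; rewrite /rho.
apply: le_trans (QD_le VS si (vZ _ Vth) (vZ _ VJth)) _.
rewrite !(QZ VS si)//.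
apply: (@le_trans _ _ (k * S * (xc g ^+ 2 + yc g ^+ 2))); last first.
  have S0 : 0 <= S by rewrite /S addr_ge0.
  by rewrite -[leRHS]mulrA; apply: ler_wpM2l; [exact: mulr_ge0|exact: coef_le].
rewrite (_ : 2 * _ + _ = k * (xc g ^+ 2 * ip th th + yc g ^+ 2 * ip Jth Jth)).
  rewrite -mulrA ler_wpM2l// /S.
  have := mulr_ge0 (sqr_ge0 (xc g)) j0; have := mulr_ge0 (sqr_ge0 (yc g)) t0.
  lra.
by rewrite /k; ring.
Qed.

Lemma Ml_onto g : V g -> exists2 f, V f & eqv V ip (Ml f) g.
Proof.
move=> Vg; have Vg' : V (g + rho g) by apply: vD.
have [f Vf fE] := XDl_onto VS si cV VD VX VJ D_sym Xsym Jasym (fun f _ => JJ f)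
  D_J (fun f g Vf Vg => congr1 (fun h => ip h g) (XJ f)) D_ge0 D_le1 X_le1 a b0 Vg'.
exists f => // x Vx; rewrite MlE Rop_rho// (rho_eq (g' := g))//.
- have Vr := Vrho g; have VTf := VTl Vf.
  by rewrite (ipBl VS si)// fE// (ipDl si)// addrK.
- exact: VTl.
- by rewrite fE// (ipDl si)// (rho_coef g).1 addr0.
- have VJz : V (J (z 0%N)) by inV.
  by rewrite fE// (ipDl si)// (rho_coef g).2 addr0.
Qed.

Lemma Ml_bound : exists2 C, 0 <= C & forall f, V f -> ip f f <= C * ip (Ml f) (Ml f).
Proof.
have [C C0 CP] := rho_le.
have b2 : 0 < b ^+ 2 by rewrite exprn_even_gt0.
pose k := (2 / b ^+ 2 + 2) / m.
have k0 : 0 <= k.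
  by rewrite divr_ge0 ?(ltW m0)// addr_ge0// divr_ge0// ltW.
exists (k * (2 + 2 * C)) => [|f Vf]; first by rewrite mulr_ge0//; lra.
have VTf := VTl Vf; have VMf := VMl Vf.
apply: le_trans (XDl_bound VS si VD VX VJ D_sym Xsym Jasym (fun f _ => JJ f)
  D_J (fun f g Vf Vg => congr1 (fun h => ip h g) (XJ f)) D_ge0 D_le1 X_le1 a b0 Vf) _.
rewrite -/m -/k -[leRHS]mulrA; apply: ler_wpM2l => //.
have TE : Tl f = Ml f + rho (Ml f).
  rewrite MlE Rop_rho// (rho_eq (g := Tl f - rho (Tl f)) (g' := Tl f)) ?subrK//.
  - by have Vr := Vrho (Tl f); apply: vD => //; apply: vN.
  - by have Vr := Vrho (Tl f); rewrite (ipBl VS si)// (rho_coef _).1 subr0.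
  - have VJz : V (J (z 0%N)) by inV.
    by have Vr := Vrho (Tl f); rewrite (ipBl VS si)// (rho_coef _).2 subr0.
rewrite TE; apply: le_trans (QD_le VS si VMf (Vrho _)) _.
by have := CP _ VMf; rewrite mulrDl; lra.
Qed.

(** K is an arbitrary function with given coefficients; it is linear modulo null
vectors because it is its own adjoint. *)
Lemma Ml_sub f g : V f -> V g -> eqv V ip (Ml (f - g)) (Ml f - Ml g).
Proof.
move=> Vf Vg h Vh; have VXh := VX Vh.
have MA u : V u -> ip (Mop u) h = ip u (X h) + 6 * ip u (K (X h)).
  by move=> Vu; rewrite /Mop; rw Xsym; ip_expand si; rw K_sym.
have VMf := VM Vf; have VMg := VM Vg.
have VMfg : V (Mop (f - g)) by inV.
rewrite /Ml; ip_expand si; do 3 (rw MA); do 3 (rw Jasym); ip_expand si; ring.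
Qed.

(** For the same reason the operator respects classes. *)
Lemma Ml_null f : V f -> ip f f = 0 -> ip (Ml f) (Ml f) = 0.
Proof.
move=> Vf f0; have N h : V h -> ip f h = 0 by move=> Vh; exact: (null_ip VS si Vf Vh f0).
suff H h : V h -> ip (Ml f) h = 0.
  by apply: H; have VMf := VM Vf; rewrite /Ml; inV.
move=> Vh; have VMf := VM Vf; have VXh := VX Vh.
rewrite /Ml; ip_expand si; rewrite /Mop; rw Xsym; ip_expand si; rw K_sym; rw Jasym.
by do 4 (rw N); ring.
Qed.

End Lambda.
End RealSpectrum.

(** * Integration over the sphere *)

Section SphereIntegral.
Variable R : realType.
Notation mu := (@area R).
Notation leb := (@lebesgue_measure R).
Notation leb2 := (leb \x leb)%E.
Notation rect := (@coord_rect R).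
Notation sph := (@spherical R).

Lemma measurable_rect : measurable rect.
Proof. by apply: measurableX; exact: measurable_itv. Qed.

Lemma measurable_sin : measurable_fun [set: R] (@sin R).
Proof. by apply: continuous_measurable_fun; exact: continuous_sin. Qed.

Let msin1 D : measurable_fun D (fun p : R * R => (sin p.1)%:E).
Proof.
apply/measurable_funTS/measurable_EFinP; apply: measurableT_comp => //.
exact: measurable_sin.
Qed.

Lemma sin_rect_ge0 p : rect p -> 0 <= sin p.1 :> R.
Proof. by move=> [/= + _]; rewrite in_itv/= => p1; rewrite sin_ge0_pi. Qed.

Import HBNNSimple.

(** By definition the area integrates indicator functions in spherical
coordinates; linearity extends this to simple functions, monotone convergence
to nonnegative functions, and differences to integrable ones. *)
Lemma area_nnsfun (f : {nnsfun space3 R >-> R}) :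
  (\int[mu]_x (f x)%:E = \int[leb2]_(p in rect) ((f (sph p))%:E * (sin p.1)%:E))%E.
Proof.
have mr := measurable_rect.
rewrite integralT_nnsfun sintegralE.
transitivity (\int[leb2]_(p in rect)
    (\sum_(r \in range f) (r * \1_(f @^-1` [set r]) (sph p))%:E * (sin p.1)%:E))%E; last first.
  apply: eq_integral => p _; rewrite -ge0_mule_fsuml => [|r].
    by rewrite fsumEFin // -(fimfunE _ _).
  exact: nnfun_muleindic_ge0.
have mi r : measurable_fun rect (fun p => (\1_(f @^-1` [set r]) (sph p))%:E).
  apply/measurable_funTS/measurable_EFinP.
  apply: measurableT_comp; last exact: measurable_spherical.
  by [].
rewrite ge0_integral_fsum//; last 2 first.
  - move=> r; apply: emeasurable_funM; last exact: msin1.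
    by under eq_fun do rewrite EFinM; apply: measurable_funeM; exact: mi.
  - move=> r p rp; apply: mule_ge0; last by rewrite lee_fin sin_rect_ge0.
    by rewrite EFinM nnfun_muleindic_ge0.
apply: eq_fsbigr => r; rewrite inE => -[x _ <-].
under eq_integral do rewrite EFinM -muleA.
rewrite ge0_integralZl//.
- congr (_ * _)%E; rewrite [LHS]/= /area integral_mkcondr; apply: eq_integral => p _.
  rewrite patchE indicE (_ : (p \in _) = (sph p \in f @^-1` [set f x])); last by apply/idP/idP; rewrite !inE.
  case: ifPn => _; [by rewrite mul1e|by rewrite mul0e].
- by apply: emeasurable_funM; [exact: mi|exact: msin1].
- by move=> p rp; rewrite mule_ge0// lee_fin sin_rect_ge0.
- by rewrite lee_fin.
Qed.

Lemma ge0_integral_area (f : space3 R -> \bar R) : measurable_fun setT f ->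
  (forall x, 0 <= f x)%E ->
  (\int[mu]_x f x = \int[leb2]_(p in rect) (f (sph p) * (sin p.1)%:E))%E.
Proof.
move=> mf f0; have mr := measurable_rect.
pose f_ := nnsfun_approx measurableT mf.
have f_nd x : {homo (fun n => f_ n x) : a b / (a <= b)%N >-> a <= b}.
  by move=> a b ab; exact/lefP/nd_nnsfun_approx.
transitivity (lim (\int[mu]_x (f_ n x)%:E @[n --> \oo])%E).
  rewrite -monotone_convergence//=.
  - by apply: eq_integral => x _; apply/esym/cvg_lim => //=; exact: cvg_nnsfun_approx.
  - by move=> n; exact/measurable_EFinP/measurable_funTS.
  - by move=> n x _; rewrite lee_fin.
  - by move=> x _ a b ab; rewrite lee_fin; exact: f_nd.
under eq_fun do rewrite area_nnsfun.
rewrite -monotone_convergence//=.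
- apply: eq_integral => p _; apply/cvg_lim => //.
  apply: cvgeZr; first by [].
  exact: cvg_nnsfun_approx.
- move=> n; apply: emeasurable_funM; last exact: msin1.
  apply/measurable_funTS/measurable_EFinP.
  by apply: measurableT_comp => //; exact: measurable_spherical.
- by move=> n p rp; rewrite mule_ge0// lee_fin ?sin_rect_ge0.
- move=> p rp a b ab; rewrite lee_wpmul2r ?lee_fin ?sin_rect_ge0//; exact: f_nd.
Qed.

Lemma integral_area (f : space3 R -> R) : measurable_fun setT f ->
  (\int[mu]_x (f x)%:E = \int[leb2]_(p in rect) (f (sph p) * sin p.1)%:E)%E.
Proof.
move=> mf; rewrite [LHS]integralE [RHS]integralE.
have mE : measurable_fun setT (EFin \o f) by exact/measurable_EFinP.
congr (_ - _)%E; rewrite ge0_integral_area//.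
- apply: eq_integral => p /[!inE] /sin_rect_ge0 s0.
  by rewrite !funeposE/= -!EFin_max -EFinM maxr_pMl// mul0r.
- exact: measurable_funepos.
- apply: eq_integral => p /[!inE] /sin_rect_ge0 s0.
  by rewrite !funenegE/= -!EFin_max -EFinM maxr_pMl// mul0r mulNr.
- exact: measurable_funeneg.
Qed.

Lemma Rintegral_area (f : space3 R -> R) : measurable_fun setT f ->
  \int[mu]_x f x = \int[leb2]_(p in rect) (f (sph p) * sin p.1).
Proof. by move=> mf; rewrite /Rintegral integral_area. Qed.

Lemma rect_lty : (leb2 rect < +oo)%E.
Proof.
rewrite /coord_rect product_measure1E//=; try exact: measurable_itv.
rewrite !lebesgue_measure_itv/=; do 2 case: ifP => _; rewrite -?EFinB -?EFinM ?mule0 ?mul0e ltry//.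
Qed.

Lemma area_lty : (mu setT < +oo)%E.
Proof.
have mr := measurable_rect.
rewrite /= /area preimage_setT setIT; apply: le_lt_trans rect_lty.
rewrite -[leRHS]mul1e -integral_cst//; apply: ge0_le_integral => //.
- by move=> p rp; rewrite lee_fin sin_rect_ge0.
- exact: msin1.
- by move=> p _; rewrite lee_fin sin_le1.
Qed.

End SphereIntegral.

Lemma area_finite (R : realType) : fin_num_fun (@area R).
Proof. by apply: lty_fin_num_fun; exact: area_lty. Qed.

HB.instance Definition _ (R : realType) :=
  @Measure_isFinite.Build _ _ R (@area R) (@area_finite R).

(** * Square integrable functions for a finite measure *)

Section L2.
Context d (T : measurableType d) (R : realType).
Variable mu : {finite_measure set T -> \bar R}.
Implicit Types f g h : T -> R.
Notation L2 f := (f \in Lfun mu 2%:E).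

Lemma L2P f : L2 f <->
  measurable_fun setT f /\ mu.-integrable setT (EFin \o (fun x => f x ^+ 2)).
Proof.
split=> [fL|[mf /integrableP[_ f2]]].
  split; last exact: Lfun2_integrable_sqr.
  by move: fL; rewrite inE => /andP[]; rewrite inE.
rewrite inE; apply/andP; split; rewrite inE//= /finite_norm unlock /Lnorm.
apply: poweR_lty; apply: le_lt_trans f2; rewrite le_eqVlt; apply/orP; left; apply/eqP.
by apply: eq_integral => x _ /=; rewrite powR_mulrn// real_normK ?num_real// ger0_norm ?sqr_ge0.
Qed.

Lemma L2_measurable f : L2 f -> measurable_fun setT f.
Proof. by move/L2P => []. Qed.

Lemma L2_mul f g : L2 f -> L2 g -> mu.-integrable setT (EFin \o (fun x => f x * g x)).
Proof.
by move=> fL gL; apply/Lfun1_integrable; exact: Lfun2_mul_Lfun1.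
Qed.

Lemma L2_lin a f g : L2 f -> L2 g -> L2 (fun x => a * f x + g x).
Proof. by move=> fL gL; exact: (Lfun_submod_closed mu (lee1n 2)).2. Qed.

Lemma L2_0 : L2 (fun=> 0).
Proof. by have := (Lfun_submod_closed mu (lee1n 2)).1. Qed.

Lemma L2_bounded_mul C f g : measurable_fun setT g ->
  {ae mu, forall x, `|g x| <= C} -> L2 f -> L2 (fun x => g x * f x).
Proof.
move=> mg gC fL; have [mf f2] := (L2P f).1 fL.
apply/L2P; split; first exact: measurable_funM.
have mgf : measurable_fun setT (fun x => (g x * f x) ^+ 2).
  by apply: measurable_funX; exact: measurable_funM.
apply/integrableP; split; first exact/measurable_EFinP.
have i2 := integrableZl measurableT (C ^+ 2) f2.
have /integrableP[m2 lt2] := i2; apply: le_lt_trans lt2.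
apply: ae_ge0_le_integral => //.
- by apply: measurableT_comp => //; exact/measurable_EFinP.
- exact: measurableT_comp.
- apply: filterS gC => x gx _.
  have g2 : g x ^+ 2 <= C ^+ 2.
    by rewrite -real_normK ?num_real// ler_sqr ?nnegrE// (le_trans _ gx).
  rewrite /= lee_fin exprMn !ger0_norm; [|by apply: mulr_ge0; exact: sqr_ge0..].
  by apply: ler_wpM2r => //; exact: sqr_ge0.
Qed.

Definition dot f g := \int[mu]_x (f x * g x).

Lemma dot_lin a f g h : L2 f -> L2 g -> L2 h ->
  dot (fun x => a * f x + g x) h = a * dot f h + dot g h.
Proof.
move=> fL gL hL; rewrite /dot -RintegralZl//; last exact: L2_mul.
rewrite -RintegralD//; last exact: L2_mul.
  by apply: eq_Rintegral => x _; rewrite mulrDl mulrA.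
exact: (integrableZl measurableT a (L2_mul fL hL)).
Qed.

Lemma dot0l h : dot (fun=> 0) h = 0.
Proof.
rewrite /dot /Rintegral integral0_eq// => x _ /=; by rewrite mul0r.
Qed.

Lemma dotZl a f h : L2 f -> L2 h -> dot (fun x => a * f x) h = a * dot f h.
Proof.
move=> fL hL; have := dot_lin a fL L2_0 hL; rewrite dot0l addr0 => <-.
by congr dot; apply/funext => x; rewrite addr0.
Qed.

Lemma L2Z a f : L2 f -> L2 (fun x => a * f x).
Proof. by move=> fL; have := L2_lin a fL L2_0; under eq_fun do rewrite addr0. Qed.

Lemma dotC f g : dot f g = dot g f.
Proof. by apply: eq_Rintegral => x _; rewrite mulrC. Qed.

Lemma dot_ge0 f : 0 <= dot f f.
Proof. by apply: Rintegral_ge0 => x _; rewrite -expr2 sqr_ge0. Qed.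

Lemma dotE f : L2 f -> (dot f f)%:E = (\int[mu]_x (f x ^+ 2)%:E)%E.
Proof.
move=> fL; rewrite /dot /Rintegral fineK.
  by apply: eq_integral => x _; rewrite expr2.
by apply: integrable_fin_num => //; exact: L2_mul.
Qed.

Lemma dot_eq0 f : L2 f -> dot f f = 0 <-> {ae mu, forall x, f x = 0}.
Proof.
move=> fL; have mf := L2_measurable fL.
have mf2 : measurable_fun setT (EFin \o (fun x => f x ^+ 2)).
  by apply/measurable_EFinP; exact: measurable_funX.
have H := @ae_eq_integral_abs _ _ _ mu setT measurableT _ mf2.
have E : (\int[mu]_x `|(f x ^+ 2)%:E|)%E = (dot f f)%:E.
  by rewrite dotE//; apply: eq_integral => x _; rewrite /= ger0_norm ?sqr_ge0.
split=> [f0|f0].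
  have /H.1 : (\int[mu]_x `|(f x ^+ 2)%:E|)%E = 0%E by rewrite E f0.
  by apply: filterS => x /(_ I) /= [] /eqP; rewrite sqrf_eq0 => /eqP.
apply: EFin_inj; rewrite -E; apply/H.2.
by apply: filterS f0 => x /= -> _; rewrite expr0n.
Qed.

(** Integrate 2 |f| <= c f^2 + 1 / c, with c a power of two chosen to make the
increments in the next proof summable. *)
Let L2_bound f : L2 f -> forall k : nat,
  (\int[mu]_x `|(f x)%:E| <= ((2 ^+ k * dot f f + (2 ^+ k)^-1 * fine (mu setT)) / 2)%:E)%E.
Proof.
move=> fL k; have mf := L2_measurable fL.
have p0 : 0 < (2 : R) ^+ k by rewrite exprn_gt0.
have i2 : mu.-integrable setT (EFin \o (fun x => f x * f x)) by exact: L2_mul.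
pose g x := (2 ^+ k / 2) * (f x * f x) + (2 ^+ k)^-1 / 2.
have ig1 := integrableZl measurableT (2 ^+ k / 2) i2.
have ig2 := finite_measure_integrable_cst mu ((2 ^+ k)^-1 / 2) (A := setT).
have -> : ((2 ^+ k * dot f f + (2 ^+ k)^-1 * fine (mu setT)) / 2)%:E =
    (\int[mu]_x (g x)%:E)%E.
  rewrite -[RHS]fineK; last first.
    by apply: integrable_fin_num => //; exact: (integrableD measurableT ig1 (ig2 measurableT)).
  congr EFin; rewrite -/(Rintegral mu setT g) /g RintegralD//; last exact: ig2.
  rewrite RintegralZl// Rintegral_cst// /dot; ring.
apply: ge0_le_integral => //.
- by apply: measurableT_comp => //; exact/measurable_EFinP.
- apply/measurable_EFinP; apply: measurable_funD => //.
  by apply: measurable_funM => //; exact: measurable_funM.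
- move=> x _; rewrite /= lee_fin /g.
  have h : 0 <= (2 ^+ k * `|f x| - 1) ^+ 2 by exact: sqr_ge0.
  have ff : f x * f x = `|f x| ^+ 2 by rewrite real_normK ?num_real// expr2.
  rewrite ff -(ler_pM2l p0) -subr_ge0.
  rewrite (_ : _ - _ = (2 ^+ k * `|f x| - 1) ^+ 2 / 2); first by rewrite divr_ge0.
  by field; rewrite gt_eqF.
Qed.

(** Riesz-Fischer: a rapidly converging subsequence converges almost everywhere
because its increments are summable in L^1; Fatou's lemma makes the pointwise
limit the limit in mean square. *)
Lemma L2_complete (u : nat -> T -> R) : (forall n, L2 (u n)) ->
  (forall e, 0 < e -> exists N, forall m n, (N <= m)%N -> (N <= n)%N ->
    dot (fun x => u m x - u n x) (fun x => u m x - u n x) < e) ->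
  exists2 f, L2 f &
    (fun n => dot (fun x => u n x - f x) (fun x => u n x - f x)) @ \oo --> (0 : R).
Proof.
move=> uL uC; have mu_ n := L2_measurable (uL n).
have L2B f g : L2 f -> L2 g -> L2 (fun x => f x - g x).
  move=> fL gL; rewrite (_ : (fun x => _) = (fun x => -1 * g x + f x)).
    exact: L2_lin.
  by apply/funext => x; rewrite mulN1r addrC.
have eps_gt0 k : 0 < (4 : R)^-1 ^+ k.+1 by rewrite exprn_gt0// invr_gt0.
have /choice [phi phiP] : forall k : nat, exists N : nat, forall m n,
    (N <= m)%N -> (N <= n)%N ->
    dot (fun x => u m x - u n x) (fun x => u m x - u n x) < 4^-1 ^+ k.+1.
  by move=> k; exact: uC.
(* psi k >= phi k makes the squared norms of the increments D k smaller than
4^-(k+1), and psi is nondecreasing and unbounded. *)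
pose psi k := (\sum_(j < k.+1) phi j + k)%N.
have psi_phi k : (phi k <= psi k)%N.
  by rewrite /psi big_ord_recr/= -addnA -addnCA leq_addr.
have psiS k : (psi k <= psi k.+1)%N.
  by rewrite /psi [in leqRHS]big_ord_recr/= -addnA leq_add2l addnS -addSn leq_addl.
have psi_ge k : (k <= psi k)%N by rewrite /psi leq_addl.
pose D k x := u (psi k.+1) x - u (psi k) x.
have DL k : L2 (D k) by apply: L2B.
have mD k : measurable_fun setT (D k) := L2_measurable (DL k).
pose c := (1 + fine (mu setT)) / 2.
have D1 k : (\int[mu]_x `|(D k x)%:E| <= (c / (2 ^ (k + 1))%:R)%:E)%E.
  apply: le_trans (L2_bound (DL k) k.+1) _; rewrite lee_fin /c addn1.
  have d0 : dot (D k) (D k) <= _ :=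
    ltW (phiP k _ _ (leq_trans (psi_phi k) (psiS k)) (psi_phi k)).
  have p0 : 0 < (2 : R) ^+ k.+1 by rewrite exprn_gt0.
  have {}d0 : 2 ^+ k.+1 * dot (D k) (D k) <= (2 ^+ k.+1)^-1.
    apply: le_trans (ler_wpM2l (ltW p0) d0) _; rewrite -exprVn -exprMn.
    by rewrite (_ : 2 * 4^-1 = 2^-1)//; field.
  rewrite natrX -subr_ge0 (_ : _ - _ =
    ((2 ^+ k.+1)^-1 - 2 ^+ k.+1 * dot (D k) (D k)) / 2); last by ring.
  by rewrite divr_ge0// subr_ge0.
have sumD : (\int[mu]_x \sum_(k <oo) `|(D k x)%:E| < +oo)%E.
  rewrite integral_nneseries//; last first.
    by move=> k; apply: measurableT_comp => //; exact/measurable_EFinP.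
  apply: (@le_lt_trans _ _ (\sum_(k <oo) (c / (2 ^ (k + 1))%:R)%:E)%E).
    apply: lee_nneseries => k *; last exact: D1.
    by apply: integral_ge0 => x _; exact: abse_ge0.
  by rewrite (cvg_lim _ (@cvg_geometric_eseries_half R c 0))// ltry.
have cvu : {ae mu, forall x, cvgn (fun k => u (psi k) x)}.
  have iS : mu.-integrable setT (fun x => \sum_(k <oo) `|(D k x)%:E|)%E.
    apply/integrableP; split.
      apply: ge0_emeasurable_sum => // k _.
      by apply: measurableT_comp => //; exact/measurable_EFinP.
    by under eq_integral do rewrite gee0_abs ?nneseries_ge0//.
  have := integrable_ae measurableT iS; apply: filterS => x /(_ I) Sx.
  have cD : cvgn (series (D ^~ x)).
    apply: normed_cvg; apply: nondecreasing_is_cvgn.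
      by apply: nondecreasing_series => k _ _ /=.
    exists (fine (\sum_(k <oo) `|(D k x)%:E|)%E) => _ [n _ <-].
    rewrite -lee_fin fineK// /series/= -sumEFin.
    exact: nneseries_lim_ge.
  rewrite (_ : (fun k => u (psi k) x) = series (D ^~ x) \+ cst (u (psi 0%N) x)).
    by apply: is_cvgD => //; exact: is_cvg_cst.
  apply/funext => n /=; rewrite /series/= /D.
  by rewrite (telescope_sumr (fun k => u (psi k) x))// subrK.
pose f x := fine (limn_esup (fun k => (u (psi k) x)%:E)).
have mf : measurable_fun setT f.
  apply: measurableT_comp => //.
  by apply: measurable_fun_limn_esup => k; apply/measurable_EFinP.
have fE : {ae mu, forall x, (fun k => u (psi k) x) @ \oo --> f x}.
  apply: filterS cvu => x cx.
  have cE : (fun k => (u (psi k) x)%:E) @ \oo --> (limn (fun k => u (psi k) x))%:E.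
    by apply: cvg_EFin; [exact: nearW|exact: cx].
  by rewrite /f (cvg_limn_einf_sup cE).2.
(* Fatou along the subsequence, for fixed n. *)
have fatou_n n e : 0 < e -> (forall m, (n <= m)%N -> dot (fun x => u n x - u m x)
    (fun x => u n x - u m x) < e) ->
    (\int[mu]_x ((u n x - f x) ^+ 2)%:E <= e%:E)%E.
  move=> e0 H.
  pose v k x := ((u n x - u (psi k) x) ^+ 2)%:E.
  have mv k : measurable_fun setT (v k).
    by apply/measurable_EFinP; apply: measurable_funX; exact: measurable_funB.
  have -> : (\int[mu]_x ((u n x - f x) ^+ 2)%:E =
      \int[mu]_x limn_einf (fun k => v k x))%E.
    apply: ae_eq_integral => //.
    - by apply/measurable_EFinP; apply: measurable_funX; exact: measurable_funB.
    - rewrite (_ : (fun x => _) = (fun x => - limn_esup (-%E \o (fun k => v k x)))%E).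
        apply: measurableT_comp => //; apply: measurable_fun_limn_esup => k.
        exact: measurableT_comp.
      by apply/funext => x; rewrite limn_esupN oppeK.
    - apply: filterS fE => x fx _.
      have vc : (fun k => v k x) @ \oo --> ((u n x - f x) ^+ 2)%:E.
        apply: cvg_EFin; first exact: nearW.
        have h : (fun k => u n x - u (psi k) x) @ \oo --> u n x - f x.
          by apply: cvgB => //; exact: cvg_cst.
        by rewrite expr2; apply: cvgM.
      by rewrite (cvg_limn_einf_sup vc).1.
  have v0 k x : setT x -> (0 <= v k x)%E by rewrite lee_fin sqr_ge0.
  apply: le_trans (fatou mu measurableT mv v0) _.
  rewrite limn_einf_lim; apply: lime_le; first exact: is_cvg_einfs.
  apply: nearW => k; apply: (@le_trans _ _ (\int[mu]_x v (n + k)%N x)%E).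
    by apply: ereal_inf_lbound; exists (n + k)%N => //=; exact: leq_addl.
  rewrite /v -dotE; last exact: L2B.
  by rewrite lee_fin ltW// H// (leq_trans _ (psi_ge _))// leq_addr.
have uf_L2 n e : 0 < e -> (forall m, (n <= m)%N -> dot (fun x => u n x - u m x)
    (fun x => u n x - u m x) < e) -> L2 (fun x => u n x - f x).
  move=> e0 H; apply/L2P; split; first exact: measurable_funB.
  apply/integrableP; split.
    by apply/measurable_EFinP; apply: measurable_funX; exact: measurable_funB.
  apply: (@le_lt_trans _ _ e%:E); last exact: ltry.
  apply: le_trans (fatou_n n e e0 H); rewrite le_eqVlt; apply/orP; left; apply/eqP.
  by apply: eq_integral => x _; rewrite /= ger0_norm ?sqr_ge0.
have fL : L2 f.
  have [N NP] := uC 1 ltr01.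
  rewrite (_ : f = (fun x => u N x - (u N x - f x))).
    by apply: L2B => //; apply: (uf_L2 N 1 ltr01) => m; exact: NP.
  by apply/funext => x; rewrite subKr.
exists f => //; apply/cvgrPdist_le => e e0.
have [N NP] := uC e e0; exists N => // n /= Nn.
rewrite sub0r normrN ger0_norm ?dot_ge0// -lee_fin dotE; last exact: L2B.
by apply: fatou_n => // m nm; apply: NP => //; exact: leq_trans nm.
Qed.
End L2.

(** * Continuous functions on the sphere *)

(** A function measurable in u and continuous in y is the pointwise limit of the
jointly measurable functions obtained by rounding y to multiples of 1/n. *)
Lemma caratheodory_measurable d (U : measurableType d) (R : realType)
    (f : U * R -> R) :
  (forall y, measurable_fun setT (fun u => f (u, y))) ->
  (forall u, continuous (fun y => f (u, y))) -> measurable_fun setT f.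
Proof.
move=> mf cf.
pose r (n : nat) (y : R) : R := (Num.floor (y * n.+1%:R))%:~R / n.+1%:R.
have n0 (n : nat) : 0 < n.+1%:R :> R by rewrite ltr0n.
apply: (@measurable_fun_cvg _ _ _ setT (fun n p => f (p.1, r n p.2))) => [n|[u y] _].
  move=> _ B mB; rewrite setTI.
  rewrite (_ : _ @^-1` B = \bigcup_(k : int)
    ((fun u => f (u, k%:~R / n.+1%:R)) @^-1` B `*`
      `[k%:~R / n.+1%:R, (k + 1)%:~R / n.+1%:R[%classic)).
    apply: countable_bigcupT_measurable => // k.
    apply: measurableX; last exact: measurable_itv.
    by rewrite -[X in measurable X]setTI; exact: mf.
  have fl (k : int) (y : R) : (k%:~R / n.+1%:R <= y < (k + 1)%:~R / n.+1%:R) =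
      (Num.floor (y * n.+1%:R) == k).
    by rewrite floor_eq ler_pdivrMr// ltr_pdivlMr.
  apply/seteqP; split => [[u y] /= Bf|[u y] [k _] /= [Bf]].
    by exists (Num.floor (y * n.+1%:R)) => //; split => //=; rewrite in_itv/= fl.
  by rewrite in_itv/= fl /r => /eqP ->.
have rc : (fun n => r n y) @ \oo --> y.
  apply/cvgrPdist_le => e e0; near=> n.
  have /andP[l1 l2] := floor_itv (y * n.+1%:R).
  have ne : n.+1%:R^-1 < e by near: n; exact: (near_infty_natSinv_lt (PosNum e0)).
  apply: le_trans (ltW ne).
  rewrite -[leRHS]mul1r ler_pdivlMr// -[X in _ * X](gtr0_norm (n0 n)) -normrM.
  rewrite mulrBl divfK ?gt_eqF// ger0_norm ?subr_ge0//.
  by move: l2; rewrite intrD; lra.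
exact: (cvg_comp _ _ rc (cf u y)).
Unshelve. all: end_near. Qed.

Lemma continuous_pair (S T U : topologicalType) (f : S -> T) (g : S -> U) :
  continuous f -> continuous g -> continuous (fun x => (f x, g x)).
Proof. by move=> cf cg x; apply: cvg_pair; [exact: cf|exact: cg]. Qed.

Section ContinuousSphere.
Variable R : realType.
Notation mu := (@area R).
Notation rect := (@coord_rect R).
Notation sph := (@spherical R).

(** Continuity is with respect to the product topology and measurability with
respect to the product sigma-algebra of the line. *)
Lemma continuous_measurable2 (f : R * R -> R) : continuous f -> measurable_fun setT f.
Proof.
move=> cf; apply: caratheodory_measurable => [y|x].
  apply: continuous_measurable_fun => x; apply: (@continuous_comp _ _ _ (fun x => (x, y)) f); last exact: cf.
  by apply: (continuous_pair (f := id) (g := cst y)) => z; [exact: cvg_id|exact: cvg_cst].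
move=> y; apply: (@continuous_comp _ _ _ (fun y => (x, y)) f); last exact: cf.
by apply: (continuous_pair (f := cst x) (g := id)) => z; [exact: cvg_cst|exact: cvg_id].
Qed.

Lemma continuous_measurable3 (f : space3 R -> R) : continuous f -> measurable_fun setT f.
Proof.
move=> cf; apply: caratheodory_measurable => [y|x].
  apply: continuous_measurable2 => x; apply: (@continuous_comp _ _ _ (fun x => (x, y)) f); last exact: cf.
  by apply: (continuous_pair (f := id) (g := cst y)) => z; [exact: cvg_id|exact: cvg_cst].
move=> y; apply: (@continuous_comp _ _ _ (fun y => (x, y)) f); last exact: cf.
by apply: (continuous_pair (f := cst x) (g := id)) => z; [exact: cvg_cst|exact: cvg_id].
Qed.

Lemma continuous_spherical : continuous sph.
Proof.
have c1 : continuous (fun p : R * R => p.1) by move=> p; exact: cvg_fst.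
have c2 : continuous (fun p : R * R => p.2) by move=> p; exact: cvg_snd.
have cs1 : continuous (fun p : R * R => sin p.1).
  by move=> p; apply: continuous_comp; [exact: c1|exact: continuous_sin].
have cc1 : continuous (fun p : R * R => cos p.1).
  by move=> p; apply: continuous_comp; [exact: c1|exact: continuous_cos].
have cs2 : continuous (fun p : R * R => sin p.2).
  by move=> p; apply: continuous_comp; [exact: c2|exact: continuous_sin].
have cc2 : continuous (fun p : R * R => cos p.2).
  by move=> p; apply: continuous_comp; [exact: c2|exact: continuous_cos].
apply: continuous_pair => //; apply: continuous_pair => p.
  by apply: cvgM; [exact: cs1|exact: cc2].
by apply: cvgM; [exact: cs1|exact: cs2].
Qed.

Lemma compact_rect : compact rect.
Proof. by apply: compact_setX; exact: segment_compact. Qed.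

(** The area is carried by the image of the coordinate rectangle. *)
Lemma ae_area (P : space3 R -> Prop) : measurable [set x | P x] ->
  (forall p, rect p -> P (sph p)) -> {ae mu, forall x, P x}.
Proof.
move=> mP rP; exists (~` [set x | P x]); split => //; first exact: measurableC.
rewrite /= /area (_ : rect `&` _ = set0) ?integral_set0//.
by apply/seteqP; split => // p [rp]; apply; exact: rP.
Qed.

Lemma bounded_rect (g : R * R -> R) : continuous g ->
  exists C, forall p, rect p -> `|g p| <= C.
Proof.
move=> cg; have /compact_bounded [M [_ MP]] : compact (g @` rect).
  by apply: continuous_compact; [exact: continuous_subspaceT|exact: compact_rect].
exists (M + 1) => p rp; apply: (MP (M + 1)); [by rewrite ltrDl|by exists p].
Qed.

Lemma continuous_bounded_sphere (g : space3 R -> R) : continuous g ->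
  exists C, {ae mu, forall x, `|g x| <= C}.
Proof.
move=> cg.
have [|C CP] := @bounded_rect (g \o sph).
  by move=> p; apply: continuous_comp; [exact: continuous_spherical|exact: cg].
exists C; apply: ae_area => //.
have mg := continuous_measurable3 cg.
rewrite (_ : [set x | _] = g @^-1` `[- C, C]%classic).
  by rewrite -[X in measurable X]setTI; apply: mg => //; exact: measurable_itv.
by apply/seteqP; split => x /=; rewrite in_itv/= ler_norml.
Qed.

Lemma continuous_L2 (g : space3 R -> R) : continuous g -> g \in Lfun mu 2%:E.
Proof.
move=> cg; have [C CP] := continuous_bounded_sphere cg.
have := L2_bounded_mul (continuous_measurable3 cg) CP (Lfun_cst mu 1 2).
by under eq_fun do rewrite mulr1.
Qed.

End ContinuousSphere.

(** * Densities are determined by their polynomial moments *)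

Section Moments.
Context d (T : measurableType d) (R : realType).
Variable mu : {finite_measure set T -> \bar R}.
Implicit Types w v : T -> R.
Notation L1 w := (mu.-integrable setT (EFin \o w)).

Lemma L1_bounded_mul C w (g : T -> R) : L1 w -> measurable_fun setT g ->
  {ae mu, forall x, `|g x| <= C} -> L1 (fun x => w x * g x).
Proof.
move=> wi mg gC; have mw : measurable_fun setT w.
  by apply/measurable_EFinP; exact: measurable_int wi.
apply/integrableP; split; first by apply/measurable_EFinP; exact: measurable_funM.
have /integrableP[m2 lt2] := integrableZl measurableT C wi; apply: le_lt_trans lt2.
apply: ae_ge0_le_integral => //.
- by apply: measurableT_comp => //; apply/measurable_EFinP; exact: measurable_funM.
- exact: measurableT_comp.
- apply: filterS gC => x gx _; rewrite /= lee_fin !normrM mulrC.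
  by rewrite ler_wpM2r// (le_trans gx)// ler_norm.
Qed.

Lemma L1_indic w (U : Type) (X : T -> U) (S : set U) : L1 w -> measurable (X @^-1` S) ->
  L1 (fun x => w x * \1_S (X x)).
Proof.
move=> wi mS; apply: (@L1_bounded_mul 1) => //.
  rewrite (_ : (fun x => _) = \1_(X @^-1` S)); first exact: measurable_indic.
  by apply/funext => x; rewrite !indicE; congr (_%:R); congr nat_of_bool; apply/idP/idP; rewrite !inE.
by apply: aeW => x; rewrite indicE; case: (_ \in _); rewrite ?normr1 ?normr0.
Qed.

Lemma Rintegral_indic w (U : Type) (X : T -> U) (S : set U) :
  \int[mu]_x (w x * \1_S (X x)) = \int[mu]_(x in X @^-1` S) w x.
Proof.
rewrite [RHS]Rintegral_mkcond; apply: eq_Rintegral => x _.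
rewrite patchE indicE (_ : (x \in _) = (X x \in S)); last by apply/idP/idP; rewrite !inE.
by case: ifP => _; rewrite ?mulr1 ?mulr0.
Qed.

(** The sets S on which the signed density w integrates to 0 form a Dynkin
system. *)
Lemma pi_system_integral0 d' (U : measurableType d') (X : T -> U) (G : set (set U)) w :
  measurable_fun setT X -> L1 w ->
  @measurable _ U = <<s G >> -> setI_closed G ->
  \int[mu]_x w x = 0 ->
  (forall S, G S -> \int[mu]_x (w x * \1_S (X x)) = 0) ->
  forall S, measurable S -> \int[mu]_x (w x * \1_S (X x)) = 0.
Proof.
move=> mX wi UG GI w0 G0 S; rewrite UG => GS.
have mpre A : measurable A -> measurable (X @^-1` A).
  by move=> mA; rewrite -[X in measurable X]setTI; exact: mX.
move: S GS; apply: (dynkin_induction UG GI) => //.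
- by rewrite -[RHS]w0; apply: eq_Rintegral => x _; rewrite indicT mulr1.
- move=> S mS S0.
  have := RintegralB measurableT wi (L1_indic wi (mpre _ mS)).
  rewrite w0 S0 subrr => <-; apply: eq_Rintegral => x _.
  by rewrite -[X in X - _]mulr1 -mulrBr !indicE in_setC; case: (_ \in _); rewrite ?subrr ?subr0.
- move=> F mF tF F0; rewrite Rintegral_indic preimage_bigcup /Rintegral.
  rewrite integral_bigcup//; last 3 first.
  + apply/trivIsetP => i j _ _ ij; rewrite -preimage_setI.
    by move/trivIsetP : tF => /(_ _ _ I I ij) ->; rewrite preimage_set0.
  + by move=> k; exact: mpre.
  + apply: integrableS wi => //; apply: bigcup_measurable => k _; exact: mpre.
  rewrite eseries0// => k _ _.
  have := F0 k; rewrite Rintegral_indic /Rintegral => fk.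
  rewrite -[LHS]fineK ?fk//; apply: integrable_fin_num; first exact: mpre.
  by apply: integrableS wi => //; exact: mpre.
Qed.

End Moments.

Section StepApproximation.
Variable R : realType.

Lemma bernoulli_ineq (x : R) n : 0 <= x -> 1 + n%:R * x <= (1 + x) ^+ n.
Proof.
move=> x0; elim: n => [|n IH]; first by rewrite mul0r addr0 expr0.
rewrite exprS; have : 0 <= 1 + x by lra.
move/(ler_wpM2l) => /(_ _ _ IH); apply: le_trans.
rewrite -natr1; have : 0 <= n%:R * x * x by rewrite !mulr_ge0.
lra.
Qed.

Lemma bernoulli_ineqN (y : R) n : 0 <= y <= 1 -> 1 - n%:R * y <= (1 - y) ^+ n.
Proof.
move=> /andP[y0 y1]; elim: n => [|n IH]; first by rewrite mul0r subr0 expr0.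
rewrite exprS; have : 0 <= 1 - y by lra.
move/(ler_wpM2l) => /(_ _ _ IH); apply: le_trans.
rewrite -natr1; have : 0 <= n%:R * y * y by rewrite !mulr_ge0.
lra.
Qed.

Lemma expr_1B_le (y : R) n : 0 <= y <= 1 -> (1 - y) ^+ n <= (1 + n%:R * y)^-1.
Proof.
move=> /andP[y0 y1]; have h := bernoulli_ineq n y0.
have p0 : 0 < 1 + n%:R * y by rewrite ltr_wpDr// mulr_ge0.
rewrite -[leRHS]mul1r ler_pdivlMr//.
apply: (@le_trans _ _ ((1 - y) ^+ n * (1 + y) ^+ n)).
  by rewrite ler_wpM2l// exprn_ge0// subr_ge0.
by rewrite -exprMn exprn_ile1//; nra.
Qed.

(** n s^n = (n r^n) r^n for r^2 >= s, and n r^n is bounded by the Bernoulli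
inequality. *)
Lemma cvg_natM_expr (s : R) : 0 <= s < 1 -> (fun n => n%:R * s ^+ n) @ \oo --> (0 : R).
Proof.
move=> /andP[s0 s1]; pose r := (1 + s) / 2.
have r0 : 0 < r by rewrite /r; lra.
have r1 : r < 1 by rewrite /r; lra.
have sr : s <= r ^+ 2 by rewrite /r; have := sqr_ge0 (1 - s); nra.
pose de := r^-1 - 1.
have de0 : 0 < de by rewrite /de subr_gt0 invf_gt1.
have nr n : n%:R * r ^+ n <= de^-1.
  have := bernoulli_ineq n (ltW de0); rewrite /de addrCA subrr addr0 -/de exprVn.
  move=> h; rewrite -[leRHS]mul1r ler_pdivlMr//.
  have rn0 : 0 < r ^+ n by rewrite exprn_gt0.
  have := ler_wpM2l (ltW rn0) h; rewrite mulfV ?gt_eqF// => {}h.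
  by rewrite mulrAC mulrC; apply: le_trans h; rewrite ler_wpM2l ?ltW//; lra.
have lim : (fun n => de^-1 * r ^+ n) @ \oo --> (0 : R).
  rewrite -[X in _ --> X](mulr0 de^-1); apply: cvgMr; apply: cvg_expr.
  by rewrite ger0_norm ?ltW.
apply: (squeeze_cvgr _ _ lim); last exact: cvg_cst.
apply: nearW => n; rewrite mulr_ge0 ?exprn_ge0//=.
apply: (@le_trans _ _ (n%:R * r ^+ n * r ^+ n)); last first.
  by rewrite ler_wpM2r// ltW// exprn_gt0.
by rewrite -mulrA ler_wpM2l// -exprD addnn -mul2n exprM lerXn2r// nnegrE ?sqr_ge0.
Qed.

(** The polynomials (1 - t^n)^(n 2^n), with t affine in x and t = 1/2 at x = a,
converge on [-1, 1] to the indicator function of x < a: by the two Bernoulli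
inequalities the value is at least 1 - n (2 t)^n and at most 1 / (1 + n (2 t)^n). *)
Definition step_poly (a : R) (n : nat) : {poly R} :=
  (1 - ((2 * (1 + `|a|))^-1 *: ('X - a%:P) + 2^-1%:P) ^+ n) ^+ (n * 2 ^ n).

Lemma step_polyE a n x : (step_poly a n).[x] =
  (1 - ((x - a) / (2 * (1 + `|a|)) + 2^-1) ^+ n) ^+ (n * 2 ^ n).
Proof. by rewrite /step_poly !hornerE ?hornerXn /=; congr ((1 - (_ + _) ^+ n) ^+ _); rewrite mulrC. Qed.

Lemma step_poly_cvg a x : `|x| <= 1 ->
  (forall n, 0 <= (step_poly a n).[x] <= 1) /\
  (fun n => (step_poly a n).[x]) @ \oo --> (\1_(`]-oo, a[%classic) x : R).
Proof.
move=> x1.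
pose t := (x - a) / (2 * (1 + `|a|)) + 2^-1.
have a0 : 0 < 1 + `|a| by rewrite ltr_pwDl.
have xa : `|x - a| <= 1 + `|a| by rewrite (le_trans (ler_normB _ _))// lerD2r.
have t01 : 0 <= t <= 1.
  have := xa; rewrite ler_norml => /andP[l1 l2].
  have e : t = ((x - a) + (1 + `|a|)) / (2 * (1 + `|a|)) by rewrite /t; field; rewrite gt_eqF.
  have d0 : 0 < 2 * (1 + `|a|) by rewrite mulr_gt0.
  have n0 : 0 <= x - a + (1 + `|a|) by lra.
  by rewrite e divr_ge0 ?(ltW d0)//= ler_pdivrMr//; lra.
have tn n : 0 <= t ^+ n <= 1.
  by have /andP[? ?] := t01; rewrite exprn_ge0//= exprn_ile1.
have P01 n : 0 <= (step_poly a n).[x] <= 1.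
  rewrite step_polyE -/t; have /andP[u0 u1] := tn n.
  by rewrite exprn_ge0 ?subr_ge0//= exprn_ile1 ?subr_ge0// gerBl.
split => //.
have half n : (n * 2 ^ n)%:R * t ^+ n = n%:R * (2 * t) ^+ n.
  by rewrite natrM natrX exprMn mulrA.
have tE : (t < 2^-1) = (x < a).
  by rewrite /t -ltrBrDr subrr pmulr_llt0 ?invr_gt0 ?mulr_gt0// subr_lt0.
rewrite indicE mem_setE in_itv/= -tE; have /andP[t0 t1] := t01.
case: ltP => th /=.
  have H : (fun n => 1 - n%:R * (2 * t) ^+ n) @ \oo --> (1 : R).
    rewrite -[X in _ --> X]subr0; apply: cvgB; first exact: cvg_cst.
    by apply: cvg_natM_expr; rewrite mulr_ge0//=; lra.
  apply: (squeeze_cvgr _ H); last exact: cvg_cst.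
  apply: nearW => n; have /andP[_ ->] := P01 n; rewrite andbT.
  by rewrite step_polyE -/t -half bernoulli_ineqN.
have H : (fun n => n.+1%:R^-1) @ \oo --> (0 : R) by exact: cvg_harmonic.
apply: (squeeze_cvgr _ _ H); last exact: cvg_cst.
apply: nearW => n; have /andP[-> _] := P01 n; rewrite /=.
rewrite step_polyE -/t (le_trans (expr_1B_le _ (tn n)))// half.
rewrite lef_pV2 ?posrE ?ltr_pwDl ?mulr_ge0 ?exprn_ge0 ?mulr_ge0//.
rewrite -natr1 addrC lerD2l -[leLHS]mulr1 ler_wpM2l// exprn_ege1//; lra.
Qed.

End StepApproximation.

Section PolynomialMoments.
Context d (T : measurableType d) (R : realType).
Variable mu : {finite_measure set T -> \bar R}.
Notation L1 w := (mu.-integrable setT (EFin \o w)).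

Lemma measurable_horner (p : {poly R}) : measurable_fun setT (horner p).
Proof. by apply: continuous_measurable_fun; exact: continuous_horner. Qed.

(** Half-lines generate the Borel sets and their indicators are bounded limits
of polynomials. *)
Lemma poly_moments_indic (w X : T -> R) : measurable_fun setT X ->
  {ae mu, forall x, `|X x| <= 1} -> L1 w ->
  (forall p : {poly R}, \int[mu]_x (w x * p.[X x]) = 0) ->
  forall S, measurable S -> \int[mu]_x (w x * \1_S (X x)) = 0.
Proof.
move=> mX X1 wi wp.
have mw : measurable_fun setT w by apply/measurable_EFinP; exact: measurable_int wi.
apply: (pi_system_integral0 mX wi (RGenInftyO.measurableE R)).
- move=> _ _ [a ->] [b ->]; exists (Num.min a b).
  by apply/seteqP; split => x /=; rewrite !in_itv/= lt_min; [move=> [-> ->]|move=> /andP].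
- by rewrite -[RHS](wp 1); apply: eq_Rintegral => x _; rewrite hornerC mulr1.
- move=> _ [a ->].
  have mi : measurable_fun setT (fun x => \1_(`]-oo, a[%classic : set R) (X x) : R).
    by apply: measurableT_comp => //; exact: measurable_indic.
  have [] := @dominated_convergence _ _ _ mu setT measurableT
    (fun n x => (w x * (step_poly a n).[X x])%:E)
    (fun x => (w x * \1_(`]-oo, a[%classic : set R) (X x))%:E) (fun x => `|w x|%:E).
  + move=> n; apply/measurable_EFinP; apply: measurable_funM => //.
    by apply: measurableT_comp => //; exact: measurable_horner.
  + by apply/measurable_EFinP; apply: measurable_funM.
  + apply: filterS X1 => x x1 _; apply: cvg_EFin; first exact: nearW.
    by apply: cvgMr; have [] := step_poly_cvg a x1.
  + exact: integrable_abse wi.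
  + apply: filterS X1 => x x1 n _; rewrite /= lee_fin normrM ler_piMr//.
    by have [/(_ n)/andP[p0 p1] _] := step_poly_cvg a x1; rewrite ger0_norm.
  + move=> wSi _ lim; rewrite /Rintegral.
    have E n : (\int[mu]_x (w x * (step_poly a n).[X x])%:E = 0)%E.
      rewrite -[RHS]/(0%:E) -(wp (step_poly a n)) /Rintegral fineK//.
      apply: integrable_fin_num => //; apply: (@L1_bounded_mul _ _ _ _ 1) => //.
        by apply: measurableT_comp => //; exact: measurable_horner.
      apply: filterS X1 => x x1.
      by have [/(_ n)/andP[p0 p1] _] := step_poly_cvg a x1; rewrite ger0_norm.
    move: lim; rewrite (_ : (fun n => _) = cst 0%E); last by apply/funext.
    by move/(cvg_lim _) => <-//; rewrite lim_cst.
Qed.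

End PolynomialMoments.

Section SphereMoments.
Variable R : realType.
Notation mu := (@area R).
Notation L1 w := (mu.-integrable setT (EFin \o w)).

Lemma measurable_x1 : measurable_fun setT (fun x : space3 R => x.1.1).
Proof. exact: (measurableT_comp measurable_fst measurable_fst). Qed.
Lemma measurable_x2 : measurable_fun setT (fun x : space3 R => x.1.2).
Proof. exact: (measurableT_comp measurable_snd measurable_fst). Qed.
Lemma measurable_x3 : measurable_fun setT (fun x : space3 R => x.2).
Proof. exact: measurable_snd. Qed.

Lemma measurable_le1 (X : space3 R -> R) : measurable_fun setT X ->
  measurable [set x | `|X x| <= 1].
Proof.
move=> mX; rewrite (_ : [set x | _] = X @^-1` `[- 1, 1]%classic).
  by rewrite -[X in measurable X]setTI; apply: mX => //; exact: measurable_itv.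
by apply/seteqP; split => x /=; rewrite in_itv/= ler_norml.
Qed.

Lemma ae_x1_le1 : {ae mu, forall x, `|x.1.1| <= 1}.
Proof.
apply: ae_area => [|p _ /=]; first exact: measurable_le1 measurable_x1.
rewrite normrM -[leRHS]mulr1 ler_pM// ler_norml.
  by rewrite sin_geN1 sin_le1.
by rewrite cos_geN1 cos_le1.
Qed.
Lemma ae_x2_le1 : {ae mu, forall x, `|x.1.2| <= 1}.
Proof.
apply: ae_area => [|p _ /=]; first exact: measurable_le1 measurable_x2.
by rewrite normrM -[leRHS]mulr1 ler_pM// ler_norml sin_geN1 sin_le1.
Qed.
Lemma ae_x3_le1 : {ae mu, forall x, `|x.2| <= 1}.
Proof.
apply: ae_area => [|p _ /=]; first exact: measurable_le1 measurable_x3.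
by rewrite ler_norml cos_geN1 cos_le1.
Qed.

Lemma horner_ae_bounded (X : space3 R -> R) (p : {poly R}) : measurable_fun setT X ->
  {ae mu, forall x, `|X x| <= 1} -> exists C, {ae mu, forall x, `|p.[X x]| <= C}.
Proof.
move=> mX X1; exists (\sum_(i < size p) `|p`_i|); apply: filterS X1 => x x1.
rewrite horner_coef (le_trans (ler_norm_sum _ _ _))//; apply: ler_sum => i _.
by rewrite normrM ler_piMr// normrX exprn_ile1.
Qed.

Lemma L1_horner w (X : space3 R -> R) (p : {poly R}) : measurable_fun setT X ->
  {ae mu, forall x, `|X x| <= 1} -> L1 w -> L1 (fun x => w x * p.[X x]).
Proof.
move=> mX X1 wi; have [C CP] := horner_ae_bounded p mX X1.
apply: (L1_bounded_mul wi _ CP).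
by apply: measurableT_comp => //; exact: measurable_horner.
Qed.

(** Polynomials in one coordinate are replaced by indicator functions, one
coordinate at a time. The boxes so obtained generate the Borel sets of the space,
so that the density integrates to 0 over every Borel set. *)
Lemma poly_moments_ae0 (v : space3 R -> R) : L1 v ->
  (forall p1 p2 p3 : {poly R},
     \int[mu]_x (v x * p1.[x.1.1] * p2.[x.1.2] * p3.[x.2]) = 0) ->
  {ae mu, forall x, v x = 0}.
Proof.
move=> vi vp.
have m1 := measurable_x1; have m2 := measurable_x2; have m3 := measurable_x3.
have b1 := ae_x1_le1; have b2 := ae_x2_le1; have b3 := ae_x3_le1.
have pre (X : space3 R -> R) S : measurable_fun setT X -> measurable S -> measurable (X @^-1` S).
  by move=> mX mS; rewrite -[X in measurable X]setTI; exact: mX.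
have s1 p1 p2 S : measurable S ->
    \int[mu]_x (v x * p1.[x.1.1] * p2.[x.1.2] * \1_S x.2) = 0.
  apply: (poly_moments_indic m3 b3) => [|p3]; last exact: vp.
  by apply: L1_horner => //; exact: L1_horner.
have s2 p1 S2 S3 : measurable S2 -> measurable S3 ->
    \int[mu]_x (v x * p1.[x.1.1] * \1_S3 x.2 * \1_S2 x.1.2) = 0.
  move=> mS2 mS3; move: S2 mS2; apply: (poly_moments_indic m2 b2) => [|p2].
    by apply: L1_indic; [exact: L1_horner|exact: pre].
  by rewrite -[RHS](s1 p1 p2 _ mS3); apply: eq_Rintegral => x _; ring.
have s3 S1 S2 S3 : measurable S1 -> measurable S2 -> measurable S3 ->
    \int[mu]_x (v x * \1_S3 x.2 * \1_S2 x.1.2 * \1_S1 x.1.1) = 0.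
  move=> mS1 mS2 mS3; move: S1 mS1; apply: (poly_moments_indic m1 b1) => [|p1].
    by apply: L1_indic; [apply: L1_indic => //|]; exact: pre.
  by rewrite -[RHS](s2 p1 _ _ mS2 mS3); apply: eq_Rintegral => x _; ring.
have v0 : \int[mu]_x v x = 0.
  by rewrite -[RHS](vp 1 1 1); apply: eq_Rintegral => x _; rewrite !hornerC !mulr1.
have indicX (U U' : Type) (A : set U) (B : set U') x :
    \1_(A `*` B) x = \1_A x.1 * \1_B x.2 :> R.
  by rewrite !indicE in_setX; case: (_ \in A); case: (_ \in B); rewrite ?mulr0 ?mulr1.
have GI d1 d2 (U1 : measurableType d1) (U2 : measurableType d2) :
    setI_closed [set A1 `*` A2 | A1 in @measurable _ U1 & A2 in @measurable _ U2].
  move=> _ _ [A1 mA1 [A2 mA2 <-]] [B1 mB1 [B2 mB2 <-]].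
  exists (A1 `&` B1); first exact: measurableI.
  by exists (A2 `&` B2); [exact: measurableI|rewrite setXI].
have s12 S3 S : measurable S3 -> measurable S ->
    \int[mu]_x (v x * \1_S3 x.2 * \1_S x.1) = 0.
  move=> mS3; apply: (pi_system_integral0 measurable_fst _
    (measurable_prod_measurableType _ _) (GI _ _ _ _)).
  - by apply: L1_indic => //; exact: pre.
  - rewrite -[RHS](s3 _ _ _ measurableT measurableT mS3).
    by apply: eq_Rintegral => x _; rewrite !indicT !mulr1.
  - move=> _ [A mA [B mB <-]]; rewrite -[RHS](s3 _ _ _ mA mB mS3).
    by apply: eq_Rintegral => x _; rewrite indicX; ring.
have sS (S : set (space3 R)) : measurable S -> \int[mu]_x (v x * \1_S x) = 0.
  move: S; refine (@pi_system_integral0 _ _ R mu _ _ id _ v (@measurable_id _ _ _) vi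
    (measurable_prod_measurableType _ _) (GI _ _ _ _) v0 _).
  move=> _ [A mA [B mB <-]]; rewrite -[RHS](s12 _ _ mB mA).
  by apply: eq_Rintegral => x _; rewrite indicX; ring.
have := @integral_ae_eq _ _ _ mu setT measurableT (cst 0%E) (EFin \o v) vi (measurable_cst _).
move=> H; have {}H := H _; apply: filterS (H _) => [x /(_ I)/= []//|S _ mS].
rewrite integral_cst// mul0e.
have := sS _ mS; rewrite (Rintegral_indic mu v id) preimage_id /Rintegral => S0.
rewrite -[RHS]/(0%:E) -S0 fineK//.
by apply: integrable_fin_num => //; exact: integrableS vi.
Qed.

End SphereMoments.

(** * Smooth functions and the Laplacian in Cartesian coordinates *)

Section Smooth.
Variable R : realType.
Implicit Types f g Phi : space3 R -> R.

Lemma n_smooth_continuous n f : n_smooth n f -> continuous f.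
Proof. by case: n => //= n [df _] x; exact: differentiable_continuous. Qed.

Lemma n_smoothS n f : n_smooth n.+1 f -> n_smooth n f.
Proof.
elim: n f => [|n IH] f; first exact: n_smooth_continuous.
by move=> [df Df]; split => // v; apply: IH; exact: Df.
Qed.

Lemma n_smooth_cst n (c : R) : n_smooth n (fun=> c : R).
Proof.
elim: n c => [|n IH] c /=; first by move=> x; exact: cvg_cst.
split=> [x|v]; first exact: differentiable_cst.
rewrite (_ : 'D_v _ = fun=> 0); first exact: IH.
by apply/funext => x; exact: derive_cst.
Qed.

Lemma n_smoothD n f g : n_smooth n f -> n_smooth n g -> n_smooth n (fun x => f x + g x).
Proof.
elim: n f g => [|n IH] f g /=; first by move=> cf cg x; apply: cvgD; [exact: cf|exact: cg].
move=> [df Df] [dg Dg]; split=> [x|v]; first exact: differentiableD.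
rewrite (_ : 'D_v _ = fun x => 'D_v f x + 'D_v g x); first exact: IH.
by apply/funext => x; apply: deriveD; exact: diff_derivable.
Qed.

Lemma n_smoothM n f g : n_smooth n f -> n_smooth n g -> n_smooth n (fun x => f x * g x).
Proof.
elim: n f g => [|n IH] f g; first by move=> cf cg x; apply: cvgM; [exact: cf|exact: cg].
move=> fs gs; have fn := n_smoothS fs; have gn := n_smoothS gs.
move: fs gs => [df Df] [dg Dg]; split=> [x|v]; first exact: differentiableM.
rewrite (_ : 'D_v _ = fun x => f x * 'D_v g x + g x * 'D_v f x).
  by apply: n_smoothD; apply: IH => //; [exact: Dg|exact: Df].
by apply/funext => x; apply: deriveM; exact: diff_derivable.
Qed.

Lemma smooth_cst c : smooth (fun=> c : R).
Proof. by move=> n; exact: n_smooth_cst. Qed.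
Lemma smoothD f g : smooth f -> smooth g -> smooth (fun x => f x + g x).
Proof. by move=> fs gs n; apply: n_smoothD. Qed.
Lemma smoothM f g : smooth f -> smooth g -> smooth (fun x => f x * g x).
Proof. by move=> fs gs n; apply: n_smoothM. Qed.
Lemma smoothZ c f : smooth f -> smooth (fun x => c * f x).
Proof. by move=> fs; apply: smoothM => //; exact: smooth_cst. Qed.
Lemma smoothN f : smooth f -> smooth (fun x => - f x).
Proof.
move=> fs; rewrite (_ : (fun x => _) = fun x => -1 * f x); first exact: smoothZ.
by apply/funext => x; rewrite mulN1r.
Qed.
Lemma smoothB f g : smooth f -> smooth g -> smooth (fun x => f x - g x).
Proof. by move=> fs gs; apply: smoothD => //; exact: smoothN. Qed.
Lemma smooth_continuous f : smooth f -> continuous f.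
Proof. by move=> /(_ 0%N). Qed.
Lemma smooth_differentiable f x : smooth f -> differentiable f x.
Proof. by move=> /(_ 1%N) [+ _]. Qed.
Lemma smooth_horner (p : {poly R}) f : smooth f -> smooth (fun x => p.[f x]).
Proof.
move=> fs; elim/poly_ind: p => [|q c IH].
  by under eq_fun do rewrite hornerC; exact: smooth_cst.
under eq_fun do rewrite hornerMXaddC.
by apply: smoothD; [apply: smoothM|exact: smooth_cst].
Qed.
Lemma smooth_derive f v : smooth f -> smooth ('D_v f).
Proof. by move=> fs n; have [_ Df] := fs n.+1; exact: Df. Qed.

(** Linear maps provide the coordinate functions, from which sums and products
produce all polynomials. *)
Lemma smooth_linear (f : space3 R -> R) : linear f -> continuous f ->
  smooth f /\ forall v, 'D_v f = fun=> f v.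
Proof.
move=> lf cf; pose fM := GRing.isLinear.Build _ _ _ _ f lf.
pose fL : {linear _ -> _} := HB.pack f fM.
have df x : differentiable f x by exact: (@linear_differentiable _ _ _ fL).
have Df v : 'D_v f = fun=> f v.
  by apply/funext => x; rewrite deriveE// (@diff_lin _ _ _ fL).
split=> // -[|n]; first exact: cf.
by split=> // v; rewrite Df; exact: n_smooth_cst.
Qed.

Definition e1 : space3 R := (1, 0, 0).
Definition e2 : space3 R := (0, 1, 0).
Definition e3 : space3 R := (0, 0, 1).

Lemma continuous_x1 : continuous (fun x : space3 R => x.1.1).
Proof. by move=> x; apply: (@continuous_comp _ _ _ fst fst); exact: cvg_fst. Qed.
Lemma continuous_x2 : continuous (fun x : space3 R => x.1.2).
Proof.
by move=> x; apply: (@continuous_comp _ _ _ fst snd); [exact: cvg_fst|exact: cvg_snd].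
Qed.
Lemma continuous_x3 : continuous (fun x : space3 R => x.2).
Proof. by move=> x; exact: cvg_snd. Qed.

Let x1P := @smooth_linear (fun x => x.1.1) (fun _ _ _ => erefl) continuous_x1.
Let x2P := @smooth_linear (fun x => x.1.2) (fun _ _ _ => erefl) continuous_x2.
Let x3P := @smooth_linear (fun x => x.2) (fun _ _ _ => erefl) continuous_x3.
Lemma smooth_x1 : smooth (fun x : space3 R => x.1.1). Proof. exact: x1P.1. Qed.
Lemma smooth_x2 : smooth (fun x : space3 R => x.1.2). Proof. exact: x2P.1. Qed.
Lemma smooth_x3 : smooth (fun x : space3 R => x.2). Proof. exact: x3P.1. Qed.
Lemma derive_x1 v : 'D_v (fun x : space3 R => x.1.1) = fun=> v.1.1.
Proof. exact: x1P.2. Qed.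
Lemma derive_x2 v : 'D_v (fun x : space3 R => x.1.2) = fun=> v.1.2.
Proof. exact: x2P.2. Qed.
Lemma derive_x3 v : 'D_v (fun x : space3 R => x.2) = fun=> v.2.
Proof. exact: x3P.2. Qed.

Lemma derive_coordE Phi x v : differentiable Phi x ->
  'D_v Phi x = v.1.1 * 'D_e1 Phi x + v.1.2 * 'D_e2 Phi x + v.2 * 'D_e3 Phi x.
Proof.
move=> df; rewrite !deriveE//.
have -> : v = v.1.1 *: e1 + v.1.2 *: e2 + v.2 *: e3.
  case: v => [[a b] c]; congr (_, _, _) => /=;
  by rewrite /GRing.scale/= ?mulr1 ?mulr0 ?addr0 ?add0r.
rewrite !linearD !linearZ /=.
by rewrite /GRing.scale/= ?mulr1 ?mulr0 ?addr0 ?add0r.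
Qed.

Lemma chain_rule Phi (g1 g2 g3 : R -> R) (t d1 d2 d3 : R) :
  differentiable Phi (g1 t, g2 t, g3 t) ->
  is_derive t 1 g1 d1 -> is_derive t 1 g2 d2 -> is_derive t 1 g3 d3 ->
  is_derive t (1 : R) (fun s => Phi (g1 s, g2 s, g3 s))
    (d1 * 'D_e1 Phi (g1 t, g2 t, g3 t) + d2 * 'D_e2 Phi (g1 t, g2 t, g3 t)
     + d3 * 'D_e3 Phi (g1 t, g2 t, g3 t)).
Proof.
move=> dPhi h1 h2 h3.
have k1 : differentiable g1 t by apply/derivable1_diffP; exact: ex_derive.
have k2 : differentiable g2 t by apply/derivable1_diffP; exact: ex_derive.
have k3 : differentiable g3 t by apply/derivable1_diffP; exact: ex_derive.
have k12 := differentiable_pair k1 k2; have k123 := differentiable_pair k12 k3.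
have kc : differentiable (Phi \o (fun s => (g1 s, g2 s, g3 s))) t.
  exact: differentiable_comp.
apply: DeriveDef; first by apply/derivable1_diffP; exact: kc.
have v1 : 'd g1 t 1 = d1 by rewrite -deriveE// derive_val.
have v2 : 'd g2 t 1 = d2 by rewrite -deriveE// derive_val.
have v3 : 'd g3 t 1 = d3 by rewrite -deriveE// derive_val.
rewrite deriveE//; rewrite diff_comp//= (diff_pair k12 k3) (diff_pair k1 k2) v1 v2 v3.
by rewrite -deriveE// derive_coordE.
Qed.

Notation D1 f := ('D_e1 f).
Notation D2 f := ('D_e2 f).
Notation D3 f := ('D_e3 f).

Lemma X3E Phi x : smooth Phi -> X3 Phi x = x.1.1 * D2 Phi x - x.1.2 * D1 Phi x.
Proof.
move=> Ps; rewrite /X3 /rotation3 derive1E.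
have h1 : is_derive (0 : R) (1 : R) (fun t => cos t * x.1.1 - sin t * x.1.2) (- x.1.2).
  apply: is_derive_eq.
  by rewrite sin0 cos0 /GRing.scale/=; ring.
have h2 : is_derive (0 : R) (1 : R) (fun t => sin t * x.1.1 + cos t * x.1.2) x.1.1.
  apply: is_derive_eq.
  by rewrite sin0 cos0 /GRing.scale/=; ring.
have h3 := is_derive_cst x.2 (0 : R) (1 : R).
have h := chain_rule (g3 := fun=> x.2) (smooth_differentiable _ Ps) h1 h2 h3.
rewrite (@derive_val _ _ _ _ _ _ _ h) sin0 cos0 !mul1r !mul0r addr0 add0r subr0.
have -> : (x.1.1, x.1.2, x.2) = x by case: x {h h1 h2 h3} => [[]].
by rewrite mulNr addrC.
Qed.

Definition dtheta Phi (p : R * R) : R :=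
  cos p.1 * cos p.2 * D1 Phi (spherical p) + cos p.1 * sin p.2 * D2 Phi (spherical p)
  - sin p.1 * D3 Phi (spherical p).
Definition dphi Phi (p : R * R) : R :=
  - (sin p.1 * sin p.2) * D1 Phi (spherical p) + sin p.1 * cos p.2 * D2 Phi (spherical p).

Lemma is_derive_theta Phi (theta phi : R) : smooth Phi ->
  is_derive theta (1 : R) (fun r => Phi (spherical (r, phi))) (dtheta Phi (theta, phi)).
Proof.
move=> Ps.
have h1 : is_derive theta (1 : R) (fun r => sin r * cos phi) (cos theta * cos phi).
  by apply: is_derive_eq; rewrite /GRing.scale/=; ring.
have h2 : is_derive theta (1 : R) (fun r => sin r * sin phi) (cos theta * sin phi).
  by apply: is_derive_eq; rewrite /GRing.scale/=; ring.
have h := chain_rule (g3 := cos) (smooth_differentiable _ Ps) h1 h2 (is_derive_cos theta).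
by apply: (is_derive_eq h); rewrite /dtheta mulNr.
Qed.

Lemma is_derive_phi Phi (theta phi : R) : smooth Phi ->
  is_derive phi (1 : R) (fun s => Phi (spherical (theta, s))) (dphi Phi (theta, phi)).
Proof.
move=> Ps.
have h1 : is_derive phi (1 : R) (fun s => sin theta * cos s) (- (sin theta * sin phi)).
  by apply: is_derive_eq; rewrite /GRing.scale/=; ring.
have h2 : is_derive phi (1 : R) (fun s => sin theta * sin s) (sin theta * cos phi).
  by apply: is_derive_eq; rewrite /GRing.scale/=; ring.
have h := chain_rule (g3 := fun=> cos theta) (smooth_differentiable _ Ps) h1 h2
  (is_derive_cst (cos theta) phi 1).
by apply: (is_derive_eq h); rewrite /dphi mul0r addr0.
Qed.

Definition dtheta2 Phi (p : R * R) : R :=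
  cos p.1 * cos p.2 * dtheta (D1 Phi) p + cos p.1 * sin p.2 * dtheta (D2 Phi) p
  - sin p.1 * dtheta (D3 Phi) p
  - sin p.1 * cos p.2 * D1 Phi (spherical p) - sin p.1 * sin p.2 * D2 Phi (spherical p)
  - cos p.1 * D3 Phi (spherical p).
Definition dphi2 Phi (p : R * R) : R :=
  - (sin p.1 * sin p.2) * dphi (D1 Phi) p + sin p.1 * cos p.2 * dphi (D2 Phi) p
  - sin p.1 * cos p.2 * D1 Phi (spherical p) - sin p.1 * sin p.2 * D2 Phi (spherical p).

Let is_derive_combo1 (f1 f2 f3 : R -> R) (t a b d1 d2 d3 : R) :
  is_derive t (1 : R) f1 d1 -> is_derive t (1 : R) f2 d2 -> is_derive t (1 : R) f3 d3 ->
  is_derive t (1 : R) (fun r => cos r * a * f1 r + cos r * b * f2 r - sin r * f3 r)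
   (cos t * a * d1 + cos t * b * d2 - sin t * d3 - sin t * a * f1 t
    - sin t * b * f2 t - cos t * f3 t).
Proof. by move=> h1 h2 h3; apply: is_derive_eq; rewrite /GRing.scale/=; ring. Qed.

Let is_derive_combo2 (f1 f2 : R -> R) (t a d1 d2 : R) :
  is_derive t (1 : R) f1 d1 -> is_derive t (1 : R) f2 d2 ->
  is_derive t (1 : R) (fun r => - (a * sin r) * f1 r + a * cos r * f2 r)
   (- (a * sin t) * d1 + a * cos t * d2 - a * cos t * f1 t - a * sin t * f2 t).
Proof. by move=> h1 h2; apply: is_derive_eq; rewrite /GRing.scale/=; ring. Qed.

Lemma is_derive_theta2 Phi (theta phi : R) : smooth Phi ->
  is_derive theta (1 : R) (fun r => dtheta Phi (r, phi)) (dtheta2 Phi (theta, phi)).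
Proof.
move=> Ps; exact: (is_derive_combo1 (cos phi) (sin phi)
  (is_derive_theta theta phi (smooth_derive e1 Ps))
  (is_derive_theta theta phi (smooth_derive e2 Ps))
  (is_derive_theta theta phi (smooth_derive e3 Ps))).
Qed.

Lemma is_derive_phi2 Phi (theta phi : R) : smooth Phi ->
  is_derive phi (1 : R) (fun s => dphi Phi (theta, s)) (dphi2 Phi (theta, phi)).
Proof.
move=> Ps; exact: (is_derive_combo2 (sin theta)
  (is_derive_phi theta phi (smooth_derive e1 Ps))
  (is_derive_phi theta phi (smooth_derive e2 Ps))).
Qed.

(** The Laplace-Beltrami operator of S^2 in Cartesian coordinates: the Euclidean
Laplacian minus the second radial derivative and twice the radial one, both
computed on the unit sphere. *)
Definition sphere_laplacian Phi (x : space3 R) : R :=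
  D1 (D1 Phi) x + D2 (D2 Phi) x + D3 (D3 Phi) x
  - (x.1.1 * x.1.1 * D1 (D1 Phi) x + x.1.1 * x.1.2 * D1 (D2 Phi) x
     + x.1.1 * x.2 * D1 (D3 Phi) x + x.1.2 * x.1.1 * D2 (D1 Phi) x
     + x.1.2 * x.1.2 * D2 (D2 Phi) x + x.1.2 * x.2 * D2 (D3 Phi) x
     + x.2 * x.1.1 * D3 (D1 Phi) x + x.2 * x.1.2 * D3 (D2 Phi) x
     + x.2 * x.2 * D3 (D3 Phi) x)
  - 2 * (x.1.1 * D1 Phi x + x.1.2 * D2 Phi x + x.2 * D3 Phi x).

(** Both sides differ by multiples of the relations cos^2 + sin^2 = 1 for the two
angles; S, C stand for the colatitude and s, c for the longitude. *)
Let laplacian_identity (S C s c d11 d12 d13 d21 d22 d23 d31 d32 d33 d1 d2 d3 : R) :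
  C ^+ 2 + S ^+ 2 = 1 -> c ^+ 2 + s ^+ 2 = 1 ->
  S ^+ 2 * (d11 + d22 + d33
  - (S * c * (S * c) * d11 + S * c * (S * s) * d12 + S * c * C * d13
     + S * s * (S * c) * d21 + S * s * (S * s) * d22 + S * s * C * d23
     + C * (S * c) * d31 + C * (S * s) * d32 + C * C * d33)
  - 2 * (S * c * d1 + S * s * d2 + C * d3)) =
  S * C * (C * c * d1 + C * s * d2 - S * d3) +
  S ^+ 2 * (C * c * (C * c * d11 + C * s * d21 - S * d31)
    + C * s * (C * c * d12 + C * s * d22 - S * d32)
    - S * (C * c * d13 + C * s * d23 - S * d33)
    - S * c * d1 - S * s * d2 - C * d3) +
  (- (S * s) * (- (S * s) * d11 + S * c * d21) + S * c * (- (S * s) * d12 + S * c * d22)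
    - S * c * d1 - S * s * d2).
Proof.
move=> h1 h2; apply/eqP; rewrite -subr_eq0; apply/eqP.
transitivity (- S ^+ 2 * (c ^+ 2 * d11 + c * s * (d12 + d21) + s ^+ 2 * d22 + d33)
   * (C ^+ 2 + S ^+ 2 - 1) - S * (c * d1 + s * d2) * (C ^+ 2 + S ^+ 2 - 1)
  - S ^+ 2 * (d11 + d22) * (c ^+ 2 + s ^+ 2 - 1)).
  by ring.
by rewrite h1 h2 !subrr; ring.
Qed.

(** The factor sin^2 clears the denominators of the coordinate formula, so that
the identity holds at the poles too. *)
Lemma sphere_laplacianE Phi (p : R * R) :
  sin p.1 ^+ 2 * sphere_laplacian Phi (spherical p) =
  sin p.1 * cos p.1 * dtheta Phi p + sin p.1 ^+ 2 * dtheta2 Phi p + dphi2 Phi p.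
Proof. exact: (laplacian_identity _ _ _ _ _ _ _ _ _ _ _ _ (cos2Dsin2 p.1) (cos2Dsin2 p.2)). Qed.

Lemma sphere_laplacianP Phi : smooth Phi -> laplace_beltrami Phi (sphere_laplacian Phi).
Proof.
move=> Ps theta phi /sin_gt0_pi s0.
have F1 : (fun s => sin s * derive1 (fun r => Phi (spherical (r, phi))) s) =
    (fun s => sin s * dtheta Phi (s, phi)).
  apply/funext => s; rewrite derive1E.
  by rewrite (@derive_val _ _ _ _ _ _ _ (is_derive_theta s phi Ps)).
have G1 : derive1 (fun s => Phi (spherical (theta, s))) = (fun s => dphi Phi (theta, s)).
  apply/funext => s; rewrite derive1E.
  by rewrite (@derive_val _ _ _ _ _ _ _ (is_derive_phi theta s Ps)).
rewrite derive1nS derive1n1 G1 F1 !derive1E.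
rewrite (@derive_val _ _ _ _ _ _ _ (is_derive_phi2 theta phi Ps)).
have h := is_deriveM (is_derive_sin theta) (is_derive_theta2 theta phi Ps).
rewrite (@derive_val _ _ _ _ _ _ _ h) /GRing.scale/=.
have := sphere_laplacianE Phi (theta, phi) => /=.
move=> E; apply: (@mulfI _ (sin theta ^+ 2)); first by rewrite expf_eq0 gt_eqF.
by rewrite E; field; rewrite gt_eqF.
Qed.

End Smooth.

(** * Green's formula and integration by parts *)

Section Green.
Variable R : realType.
Implicit Types Phi Psi : space3 R -> R.
Notation mu := (@area R).
Notation leb := (@lebesgue_measure R).
Notation leb2 := (leb \x leb)%E.
Notation rect := (@coord_rect R).
Notation sph := (@spherical R).

Lemma continuous_rect_integrable (f : R * R -> R) : continuous f ->
  leb2.-integrable rect (EFin \o f).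
Proof.
move=> cf; have [C CP] := bounded_rect cf; have mr := @measurable_rect R.
apply: (@measurable_bounded_integrable _ _ _ leb2 f rect mr (rect_lty R)).
  by apply: measurable_funTS; exact: continuous_measurable2.
by exists C; split; [exact: num_real|move=> M /ltW CM p rp; exact: le_trans (CP p rp) CM].
Qed.

Let patch_rect (f : R * R -> \bar R) x y : (f \_ rect) (x, y) =
  (((fun x => ((fun y => f (x, y)) \_ `[0%R, pi *+ 2]%classic) y) \_ `[0%R, pi]%classic) x).
Proof.
rewrite !patchE; case: ifPn => [|].
  by rewrite inE => -[/= x1 y1]; rewrite !mem_set.
rewrite notin_setE /coord_rect /= => H; case: ifPn => //; rewrite inE => x1.
by case: ifPn => //; rewrite inE => y1; exfalso; apply: H.
Qed.

Lemma FTC2_real (F f : R -> R) (a b : R) : a < b -> continuous f ->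
  (forall x, is_derive x (1 : R) F (f x)) ->
  (\int[leb]_(x in `[a, b]) (f x)%:E = (F b - F a)%:E)%E.
Proof.
move=> ab cf dF; have dr x : derivable F x 1 by exact: ex_derive.
have cF : continuous F by move=> x; apply/differentiable_continuous/derivable1_diffP.
rewrite EFinB; apply: continuous_FTC2 => //.
- exact: continuous_subspaceT.
- split=> [x _||]; first exact: dr.
    by apply: cvg_at_right_filter; exact: cF.
  by apply: cvg_at_left_filter; exact: cF.
- by move=> x _; rewrite derive1E derive_val.
Qed.

Lemma pi2_gt0 : 0 < (pi : R) *+ 2. Proof. by rewrite mulrn_wgt0// pi_gt0. Qed.

(** Fubini's theorem and the fundamental theorem of calculus. The boundary terms
cancel at the poles here, and by periodicity in the longitude below. *)
Lemma integral_dtheta0 (A a : R * R -> R) : continuous a ->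
  (forall t s, is_derive t (1 : R) (fun r => A (r, s)) (a (t, s))) ->
  (forall s, A (pi, s) = A (0, s)) -> \int[leb2]_(p in rect) a p = 0.
Proof.
move=> ca dA A0; have ia := continuous_rect_integrable ca.
have mr := @measurable_rect R.
rewrite /Rintegral integral_mkcond -integral21_prod_meas1; last first.
  by apply/integrable_restrict => //=; rewrite ?setTI ?setIT.
rewrite integral0_eq// => s _; rewrite /fubini_G.
under eq_integral do rewrite patch_rect.
rewrite -integral_mkcond.
have [s1|s1] := pselect (`[0%R, pi *+ 2]%classic s).
  under eq_integral do rewrite patchE mem_set//.
  rewrite (FTC2_real (pi_gt0 R) _ (fun t => dA t s)) ?A0 ?subrr//.
  move=> t; apply: (@continuous_comp _ _ _ (fun t => (t, s)) a); last exact: ca.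
  by apply: (continuous_pair (f := id) (g := cst s)) => z; [exact: cvg_id|exact: cvg_cst].
by rewrite integral0_eq// => t _; rewrite patchE memNset.
Qed.

Lemma integral_dphi0 (A a : R * R -> R) : continuous a ->
  (forall t s, is_derive s (1 : R) (fun r => A (t, r)) (a (t, s))) ->
  (forall t, A (t, pi *+ 2) = A (t, 0)) -> \int[leb2]_(p in rect) a p = 0.
Proof.
move=> ca dA A0; have ia := continuous_rect_integrable ca.
have mr := @measurable_rect R.
rewrite /Rintegral integral_mkcond -integral12_prod_meas1; last first.
  by apply/integrable_restrict => //=; rewrite ?setTI ?setIT.
rewrite integral0_eq// => t _; rewrite /fubini_F.
have [t1|t1] := pselect (`[0%R, pi]%classic t); last first.
  by rewrite integral0_eq// => s _; rewrite patch_rect patchE memNset.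
transitivity (\int[leb]_(s in `[0%R, (pi *+ 2)%R]) (a (t, s))%:E)%E.
  by rewrite [RHS]integral_mkcond; apply: eq_integral => s _; rewrite patch_rect patchE mem_set.
rewrite (FTC2_real pi2_gt0 _ (fun s => dA t s)) ?A0 ?subrr//.
move=> s; apply: (@continuous_comp _ _ _ (fun s => (t, s)) a); last exact: ca.
by apply: (continuous_pair (f := cst t) (g := id)) => z; [exact: cvg_cst|exact: cvg_id].
Qed.

Lemma is_derive_horner_cos (q : {poly R}) (t : R) :
  is_derive t (1 : R) (fun r => q.[cos r]) (- sin t * q^`().[cos t]).
Proof.
apply: (@is_derive_eq _ _ _ _ _ _ _ (q^`().[cos t] * - sin t)).
by rewrite mulrC.
Qed.

(** The factor of the associated Legendre equation of order one: Delta maps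
(x_1 + i x_2) q(x_3) to (x_1 + i x_2) (legendre1 q)(x_3). *)
Definition legendre1 (q : {poly R}) : {poly R} :=
  (1 - 'X ^+ 2) * q^`()^`() - 4%:P * 'X * q^`() - 2%:P * q.

Lemma legendre1E q x : (legendre1 q).[x] =
  (1 - x ^+ 2) * q^`()^`().[x] - 4 * x * q^`().[x] - 2 * q.[x].
Proof. by rewrite /legendre1 !hornerE ?hornerXn. Qed.

(** The theta-component of the flux w grad Phi - Phi grad w, and then its
phi-component, as derivatives of expressions in abstract functions. *)
Let is_derive_flux (f0 f1 Q0 Q1 : R -> R) (t k d1 d2 e1 e2 : R) :
  is_derive t (1 : R) f0 d1 -> is_derive t (1 : R) f1 d2 ->
  is_derive t (1 : R) Q0 e1 -> is_derive t (1 : R) Q1 e2 ->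
  is_derive t (1 : R)
   (fun r => k * (sin r * sin r * Q0 r * f1 r
      - (sin r * cos r * Q0 r - sin r * sin r * sin r * Q1 r) * f0 r))
   (k * (2 * sin t * cos t * Q0 t * f1 t + sin t * sin t * e1 * f1 t
      + sin t * sin t * Q0 t * d2
      - (sin t * cos t * Q0 t - sin t * sin t * sin t * Q1 t) * d1
      - ((cos t * cos t - sin t * sin t) * Q0 t + sin t * cos t * e1
         - 3 * sin t * sin t * cos t * Q1 t - sin t * sin t * sin t * e2) * f0 t)).
Proof. by move=> h1 h2 h3 h4; apply: is_derive_eq; rewrite /GRing.scale/=; ring. Qed.

Let is_derive_flux2 (f0 f1 T0 T1 : R -> R) (t k d1 d2 e1 e2 : R) :
  is_derive t (1 : R) f0 d1 -> is_derive t (1 : R) f1 d2 ->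
  is_derive t (1 : R) T0 e1 -> is_derive t (1 : R) T1 e2 ->
  is_derive t (1 : R) (fun r => k * (T0 r * f1 r - T1 r * f0 r))
   (k * (T0 t * d2 + e1 * f1 t - T1 t * d1 - e2 * f0 t)).
Proof. by move=> h1 h2 h3 h4; apply: is_derive_eq; rewrite /GRing.scale/=; ring. Qed.

Lemma continuous_smooth_sph Phi : smooth Phi -> continuous (Phi \o sph).
Proof.
move=> Ps p; apply: continuous_comp; first exact: continuous_spherical.
exact: smooth_continuous.
Qed.

Let c1 : continuous (fun p : R * R => p.1). Proof. by move=> p; exact: cvg_fst. Qed.
Let c2 : continuous (fun p : R * R => p.2). Proof. by move=> p; exact: cvg_snd. Qed.
Let cs1 : continuous (fun p : R * R => sin p.1).
Proof. by move=> p; apply: continuous_comp; [exact: c1|exact: continuous_sin]. Qed.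
Let cc1 : continuous (fun p : R * R => cos p.1).
Proof. by move=> p; apply: continuous_comp; [exact: c1|exact: continuous_cos]. Qed.
Let cs2 : continuous (fun p : R * R => sin p.2).
Proof. by move=> p; apply: continuous_comp; [exact: c2|exact: continuous_sin]. Qed.
Let cc2 : continuous (fun p : R * R => cos p.2).
Proof. by move=> p; apply: continuous_comp; [exact: c2|exact: continuous_cos]. Qed.
Let cM (f g : R * R -> R) : continuous f -> continuous g -> continuous (fun p => f p * g p).
Proof. by move=> cf cg p; apply: cvgM; [exact: cf|exact: cg]. Qed.
Let cD (f g : R * R -> R) : continuous f -> continuous g -> continuous (fun p => f p + g p).
Proof. by move=> cf cg p; apply: cvgD; [exact: cf|exact: cg]. Qed.
Let cN (f : R * R -> R) : continuous f -> continuous (fun p => - f p).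
Proof. by move=> cf p; apply: cvgN; exact: cf. Qed.
Let ck (k : R) : continuous (fun _ : R * R => k).
Proof. by move=> p; exact: cvg_cst. Qed.

Ltac cont leaf := lazymatch goal with
  | |- continuous (fun p => @?f p + @?g p) => apply (@cD f g); cont leaf
  | |- continuous (fun p => - @?f p) => apply (@cN f); cont leaf
  | |- continuous (fun p => @?f p * @?g p) => apply (@cM f g); cont leaf
  | |- continuous (fun p => sin p.1) => exact cs1
  | |- continuous (fun p => cos p.1) => exact cc1
  | |- continuous (fun p => sin p.2) => exact cs2
  | |- continuous (fun p => cos p.2) => exact cc2
  | |- _ => leaf end.

Let c_d (Phi : space3 R -> R) v : smooth Phi -> continuous (fun p => ('D_v Phi) (sph p)).
Proof. by move=> Ps; exact: (continuous_smooth_sph (smooth_derive v Ps)). Qed.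

Lemma continuous_dtheta Phi : smooth Phi -> continuous (dtheta Phi).
Proof. by move=> Ps; rewrite /dtheta; cont ltac:(exact: c_d). Qed.

Lemma continuous_dphi Phi : smooth Phi -> continuous (dphi Phi).
Proof. by move=> Ps; rewrite /dphi; cont ltac:(exact: c_d). Qed.

Lemma continuous_dtheta2 Phi : smooth Phi -> continuous (dtheta2 Phi).
Proof.
move=> Ps; rewrite /dtheta2; cont ltac:(idtac).
- exact: (continuous_dtheta (smooth_derive _ Ps)).
- exact: (continuous_dtheta (smooth_derive _ Ps)).
- exact: (continuous_dtheta (smooth_derive _ Ps)).
- exact: c_d.
- exact: c_d.
- exact: c_d.
Qed.

Lemma continuous_dphi2 Phi : smooth Phi -> continuous (dphi2 Phi).
Proof.
move=> Ps; rewrite /dphi2; cont ltac:(idtac).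
- exact: (continuous_dphi (smooth_derive _ Ps)).
- exact: (continuous_dphi (smooth_derive _ Ps)).
- exact: c_d.
- exact: c_d.
Qed.

Lemma smooth_horner3 (q : {poly R}) : smooth (fun x : space3 R => q.[x.2]).
Proof. by apply: smooth_horner; exact: smooth_x3. Qed.

Lemma continuous_horner_cos (q : {poly R}) : continuous (fun p : R * R => q.[cos p.1]).
Proof.
by move=> p; apply: (@continuous_comp _ _ _ _ (horner q)); [exact: cc1|exact: continuous_horner].
Qed.

(** Green's formula for tau(phi) sin(theta) q(cos(theta)), with tau'' = - tau:
by Green's second identity, the difference of the two sides is the integral of
a theta-derivative of a function vanishing at the poles and of a phi-derivative of
a periodic function. *)
Lemma green_rect (q : {poly R}) Phi (T0 T1 : R -> R) : smooth Phi ->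
  continuous T0 -> continuous T1 ->
  (forall t, is_derive t (1 : R) T0 (T1 t)) ->
  (forall t, is_derive t (1 : R) T1 (- T0 t)) ->
  T0 (pi *+ 2) = T0 0 -> T1 (pi *+ 2) = T1 0 ->
  \int[leb2]_(p in rect) (q.[cos p.1] * T0 p.2 *
     (sin p.1 ^+ 2 * sphere_laplacian Phi (sph p))) =
  \int[leb2]_(p in rect) ((legendre1 q).[cos p.1] * T0 p.2 * sin p.1 ^+ 2 * Phi (sph p)).
Proof.
move=> Ps cT0 cT1 dT0 dT1 pT0 pT1.
have k0 := continuous_smooth_sph Ps.
have k1 := continuous_dtheta Ps; have k2 := continuous_dtheta2 Ps.
have k3 := continuous_dphi2 Ps.
have q0 := @continuous_horner_cos q; have q1 := @continuous_horner_cos q^`().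
have q2 := @continuous_horner_cos q^`()^`(); have ql := @continuous_horner_cos (legendre1 q).
have t0 : continuous (fun p : R * R => T0 p.2).
  by move=> p; apply: continuous_comp; [exact: c2|exact: cT0].
have t1 : continuous (fun p : R * R => T1 p.2).
  by move=> p; apply: continuous_comp; [exact: c2|exact: cT1].
pose a p := q.[cos p.1] * T0 p.2 * (sin p.1 * cos p.1 * dtheta Phi p
  + sin p.1 * sin p.1 * dtheta2 Phi p) - q.[cos p.1] * T0 p.2 * Phi (sph p)
  - (legendre1 q).[cos p.1] * T0 p.2 * (sin p.1 * sin p.1) * Phi (sph p).
pose b p := q.[cos p.1] * (T0 p.2 * dphi2 Phi p + T0 p.2 * Phi (sph p)).
pose c p := (legendre1 q).[cos p.1] * T0 p.2 * (sin p.1 * sin p.1) * Phi (sph p).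
have ca : continuous a by rewrite /a; cont ltac:(first [exact q0|exact t0|exact k1|exact k2|exact k0|exact ql]).
have cb : continuous b by rewrite /b; cont ltac:(first [exact q0|exact t0|exact k3|exact k0]).
have cc : continuous c by rewrite /c; cont ltac:(first [exact ql|exact t0|exact k0]).
have a0 : \int[leb2]_(p in rect) a p = 0.
  apply: (integral_dtheta0 ca (A := fun p => T0 p.2 * (sin p.1 * sin p.1 * q.[cos p.1] * dtheta Phi p
      - (sin p.1 * cos p.1 * q.[cos p.1] - sin p.1 * sin p.1 * sin p.1 * q^`().[cos p.1]) * Phi (sph p)))).
    move=> t s.
    have h := is_derive_flux (T0 s) (is_derive_theta t s Ps) (is_derive_theta2 t s Ps)
      (is_derive_horner_cos q t) (is_derive_horner_cos q^`() t).
    apply: (is_derive_eq h); rewrite /a legendre1E /=.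
    have := cos2Dsin2 t; move: (sin t) (cos t) => S C CS.
    have -> : 1 - C ^+ 2 = S ^+ 2 by move: CS; lra.
    move: (q.[C]) (q^`().[C]) (q^`()^`().[C]) (T0 s) (dtheta Phi _) (dtheta2 Phi _) (Phi _).
    move=> u0 u1 u2 T f1 f2 f0; apply/eqP; rewrite -subr_eq0; apply/eqP.
    transitivity (T * u0 * f0 * (1 - (C ^+ 2 + S ^+ 2))); first by ring.
    by rewrite CS subrr mulr0.
  by move=> s /=; rewrite sinpi sin0; ring.
have b0 : \int[leb2]_(p in rect) b p = 0.
  apply: (integral_dphi0 cb (A := fun p => q.[cos p.1] * (T0 p.2 * dphi Phi p - T1 p.2 * Phi (sph p)))).
    move=> t s.
    have h := is_derive_flux2 q.[cos t] (is_derive_phi t s Ps) (is_derive_phi2 t s Ps) (dT0 s) (dT1 s).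
    apply: (is_derive_eq h); rewrite /b /=; ring.
  move=> t /=; rewrite pT0 pT1 /dphi /spherical /= cos2pi sin2pi cos0 sin0 //.
have mr := @measurable_rect R.
transitivity (\int[leb2]_(p in rect) (a p + b p + c p)).
  apply: eq_Rintegral => p _; rewrite sphere_laplacianE /a /b /c; ring.
rewrite RintegralD//; last 2 first.
- by apply: continuous_rect_integrable; exact: cD.
- exact: continuous_rect_integrable.
rewrite RintegralD//; last 2 first.
- exact: continuous_rect_integrable.
- exact: continuous_rect_integrable.
by rewrite a0 b0 !add0r; apply: eq_Rintegral => p _; rewrite /c; ring.
Qed.

(** The functions Psi related to Phi by the coordinate formula agree away from the
poles, where the factor sin(theta) vanishes. *)
Lemma laplace_beltrami_sin Phi Psi p : smooth Phi -> laplace_beltrami Phi Psi -> rect p ->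
  sin p.1 * Psi (sph p) = sin p.1 * sphere_laplacian Phi (sph p).
Proof.
move=> Ps lb [/= p1 _]; have [->|s0] := eqVneq (sin p.1) 0; first by rewrite !mul0r.
congr (_ * _); case: p p1 s0 => t s /=; rewrite in_itv/= => /andP[t0 t1] s0.
have t01 : 0 < t < pi.
  rewrite !lt_neqAle t0 t1 !andbT; apply/andP; split.
    by apply: contra s0 => /eqP <-; rewrite sin0.
  by apply: contra s0 => /eqP ->; rewrite sinpi.
by rewrite (lb _ _ t01) (sphere_laplacianP Ps _ t01).
Qed.

Let mPhi Phi : continuous Phi -> measurable_fun setT Phi.
Proof. exact: continuous_measurable3. Qed.

Lemma continuousM3 Phi Psi : continuous Phi -> continuous Psi ->
  continuous (fun x => Phi x * Psi x).
Proof. by move=> cf cg x; apply: cvgM; [exact: cf|exact: cg]. Qed.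

Let dcos t : is_derive t (1 : R) cos (- sin t). Proof. exact: is_derive_cos. Qed.
Let dsin t : is_derive t (1 : R) sin (cos t). Proof. exact: is_derive_sin. Qed.
Let dNsin t : is_derive t (1 : R) (fun r => - sin r) (- cos t).
Proof. exact: is_deriveN. Qed.
Let cNsin : continuous (fun r : R => - sin r).
Proof. by move=> x; apply: cvgN; exact: continuous_sin. Qed.

(** The harmonics u q(x_3), with u = x_1 or x_2, against an arbitrary test
function Phi. *)
Lemma green_zonal (q : {poly R}) Phi Psi (u : space3 R -> R) (T0 T1 : R -> R) :
  smooth Phi -> continuous Psi -> laplace_beltrami Phi Psi ->
  smooth u -> (forall p, u (sph p) = sin p.1 * T0 p.2) ->
  continuous T0 -> continuous T1 ->
  (forall t, is_derive t (1 : R) T0 (T1 t)) -> (forall t, is_derive t (1 : R) T1 (- T0 t)) ->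
  T0 (pi *+ 2) = T0 0 -> T1 (pi *+ 2) = T1 0 ->
  \int[mu]_x (u x * q.[x.2] * Psi x) = \int[mu]_x (u x * (legendre1 q).[x.2] * Phi x).
Proof.
move=> Ps cPsi lb su uE cT0 cT1 dT0 dT1 pT0 pT1; have cPhi := smooth_continuous Ps.
have cu r : continuous (fun x => u x * r.[x.2]).
  by apply: smooth_continuous; apply: smoothM => //; exact: smooth_horner3.
rewrite !Rintegral_area; last 2 first.
- by apply: mPhi; exact: continuousM3.
- by apply: mPhi; exact: continuousM3.
have E := green_rect q Ps cT0 cT1 dT0 dT1 pT0 pT1.
rewrite [RHS](_ : _ = \int[leb2]_(p in rect)
  ((legendre1 q).[cos p.1] * T0 p.2 * sin p.1 ^+ 2 * Phi (sph p))); last first.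
  by apply: eq_Rintegral => p _; rewrite uE /=; ring.
rewrite -E; apply: eq_Rintegral => p /[!inE] rp /=; rewrite uE.
have e := laplace_beltrami_sin Ps lb rp.
transitivity (q.[cos p.1] * T0 p.2 * sin p.1 * (sin p.1 * Psi (sph p))); first by ring.
by rewrite e; ring.
Qed.

Lemma green_x1 (q : {poly R}) Phi Psi : smooth Phi -> continuous Psi ->
  laplace_beltrami Phi Psi ->
  \int[mu]_x (x.1.1 * q.[x.2] * Psi x) = \int[mu]_x (x.1.1 * (legendre1 q).[x.2] * Phi x).
Proof.
move=> Ps cPsi lb; apply: (green_zonal q Ps cPsi lb (@smooth_x1 R) _
  (@continuous_cos R) cNsin dcos dNsin); by rewrite ?cos2pi ?cos0 ?sin2pi ?sin0.
Qed.

Lemma green_x2 (q : {poly R}) Phi Psi : smooth Phi -> continuous Psi ->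
  laplace_beltrami Phi Psi ->
  \int[mu]_x (x.1.2 * q.[x.2] * Psi x) = \int[mu]_x (x.1.2 * (legendre1 q).[x.2] * Phi x).
Proof.
move=> Ps cPsi lb; apply: (green_zonal q Ps cPsi lb (@smooth_x2 R) _
  (@continuous_sin R) (@continuous_cos R) dsin dcos); by rewrite ?cos2pi ?cos0 ?sin2pi ?sin0.
Qed.

Lemma continuous_X3 Phi : smooth Phi -> continuous (X3 Phi).
Proof.
move=> Ps; rewrite (_ : X3 Phi = fun x => x.1.1 * 'D_(e2 R) Phi x - x.1.2 * 'D_(e1 R) Phi x).
  apply: smooth_continuous; apply: smoothB; apply: smoothM.
  - exact: smooth_x1.
  - exact: smooth_derive.
  - exact: smooth_x2.
  - exact: smooth_derive.
by apply/funext => x; exact: X3E.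
Qed.

Lemma X3_spherical Phi p : smooth Phi -> X3 Phi (sph p) = dphi Phi p.
Proof. by move=> Ps; rewrite X3E// /dphi mulNr addrC. Qed.

(** X_3 is d/dphi, which is skew-symmetric on periodic functions. *)
Lemma X3_by_parts (q : {poly R}) Phi (u0 u1 : space3 R -> R) (T0 T1 : R -> R) :
  smooth Phi -> smooth u0 -> smooth u1 ->
  (forall p, u0 (sph p) = sin p.1 * T0 p.2) -> (forall p, u1 (sph p) = sin p.1 * T1 p.2) ->
  continuous T0 -> continuous T1 ->
  (forall t, is_derive t (1 : R) T0 (T1 t)) -> T0 (pi *+ 2) = T0 0 ->
  \int[mu]_x (u0 x * q.[x.2] * X3 Phi x) = - \int[mu]_x (u1 x * q.[x.2] * Phi x).
Proof.
move=> Ps s0 s1 u0E u1E cT0 cT1 dT0 pT0.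
have cu u : smooth u -> continuous (fun x => u x * q.[x.2]).
  by move=> su; apply: smooth_continuous; apply: smoothM => //; exact: smooth_horner3.
rewrite !Rintegral_area; last 2 first.
- by apply: mPhi; apply: continuousM3; [exact: cu|exact: smooth_continuous].
- by apply: mPhi; apply: continuousM3; [exact: cu|exact: continuous_X3].
have k0 := continuous_smooth_sph Ps; have k1 := continuous_dphi Ps.
have q0 := @continuous_horner_cos q.
have t0 : continuous (fun p : R * R => T0 p.2).
  by move=> p; apply: continuous_comp; [exact: c2|exact: cT0].
have t1 : continuous (fun p : R * R => T1 p.2).
  by move=> p; apply: continuous_comp; [exact: c2|exact: cT1].
pose a p := sin p.1 * T0 p.2 * q.[cos p.1] * dphi Phi p * sin p.1.
pose b p := sin p.1 * T1 p.2 * q.[cos p.1] * Phi (sph p) * sin p.1.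
have ca : continuous a by rewrite /a; cont ltac:(first [exact q0|exact t0|exact k1]).
have cb : continuous b by rewrite /b; cont ltac:(first [exact q0|exact t1|exact k0]).
have ab : \int[leb2]_(p in rect) (a p + b p) = 0.
  apply: (integral_dphi0 (cD ca cb) (A := fun p => sin p.1 * q.[cos p.1] * sin p.1 * (T0 p.2 * Phi (sph p) ))).
    move=> t s.
    have h := is_deriveZ (sin t * q.[cos t] * sin t) (is_deriveM (dT0 s) (is_derive_phi t s Ps)).
    by apply: (is_derive_eq h); rewrite /a /b /GRing.scale/=; ring.
  by move=> t /=; rewrite pT0 /spherical /= cos2pi sin2pi cos0 sin0.
rewrite (_ : \int[leb2]_(p in rect) _ = \int[leb2]_(p in rect) a p); last first.
  by apply: eq_Rintegral => p _; rewrite (X3_spherical p Ps) u0E.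
rewrite [in RHS](_ : \int[leb2]_(p in rect) _ = \int[leb2]_(p in rect) b p); last first.
  by apply: eq_Rintegral => p _; rewrite u1E.
move: ab; rewrite RintegralD//.
- by move/eqP; rewrite addr_eq0 => /eqP.
- exact: measurable_rect.
- exact: continuous_rect_integrable.
- exact: continuous_rect_integrable.
Qed.

Lemma X3_x1 (q : {poly R}) Phi : smooth Phi ->
  \int[mu]_x (x.1.1 * q.[x.2] * X3 Phi x) = - \int[mu]_x (- x.1.2 * q.[x.2] * Phi x).
Proof.
move=> Ps; apply: (X3_by_parts q Ps (@smooth_x1 R) (smoothN (@smooth_x2 R)) _ _
  (@continuous_cos R) cNsin dcos) => [p|p|] /=; by rewrite ?mulrN ?cos2pi ?cos0.
Qed.

Lemma X3_x2 (q : {poly R}) Phi : smooth Phi ->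
  \int[mu]_x (x.1.2 * q.[x.2] * X3 Phi x) = - \int[mu]_x (x.1.1 * q.[x.2] * Phi x).
Proof.
move=> Ps; apply: (X3_by_parts q Ps (@smooth_x2 R) (@smooth_x1 R) _ _
  (@continuous_sin R) (@continuous_cos R) dsin); by rewrite ?sin2pi ?sin0.
Qed.

End Green.

(** * The Laplacian on polynomials *)

Section Monomials.
Variable R : realType.
Implicit Types (Phi Psi u : space3 R -> R) (p q : {poly R}).
Notation mu := (@area R).
Notation L2r f := (f \in Lfun (@area R) 2%:E).

Lemma poly_linear0 (T : {poly R} -> R) :
  (forall a p q, T (a *: p + q) = a * T p + T q) -> (forall i, T 'X^i = 0) ->
  forall p, T p = 0.
Proof.
move=> Tl T0 p; have T00 : T 0 = 0 by have := Tl (-1) 0 0; rewrite scaler0 addr0 mulN1r addNr.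
rewrite -[p]coefK poly_def.
elim/big_ind: _ => // [x y Tx Ty|i _]; first by rewrite -[x]scale1r Tl Tx Ty mulr0 addr0.
by rewrite -[_ *: _]addr0 Tl T0 T00 mulr0 addr0.
Qed.

Lemma deriveD_smooth u1 u2 v x : smooth u1 -> smooth u2 ->
  'D_v (fun x => u1 x + u2 x) x = 'D_v u1 x + 'D_v u2 x.
Proof.
by move=> s1 s2; apply: deriveD; apply: diff_derivable; exact: smooth_differentiable.
Qed.

Lemma deriveM_smooth u1 u2 v x : smooth u1 -> smooth u2 ->
  'D_v (fun x => u1 x * u2 x) x = u1 x * 'D_v u2 x + u2 x * 'D_v u1 x.
Proof.
by move=> s1 s2; apply: deriveM; apply: diff_derivable; exact: smooth_differentiable.
Qed.

Lemma derive_horner p u v x : smooth u ->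
  'D_v (fun x => p.[u x]) x = p^`().[u x] * 'D_v u x.
Proof.
move=> us; elim/poly_ind: p => [|q c IH].
  rewrite deriv0 (_ : (fun x => _) = fun=> 0); last by apply/funext => y; rewrite horner0.
  by rewrite horner0 mul0r; exact: derive_cst.
have s1 := smooth_horner q us.
have -> : (fun x => (q * 'X + c%:P).[u x]) = (fun x => q.[u x] * u x + c).
  by apply/funext => y; rewrite hornerMXaddC.
rewrite deriveD_smooth//; [|exact: smoothM|exact: smooth_cst].
rewrite deriveM_smooth// IH.
rewrite (_ : 'D_v (fun=> c) x = 0); last exact: derive_cst.
rewrite derivD derivM derivX derivC !addr0 mulr1 hornerD hornerM hornerX.
by move: ('D_v u x) (q.[u x]) (q^`().[u x]) (u x) => d a b c'; ring.
Qed.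

(** Products of one polynomial per coordinate are stable under the partial
derivatives, and contain the monomials and the functions x_1 q(x_3), x_2 q(x_3). *)
Definition prod3 p1 p2 p3 : space3 R -> R := fun x => p1.[x.1.1] * p2.[x.1.2] * p3.[x.2].

Lemma smooth_prod3 p1 p2 p3 : smooth (prod3 p1 p2 p3).
Proof.
apply: smoothM; first apply: smoothM; apply: smooth_horner.
- exact: smooth_x1.
- exact: smooth_x2.
- exact: smooth_x3.
Qed.

Lemma derive_prod3 p1 p2 p3 v : 'D_v (prod3 p1 p2 p3) = fun x =>
  v.1.1 * prod3 p1^`() p2 p3 x + v.1.2 * prod3 p1 p2^`() p3 x + v.2 * prod3 p1 p2 p3^`() x.
Proof.
have s1 := smooth_horner p1 (@smooth_x1 R).
have s2 := smooth_horner p2 (@smooth_x2 R).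
have s3 := smooth_horner p3 (@smooth_x3 R).
apply/funext => x; rewrite deriveM_smooth//; last exact: smoothM.
rewrite deriveM_smooth// (derive_horner p1 v x (@smooth_x1 R)) (derive_horner p2 v x (@smooth_x2 R)).
rewrite (derive_horner p3 v x (@smooth_x3 R)).
have E (f g : space3 R -> R) : f = g -> f x = g x by move->.
rewrite (E _ _ (derive_x1 v)) (E _ _ (derive_x2 v)) (E _ _ (derive_x3 v)).
by rewrite /prod3; ring.
Qed.

Lemma derive1_prod3 p1 p2 p3 : 'D_(e1 R) (prod3 p1 p2 p3) = prod3 p1^`() p2 p3.
Proof. by rewrite derive_prod3 /=; apply/funext => x; rewrite mul1r !mul0r !addr0. Qed.
Lemma derive2_prod3 p1 p2 p3 : 'D_(e2 R) (prod3 p1 p2 p3) = prod3 p1 p2^`() p3.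
Proof. by rewrite derive_prod3 /=; apply/funext => x; rewrite mul1r !mul0r !addr0 add0r. Qed.
Lemma derive3_prod3 p1 p2 p3 : 'D_(e3 R) (prod3 p1 p2 p3) = prod3 p1 p2 p3^`().
Proof. by rewrite derive_prod3 /=; apply/funext => x; rewrite mul1r !mul0r !add0r. Qed.

Let sphere_laplacian_of Phi f1 f2 f3 f11 f12 f13 f21 f22 f23 f31 f32 f33 x :
  'D_(e1 R) Phi = f1 -> 'D_(e2 R) Phi = f2 -> 'D_(e3 R) Phi = f3 ->
  'D_(e1 R) f1 = f11 -> 'D_(e1 R) f2 = f12 -> 'D_(e1 R) f3 = f13 ->
  'D_(e2 R) f1 = f21 -> 'D_(e2 R) f2 = f22 -> 'D_(e2 R) f3 = f23 ->
  'D_(e3 R) f1 = f31 -> 'D_(e3 R) f2 = f32 -> 'D_(e3 R) f3 = f33 ->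
  sphere_laplacian Phi x = f11 x + f22 x + f33 x
  - (x.1.1 * x.1.1 * f11 x + x.1.1 * x.1.2 * f12 x + x.1.1 * x.2 * f13 x
     + x.1.2 * x.1.1 * f21 x + x.1.2 * x.1.2 * f22 x + x.1.2 * x.2 * f23 x
     + x.2 * x.1.1 * f31 x + x.2 * x.1.2 * f32 x + x.2 * x.2 * f33 x)
  - 2 * (x.1.1 * f1 x + x.1.2 * f2 x + x.2 * f3 x).
Proof. by do 12 move=> <-. Qed.

Lemma sphere_laplacian_prod3 p1 p2 p3 x : sphere_laplacian (prod3 p1 p2 p3) x =
  prod3 p1^`()^`() p2 p3 x + prod3 p1 p2^`()^`() p3 x + prod3 p1 p2 p3^`()^`() x
  - (x.1.1 * x.1.1 * prod3 p1^`()^`() p2 p3 x + x.1.2 * x.1.2 * prod3 p1 p2^`()^`() p3 x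
     + x.2 * x.2 * prod3 p1 p2 p3^`()^`() x
     + 2 * (x.1.1 * x.1.2 * prod3 p1^`() p2^`() p3 x
            + x.1.1 * x.2 * prod3 p1^`() p2 p3^`() x
            + x.1.2 * x.2 * prod3 p1 p2^`() p3^`() x))
  - 2 * (x.1.1 * prod3 p1^`() p2 p3 x + x.1.2 * prod3 p1 p2^`() p3 x
         + x.2 * prod3 p1 p2 p3^`() x).
Proof.
have d1 := derive1_prod3; have d2 := derive2_prod3; have d3 := derive3_prod3.
rewrite (sphere_laplacian_of x (d1 p1 p2 p3) (d2 p1 p2 p3) (d3 p1 p2 p3)
  (d1 _ _ _) (d1 _ _ _) (d1 _ _ _) (d2 _ _ _) (d2 _ _ _) (d2 _ _ _)
  (d3 _ _ _) (d3 _ _ _) (d3 _ _ _)).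
rewrite /prod3; move: x => [[a b] c] /=.
move: (p1.[a]) (p1^`().[a]) (p1^`()^`().[a]) (p2.[b]) (p2^`().[b]) (p2^`()^`().[b]).
move: (p3.[c]) (p3^`().[c]) (p3^`()^`().[c]) => *; ring.
Qed.

Definition zonal1 q : space3 R -> R := fun x => x.1.1 * q.[x.2].
Definition zonal2 q : space3 R -> R := fun x => x.1.2 * q.[x.2].

Lemma zonal1E q : zonal1 q = prod3 'X 1 q.
Proof. by apply/funext => x; rewrite /prod3 hornerX hornerC mulr1. Qed.
Lemma zonal2E q : zonal2 q = prod3 1 'X q.
Proof. by apply/funext => x; rewrite /prod3 hornerX hornerC mul1r. Qed.
Lemma smooth_zonal1 q : smooth (zonal1 q).
Proof. by rewrite zonal1E; exact: smooth_prod3. Qed.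
Lemma smooth_zonal2 q : smooth (zonal2 q).
Proof. by rewrite zonal2E; exact: smooth_prod3. Qed.

Lemma laplacian_zonal1 q : laplace_beltrami (zonal1 q) (zonal1 (legendre1 q)).
Proof.
rewrite (_ : zonal1 (legendre1 q) = sphere_laplacian (zonal1 q)).
  exact: sphere_laplacianP (smooth_zonal1 q).
apply/funext => x; rewrite (zonal1E q) sphere_laplacian_prod3 /prod3 /zonal1 legendre1E.
by rewrite derivX derivC -(polyC1 R) ?derivC ?hornerC ?hornerX; ring.
Qed.

Lemma laplacian_zonal2 q : laplace_beltrami (zonal2 q) (zonal2 (legendre1 q)).
Proof.
rewrite (_ : zonal2 (legendre1 q) = sphere_laplacian (zonal2 q)).
  exact: sphere_laplacianP (smooth_zonal2 q).
apply/funext => x; rewrite (zonal2E q) sphere_laplacian_prod3 /prod3 /zonal2 legendre1E.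
by rewrite derivX derivC -(polyC1 R) ?derivC ?hornerC ?hornerX; ring.
Qed.

Definition mono i j k : space3 R -> R := prod3 'X^i 'X^j 'X^k.

Let eulerX i (t : R) : t * ('X^i)^`().[t] = i%:R * ('X^i).[t].
Proof.
rewrite derivXn hornerMn !hornerXn; case: i => [|i]; first by rewrite mulr0n mulr0 mul0r.
by rewrite exprS mulrnAr mulr_natl.
Qed.

Let eulerX2 i (t : R) : t * t * ('X^i)^`()^`().[t] = i%:R * (i%:R - 1) * ('X^i).[t].
Proof.
rewrite derivXn derivMn hornerMn mulrnAr -mulrA -[X in (_ * X) *+ _]/(_) eulerX.
case: i => [|i] /=; first by rewrite mulr0n !mul0r.
rewrite !hornerXn -mulr_natl exprS -natr1; ring.
Qed.

(** Euler's identities for the three factors combine into the factor N (N + 1),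
where N = a + b + c is the degree. *)
Let euler_identity (x y z a b c u u1 u2 v v1 v2 w w1 w2 : R) :
  x * u1 = a * u -> x * x * u2 = a * (a - 1) * u ->
  y * v1 = b * v -> y * y * v2 = b * (b - 1) * v ->
  z * w1 = c * w -> z * z * w2 = c * (c - 1) * w ->
  u2 * v * w + u * v2 * w + u * v * w2
  - (x * x * (u2 * v * w) + y * y * (u * v2 * w) + z * z * (u * v * w2)
     + 2 * (x * y * (u1 * v1 * w) + x * z * (u1 * v * w1) + y * z * (u * v1 * w1)))
  - 2 * (x * (u1 * v * w) + y * (u * v1 * w) + z * (u * v * w1)) =
  u2 * v * w + u * v2 * w + u * v * w2 - (a + b + c) * (a + b + c + 1) * (u * v * w).
Proof.
move=> h1 h2 h3 h4 h5 h6.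
transitivity (u2 * v * w + u * v2 * w + u * v * w2
  - ((x * x * u2) * v * w + u * (y * y * v2) * w + u * v * (z * z * w2)
     + 2 * ((x * u1) * (y * v1) * w + (x * u1) * v * (z * w1) + u * (y * v1) * (z * w1)))
  - 2 * ((x * u1) * v * w + u * (y * v1) * w + u * v * (z * w1))); first by ring.
by rewrite h1 h2 h3 h4 h5 h6; ring.
Qed.

Lemma sphere_laplacian_mono i j k x : sphere_laplacian (mono i j k) x =
  (i * i.-1)%:R * mono i.-2 j k x + (j * j.-1)%:R * mono i j.-2 k x
  + (k * k.-1)%:R * mono i j k.-2 x
  - ((i + j + k) * (i + j + k).+1)%:R * mono i j k x.
Proof.
have d2 n (t : R) : ('X^n : {poly R})^`()^`().[t] = (n * n.-1)%:R * ('X^(n.-2) : {poly R}).[t].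
  by rewrite derivXn derivMn derivXn -mulrnA hornerMn mulr_natl mulnC.
rewrite sphere_laplacian_prod3 /prod3 (euler_identity (eulerX i _) (eulerX2 i _)
  (eulerX j _) (eulerX2 j _) (eulerX k _) (eulerX2 k _)).
have -> : ((i + j + k) * (i + j + k).+1)%:R =
    (i%:R + j%:R + k%:R) * (i%:R + j%:R + k%:R + 1) :> R by rewrite natrM -natr1 !natrD.
rewrite !d2 /mono /prod3.
move: ('X^i).[_] ('X^j).[_] ('X^k).[_] ('X^(i.-2)).[_] ('X^(j.-2)).[_] ('X^(k.-2)).[_].
by move: (i%:R) (j%:R) (k%:R) (i * _)%:R (j * _)%:R (k * _)%:R => *; ring.
Qed.

Lemma L2_prod3 p1 p2 p3 : L2r (prod3 p1 p2 p3).
Proof. by apply: continuous_L2; apply: smooth_continuous; exact: smooth_prod3. Qed.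

Lemma L2_mono i j k : L2r (mono i j k). Proof. exact: L2_prod3. Qed.

Lemma monomial_moments_ae0 v : L2r v -> (forall i j k, dot mu (mono i j k) v = 0) ->
  {ae mu, forall x, v x = 0}.
Proof.
move=> vL m0; pose m f := dot mu f v.
have mD a f g : L2r f -> L2r g -> m (fun x => a * f x + g x) = a * m f + m g.
  by move=> fL gL; exact: dot_lin.
have lin3 p1 p2 p3 : m (prod3 p1 p2 p3) = 0.
  move: p3; apply: poly_linear0 => [a p q|k].
    rewrite -mD ?L2_prod3//; apply: eq_Rintegral => x _.
    by rewrite /prod3 hornerD hornerZ; ring.
  move: p2; apply: poly_linear0 => [a p q|j].
    rewrite -mD ?L2_prod3//; apply: eq_Rintegral => x _.
    by rewrite /prod3 hornerD hornerZ; ring.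
  move: p1; apply: poly_linear0 => [a p q|i]; last exact: m0.
  rewrite -mD ?L2_prod3//; apply: eq_Rintegral => x _.
  by rewrite /prod3 hornerD hornerZ; ring.
apply: poly_moments_ae0 => [|p1 p2 p3].
  have := L2_mul vL (Lfun_cst mu 1 2).
  by under eq_fun do rewrite mulr1.
by rewrite -[RHS](lin3 p1 p2 p3); apply: eq_Rintegral => x _; rewrite /prod3; ring.
Qed.

(** A monomial of degree N is mapped to - N (N + 1) times itself plus monomials of
degree N - 2, so that the moments of v vanish by induction on the degree. Hence
the solution of Delta u = f of mean zero is unique. *)
Lemma laplacian_injective v : L2r v -> \int[mu]_x v x = 0 ->
  (forall Phi Psi, smooth Phi -> smooth Psi -> laplace_beltrami Phi Psi ->
     \int[mu]_x (v x * Psi x) = 0) ->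
  {ae mu, forall x, v x = 0}.
Proof.
move=> vL v0 vD; pose m f := dot mu f v.
have mD a f g : L2r f -> L2r g -> m (fun x => a * f x + g x) = a * m f + m g.
  by move=> fL gL; exact: dot_lin.
have mZ a f : L2r f -> m (fun x => a * f x) = a * m f by move=> fL; exact: dotZl.
have m0 N i j k : (i + j + k < N)%N -> m (mono i j k) = 0.
  elim: N i j k => // N IH i j k iN.
  have [/eqP|n0] := eqVneq (i + j + k)%N 0%N.
    rewrite !addn_eq0 => /andP[/andP[/eqP -> /eqP ->] /eqP ->].
    rewrite -[RHS]v0; apply: eq_Rintegral => x _.
    by rewrite /mono /prod3 !expr0 !hornerC !mul1r.
  have lower n a b c : (a + b + c < i + j + k)%N || (n == 0)%N ->
      n%:R * m (mono a b c) = 0.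
    move=> /orP[h|/eqP ->]; last by rewrite mul0r.
    by rewrite IH ?mulr0//; lia.
  pose f1 := mono i.-2 j k; pose f2 := mono i j.-2 k; pose f3 := mono i j k.-2.
  pose c4 : R := ((i + j + k) * (i + j + k).+1)%:R.
  pose G x := (i * i.-1)%:R * f1 x + ((j * j.-1)%:R * f2 x + ((k * k.-1)%:R * f3 x
    + - c4 * mono i j k x)).
  have sm a b c : smooth (mono a b c) by exact: smooth_prod3.
  have sG : smooth G.
    by apply: smoothD; [|apply: smoothD; [|apply: smoothD]]; apply: smoothZ; exact: sm.
  have lG : laplace_beltrami (mono i j k) G.
    rewrite (_ : G = sphere_laplacian (mono i j k)); first exact: sphere_laplacianP.
    by apply/funext => x; rewrite sphere_laplacian_mono /G /f1 /f2 /f3 mulNr !addrA.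
  have := vD _ _ (sm i j k) sG lG.
  rewrite (_ : \int[mu]_x _ = m G); last by apply: eq_Rintegral => x _; rewrite mulrC.
  have L4 : L2r (fun x => - c4 * mono i j k x) by exact: L2Z (L2_mono i j k).
  have L3 : L2r (fun x => (k * k.-1)%:R * f3 x + - c4 * mono i j k x) by exact: L2_lin (L2_mono _ _ _) L4.
  have L23 : L2r (fun x => (j * j.-1)%:R * f2 x +
    ((k * k.-1)%:R * f3 x + - c4 * mono i j k x)) by exact: L2_lin (L2_mono _ _ _) L3.
  rewrite (mD _ _ _ (L2_mono _ _ _) L23) (mD _ _ _ (L2_mono _ _ _) L3) (mD _ _ _ (L2_mono _ _ _) L4) (mZ _ _ (L2_mono _ _ _)).
  rewrite !lower ?add0r; last 3 first.
  - by rewrite muln_eq0; lia.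
  - by rewrite muln_eq0; lia.
  - by rewrite muln_eq0; lia.
  move/eqP; rewrite mulf_eq0 oppr_eq0 pnatr_eq0 muln_eq0 (negPf n0) /= => /eqP.
  by [].
apply: (monomial_moments_ae0 vL) => i j k; exact: (m0 (i + j + k).+1).
Qed.

End Monomials.

(** * Eigenpolynomials of the Laplacian on the first Fourier mode *)

Section Eigenpolynomials.
Variable R : realType.
Implicit Types p q : {poly R}.

Lemma legendre1_is_linear : linear (@legendre1 R).
Proof.
move=> a p q; rewrite /legendre1 !(derivD, derivZ) -!mul_polyC; ring.
Qed.
HB.instance Definition _ := GRing.isLinear.Build R {poly R} {poly R} _ (@legendre1 R)
  legendre1_is_linear.

(** legendre1 is triangular on the monomials, with the distinct diagonal entries
- (k+1)(k+2): this is all the theory of Gegenbauer polynomials needed below. *)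
Lemma coef_legendre1 p k : (legendre1 p)`_k =
  (k.+1 * k.+2)%:R * p`_k.+2 - (k.+1 * k.+2)%:R * p`_k.
Proof.
rewrite /legendre1 -mulrA mulrBl mul1r !coefB mulrC !coefMXn.
rewrite [2%:P * p]mulrC coefMC coefCM coefXM !coef_deriv.
have E (x : R) n : x *+ n = x * n%:R by rewrite mulr_natr.
case: k => [|[|k]] /=.
- by rewrite mulr1n natrM mulr2n; ring.
- by rewrite subr0 mulr1n natrM ![p`_3 *+ _]E ![_ * _%:R *+ _]E; ring.
- rewrite natrM (_ : k.+2 - 2 = k)%N; last by lia.
  rewrite ![p`_k.+4 *+ _]E ![p`_k.+2 *+ _]E ![_ * _%:R *+ _]E.
  have -> : (k.+4%:R : R) = k%:R + 4%:R by rewrite -addn4 natrD.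
  have -> : (k.+3%:R : R) = k%:R + 3%:R by rewrite -addn3 natrD.
  have -> : (k.+2%:R : R) = k%:R + 2%:R by rewrite -addn2 natrD.
  have -> : (k.+1%:R : R) = k%:R + 1 by rewrite -addn1 natrD.
  by move: (p`_k.+4) (p`_k.+2) (k%:R) => *; ring.
Qed.

(** - lambda_{n+1}, as - lambda_l = - l (l + 1). *)
Definition legendre_eig (n : nat) : R := - (n.+1 * n.+2)%:R.

Lemma legendre_eig_inj m n : legendre_eig m = legendre_eig n -> m = n.
Proof.
move=> /eqP; rewrite eqr_opp eqr_nat => /eqP; nia.
Qed.

Definition lower1 j p := legendre1 p - legendre_eig j *: p.

Lemma coef_lower1 j p k : (size p <= k.+1)%N ->
  (lower1 j p)`_k = (legendre_eig k - legendre_eig j) * p`_k.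
Proof.
move=> pk; rewrite coefB coefZ coef_legendre1 [p`_k.+2]nth_default; last exact: leqW.
by rewrite /legendre_eig; ring.
Qed.

Lemma size_lower1 j p k : (size p <= k)%N -> (size (lower1 j p) <= k)%N.
Proof.
move=> pk; apply/leq_sizeP => i ki; rewrite coef_lower1; last exact/leqW/(leq_trans pk).
by rewrite [p`_i]nth_default ?mulr0//; exact: leq_trans ki.
Qed.

(** legendre1 - legendre_eig j kills the leading term in degree j. *)
Lemma size_lower1_drop j p : (size p <= j.+1)%N -> (size (lower1 j p) <= j)%N.
Proof.
move=> pj; apply/leq_sizeP => i ki; rewrite coef_lower1; last exact: leq_trans pj _.
have [->|ij] := eqVneq i j; first by rewrite subrr mul0r.
by rewrite [p`_i]nth_default ?mulr0// (leq_trans pj)// ltn_neqAle eq_sym ij.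
Qed.

Fixpoint lower k p := if k is j.+1 then lower j (lower1 j p) else p.

Lemma lower_eq0 k p : (size p <= k)%N -> lower k p = 0.
Proof.
elim: k p => [|k IH] p /=; first by rewrite leqn0 size_poly_eq0 => /eqP.
by move=> /size_lower1_drop; exact: IH.
Qed.

Lemma lower_lin k a p q : lower k (a *: p + q) = a *: lower k p + lower k q.
Proof.
elim: k p q => //= k IH p q; rewrite -IH; congr (lower k _).
by rewrite /lower1 linearP /= -!mul_polyC; ring.
Qed.

Lemma lower_legendre1 k p : lower k (legendre1 p) = legendre1 (lower k p).
Proof.
elim: k p => //= k IH p; rewrite -IH; congr (lower k _).
by rewrite /lower1 -!scaleNr ![_ + _ *: _]addrC legendre1_is_linear.
Qed.

Lemma coef_lower k p n : (size p <= n.+1)%N ->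
  (size (lower k p) <= n.+1)%N /\
  (lower k p)`_n = \prod_(j < k) (legendre_eig n - legendre_eig j) * p`_n.
Proof.
elim: k p => [|k IH] p pn /=; first by rewrite big_ord0 mul1r.
have [h1 h2] := IH _ (size_lower1 k pn); split=> //.
by rewrite h2 big_ord_recr/= coef_lower1 ?mulrA.
Qed.

(** Applying all the factors legendre1 - legendre_eig j, j < n, to X^n leaves the
eigenvector of degree n: the Gegenbauer polynomial C_n^(3/2), that is the
derivative of the Legendre polynomial of degree n+1, up to a factor. *)
Definition legendre_poly n := lower n 'X^n.

Lemma legendre1_legendre_poly n : legendre1 (legendre_poly n) = legendre_eig n *: legendre_poly n.
Proof.
apply/eqP; rewrite -subr_eq0 -scaleNr addrC /legendre_poly -lower_legendre1 -lower_lin scaleNr addrC.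
by rewrite lower_eq0// size_lower1_drop// size_polyXn.
Qed.

Lemma legendre_poly0 : legendre_poly 0 = 1. Proof. by rewrite /legendre_poly /= expr0. Qed.
Lemma legendre_poly1 : legendre_poly 1 = - 4 *: 'X.
Proof.
apply/polyP => -[|[|k]]; rewrite /legendre_poly /= expr1 coefB !coefZ coef_legendre1 !coefX /=.
- by rewrite !mulr0 !subr0.
- by rewrite /legendre_eig !natrM; ring.
- by rewrite !mulr0 !subr0.
Qed.

(** legendre_poly n has degree n, its leading coefficient being the product of the
differences of eigenvalues, so that these polynomials span. *)
Lemma legendre_poly_span (T : {poly R} -> R) :
  (forall a p q, T (a *: p + q) = a * T p + T q) -> (forall n, T (legendre_poly n) = 0) ->
  forall p, T p = 0.
Proof.
move=> Tl T0 p; have T00 : T 0 = 0 by have := Tl (-1) 0 0; rewrite scaler0 addr0 mulN1r addNr.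
have : (size p <= size p)%N by [].
move: {2}(size p) => n; elim: n p => [|n IH] p.
  by rewrite leqn0 size_poly_eq0 => /eqP ->.
move=> pn; have [|h1 h2] := @coef_lower n 'X^n n; first by rewrite size_polyXn.
rewrite coefXn eqxx mulr1 in h2.
pose c := \prod_(j < n) (legendre_eig n - legendre_eig j).
have c0 : c != 0.
  apply/prodf_neq0 => j _; rewrite subr_eq0; apply/eqP => /legendre_eig_inj E.
  by have := ltn_ord j; rewrite -E ltnn.
have : T (- (p`_n / c) *: legendre_poly n + p) = 0.
  apply: IH; apply/leq_sizeP => i ni; rewrite coefD coefZ.
  have [->|ij] := eqVneq i n; first by rewrite h2 -/c mulNr divfK// addNr.
  have i_gt : (n < i)%N by rewrite ltn_neqAle eq_sym ij.
  have -> : p`_i = 0 by rewrite nth_default// (leq_trans pn).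
  have -> : (legendre_poly n)`_i = 0 by rewrite nth_default//; exact: leq_trans h1 i_gt.
  by rewrite mulr0 addr0.
by rewrite Tl T0 mulr0 add0r.
Qed.

End Eigenpolynomials.

(** * Fourier modes of the rotations *)

Section RotationModes.
Variable R : realType.
Implicit Types (f g u v Phi : space3 R -> R) (p q : {poly R}).
Notation mu := (@area R).
Notation L2r f := (f \in Lfun (@area R) 2%:E).

Lemma X3M u v x : smooth u -> smooth v ->
  X3 (fun x => u x * v x) x = u x * X3 v x + v x * X3 u x.
Proof.
move=> su sv; rewrite !X3E//; last exact: smoothM.
rewrite !deriveM_smooth//.
move: ('D_(e1 R) u x) ('D_(e2 R) u x) ('D_(e1 R) v x) ('D_(e2 R) v x) (u x) (v x) => *; ring.
Qed.

Lemma X3D u v x : smooth u -> smooth v ->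
  X3 (fun x => u x + v x) x = X3 u x + X3 v x.
Proof.
move=> su sv; rewrite !X3E//; last exact: smoothD.
rewrite !deriveD_smooth//.
move: ('D_(e1 R) u x) ('D_(e2 R) u x) ('D_(e1 R) v x) ('D_(e2 R) v x) => *; ring.
Qed.

Lemma X3_cst (c : R) x : X3 (fun=> c) x = 0.
Proof. by rewrite /X3 derive1E derive_cst. Qed.

Lemma X3_coord1 (x : space3 R) : X3 (fun x : space3 R => x.1.1) x = - x.1.2.
Proof.
have E f g : f = g -> f x = g x by move->.
rewrite X3E; last exact: smooth_x1.
by rewrite (E _ _ (derive_x1 (e1 R))) (E _ _ (derive_x1 (e2 R))) /= mulr0 mulr1 add0r.
Qed.

Lemma X3_coord2 (x : space3 R) : X3 (fun x : space3 R => x.1.2) x = x.1.1.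
Proof.
have E f g : f = g -> f x = g x by move->.
rewrite X3E; last exact: smooth_x2.
by rewrite (E _ _ (derive_x2 (e1 R))) (E _ _ (derive_x2 (e2 R))) /= mulr0 mulr1 subr0.
Qed.

Lemma X3_zonal p (x : space3 R) : X3 (fun x : space3 R => p.[x.2]) x = 0.
Proof. exact: (X3_cst p.[x.2] x). Qed.

(** Real and imaginary parts of (x_1 + i x_2)^m. *)
Fixpoint sectoral (m : nat) (x : space3 R) : R * R :=
  if m is m'.+1 then
    let: (a, b) := sectoral m' x in (x.1.1 * a - x.1.2 * b, x.1.1 * b + x.1.2 * a)
  else (1, 0).

Notation secA m := (fun x => (sectoral m x).1).
Notation secB m := (fun x => (sectoral m x).2).

Lemma sectoralSA m : secA m.+1 = fun x => x.1.1 * secA m x - x.1.2 * secB m x.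
Proof. by apply/funext => x /=; case: (sectoral m x). Qed.
Lemma sectoralSB m : secB m.+1 = fun x => x.1.1 * secB m x + x.1.2 * secA m x.
Proof. by apply/funext => x /=; case: (sectoral m x). Qed.

Lemma smooth_sectoral m : smooth (secA m) /\ smooth (secB m).
Proof.
elim: m => [|m [sA sB]]; first by split; exact: smooth_cst.
have := @smooth_x1 R; have := @smooth_x2 R => s2 s1.
split; first by rewrite sectoralSA; apply: smoothB; apply: smoothM.
by rewrite sectoralSB; apply: smoothD; apply: smoothM.
Qed.

Lemma X3_sectoral m x : X3 (secA m) x = - m%:R * secB m x /\ X3 (secB m) x = m%:R * secA m x.
Proof.
elim: m => [|m [EA EB]]; first by rewrite !X3_cst /= mul0r mulr0.
have [sA sB] := smooth_sectoral m.
have := @smooth_x1 R; have := @smooth_x2 R => s2 s1.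
have s12 u v : smooth u -> smooth v -> smooth (fun x => u x * v x) by exact: smoothM.
split.
  rewrite sectoralSA (_ : X3 _ = X3 (fun x => x.1.1 * secA m x + (-1 * x.1.2) * secB m x)).
    have s2' : smooth (fun x : space3 R => -1 * x.1.2) by exact: smoothZ.
    rewrite (X3D _ (s12 _ _ s1 sA) (s12 _ _ s2' sB)) (X3M _ s1 sA) (X3M _ s2' sB).
    rewrite (X3M _ (smooth_cst _) s2) X3_cst X3_coord1 X3_coord2 EA EB (congr1 (@^~ x) (sectoralSB m)) -natr1.
    move: (x.1.1) (x.1.2) (sectoral m x).1 (sectoral m x).2 (m%:R) => *; ring.
  by congr X3; apply/funext => y; rewrite mulN1r mulNr.
rewrite sectoralSB (X3D _ (s12 _ _ s1 sB) (s12 _ _ s2 sA)) (X3M _ s1 sB) (X3M _ s2 sA).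
rewrite X3_coord1 X3_coord2 EA EB (congr1 (@^~ x) (sectoralSA m)) -natr1.
move: (x.1.1) (x.1.2) (sectoral m x).1 (sectoral m x).2 (m%:R) => *; ring.
Qed.

(** Orthogonality to the real and imaginary parts of all (x_1 + i x_2)^m p(x_3),
which are the Fourier modes of the rotations about the x_3-axis. *)
Definition no_modes f := forall m p,
  dot mu (fun x => secA m x * p.[x.2]) f = 0 /\ dot mu (fun x => secB m x * p.[x.2]) f = 0.

Lemma smooth_mode u p : smooth u -> smooth (fun x => u x * p.[x.2]).
Proof. by move=> su; apply: smoothM => //; exact: smooth_horner3. Qed.

Lemma L2_smooth u : smooth u -> L2r u.
Proof. by move=> su; apply: continuous_L2; exact: smooth_continuous. Qed.

(** The area is carried by the unit sphere. *)
Lemma dot_sphere f u v : measurable_fun setT f -> continuous u -> continuous v ->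
  (forall x, sphere2 x -> u x = v x) -> dot mu u f = dot mu v f.
Proof.
move=> mf cu cv uv; rewrite /dot !Rintegral_area; first last.
- by apply: measurable_funM => //; exact: continuous_measurable3.
- by apply: measurable_funM => //; exact: continuous_measurable3.
apply: eq_Rintegral => p _; rewrite uv// /sphere2 /= !exprMn -mulrDr cos2Dsin2.
by rewrite mulr1 addrC cos2Dsin2.
Qed.

Lemma L2_continuous_mul u f : continuous u -> L2r f -> L2r (fun x => u x * f x).
Proof.
move=> cu fL; have [C CP] := continuous_bounded_sphere cu.
exact: (L2_bounded_mul (continuous_measurable3 cu) CP fL).
Qed.

Lemma no_modes_x3 f : no_modes f -> no_modes (fun x => x.2 * f x).
Proof.
move=> nf m p; have [h1 h2] := nf m (p * 'X); split.
  by rewrite -[RHS]h1; apply: eq_Rintegral => x _; rewrite hornerM hornerX /=; ring.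
by rewrite -[RHS]h2; apply: eq_Rintegral => x _; rewrite hornerM hornerX /=; ring.
Qed.

(** Multiplying a mode of order m+1 by x_1 or x_2 gives half the sum or the
difference of the modes of orders m+2 and m, the latter with the factor
x_1^2 + x_2^2 = 1 - x_3^2. *)
Let average f u u0 u2 w c p : L2r f -> smooth u0 -> smooth u2 -> smooth u -> smooth w ->
  (forall x, sphere2 x -> w x * u x = 2^-1 * u2 x + c * ((1 - x.2 ^+ 2) * u0 x)) ->
  dot mu (fun x => u2 x * p.[x.2]) f = 0 ->
  dot mu (fun x => u0 x * (p * (1 - 'X ^+ 2)).[x.2]) f = 0 ->
  dot mu (fun x => u x * p.[x.2]) (fun x => w x * f x) = 0.
Proof.
move=> fL s0 s2 s sw E h2 h0.
transitivity (dot mu (fun x => w x * u x * p.[x.2]) f).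
  by apply: eq_Rintegral => x _; ring.
pose g x := 2^-1 * (u2 x * p.[x.2]) + c * (u0 x * (p * (1 - 'X ^+ 2)).[x.2]).
have sg1 := smooth_mode p s2; have sg0 := smooth_mode (p * (1 - 'X ^+ 2)) s0.
rewrite (@dot_sphere f _ g).
- rewrite dot_lin//; last 2 first.
  + exact: L2_smooth.
  + by apply: L2_smooth; exact: smoothZ.
  by rewrite dotZl ?h0 ?h2 ?mulr0 ?addr0//; exact: L2_smooth.
- exact: L2_measurable fL.
- by apply: smooth_continuous; apply: smooth_mode; exact: smoothM.
- by apply: smooth_continuous; apply: smoothD; exact: smoothZ.
- move=> x Sx; have hX : ('X ^+ 2 : {poly R}).[x.2] = x.2 ^+ 2 by exact: hornerXn.
  by rewrite E// /g hornerM hornerD hornerN hornerC hX; ring.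
Qed.

Lemma no_modes_x1 f : L2r f -> no_modes f -> no_modes (fun x => x.1.1 * f x).
Proof.
move=> fL nf; have s1 := @smooth_x1 R.
case=> [|m] p.
  have [h1 h2] := nf 1%N p; split.
    by rewrite -[RHS]h1; apply: eq_Rintegral => x _ /=; ring.
  by rewrite -[RHS](dot0l mu f); apply: eq_Rintegral => x _ /=; ring.
have [a2 b2] := nf m.+2 p; have [a0 b0] := nf m (p * (1 - 'X ^+ 2)).
have [sA0 sB0] := smooth_sectoral m; have [sA1 sB1] := smooth_sectoral m.+1.
have [sA2 sB2] := smooth_sectoral m.+2.
split; [apply: (average (c := 2^-1) fL sA0 sA2 sA1 s1 _ a2 a0)|
        apply: (average (c := 2^-1) fL sB0 sB2 sB1 s1 _ b2 b0)] => x Sx /=;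
  have -> : 1 - x.2 ^+ 2 = x.1.1 ^+ 2 + x.1.2 ^+ 2 by rewrite -Sx addrK.
  by case: (sectoral m x) => a b /=; field.
by case: (sectoral m x) => a b /=; field.
Qed.

Lemma no_modes_x2 f : L2r f -> no_modes f -> no_modes (fun x => x.1.2 * f x).
Proof.
move=> fL nf; have s1 := @smooth_x2 R.
case=> [|m] p.
  have [h1 h2] := nf 1%N p; split.
    by rewrite -[RHS]h2; apply: eq_Rintegral => x _ /=; ring.
  by rewrite -[RHS](dot0l mu f); apply: eq_Rintegral => x _ /=; ring.
have [a2 b2] := nf m.+2 p; have [a0 b0] := nf m (p * (1 - 'X ^+ 2)).
have [sA0 sB0] := smooth_sectoral m; have [sA1 sB1] := smooth_sectoral m.+1.
have [sA2 sB2] := smooth_sectoral m.+2.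
split; [apply: (average (c := - 2^-1) fL sB0 sB2 sA1 s1 _ b2 b0)|
        apply: (average (c := 2^-1) fL sA0 (smoothN sA2) sB1 s1 _ _ a0)].
- move=> x Sx; have -> : 1 - x.2 ^+ 2 = x.1.1 ^+ 2 + x.1.2 ^+ 2 by rewrite -Sx addrK.
  by move=> /=; case: (sectoral m x) => a b /=; field.
- move=> x Sx; have -> : 1 - x.2 ^+ 2 = x.1.1 ^+ 2 + x.1.2 ^+ 2 by rewrite -Sx addrK.
  by move=> /=; case: (sectoral m x) => a b /=; field.
rewrite -[RHS](mulr0 (-1)) -a2 -dotZl//; last by apply: L2_smooth; exact: smooth_mode.
by apply: eq_Rintegral => x _; ring.
Qed.

Let no_modes_pow (w : space3 R -> R) k f : continuous w ->
  (forall g, L2r g -> no_modes g -> no_modes (fun x => w x * g x)) -> L2r f -> no_modes f ->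
  L2r (fun x => w x ^+ k * f x) /\ no_modes (fun x => w x ^+ k * f x).
Proof.
move=> cw wN fL nf; elim: k => [|k [IH1 IH2]].
  by rewrite (_ : (fun x => _) = f)//; apply/funext => x; rewrite mul1r.
rewrite (_ : (fun x => _) = (fun x => w x * (w x ^+ k * f x))); last first.
  by apply/funext => x; rewrite exprS mulrA.
by split; [exact: L2_continuous_mul|exact: wN].
Qed.

(** Since the condition is stable under multiplication by the coordinates, all the
polynomial moments of f vanish. *)
Lemma no_modes_ae0 f : L2r f -> no_modes f -> {ae mu, forall x, f x = 0}.
Proof.
move=> fL nf; apply: monomial_moments_ae0 => // i j k.
have [L3 n3] := no_modes_pow k (@continuous_x3 R) (fun g _ => @no_modes_x3 g) fL nf.
have [L2 n2] := no_modes_pow j (@continuous_x2 R) no_modes_x2 L3 n3.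
have [_ n1] := no_modes_pow i (@continuous_x1 R) no_modes_x1 L2 n2.
rewrite -[RHS](n1 0%N 1).1; apply: eq_Rintegral => x _.
by rewrite /mono /prod3 /= !hornerXn hornerC; ring.
Qed.

Let sqr_neq1 (m : nat) : m <> 1%N -> (m ^ 2 <> 1)%N. Proof. nia. Qed.
Let dbl0 (a : R) : a + a = 0 -> a = 0. Proof. lra. Qed.
Let mode0 (m a b : R) : m * a = b -> - m * b = - a -> (1 - m ^+ 2) * a = 0.
Proof. by move=> <- h; have : m * (m * a) = a; lra. Qed.

(** Write f = f1 + i f2. Testing X_3 f = i f against the modes of order m, which
X_3 exchanges up to the factors m and - m, shows that 1 - m^2 times each moment
is 0. The modes of order one remain; they are combinations of the functions
(x_1 + i x_2) q_n(x_3). *)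
Lemma rotation_total f1 f2 : L2r f1 -> L2r f2 ->
  (forall Phi, smooth Phi -> dot mu (X3 Phi) f1 = dot mu Phi f2) ->
  (forall Phi, smooth Phi -> dot mu (X3 Phi) f2 = - dot mu Phi f1) ->
  (forall n, dot mu (zonal1 (legendre_poly R n)) f1 + dot mu (zonal2 (legendre_poly R n)) f2 = 0) ->
  (forall n, dot mu (zonal1 (legendre_poly R n)) f2 - dot mu (zonal2 (legendre_poly R n)) f1 = 0) ->
  {ae mu, forall x, f1 x = 0} /\ {ae mu, forall x, f2 x = 0}.
Proof.
move=> f1L f2L w1 w2 o1 o2.
pose dA m p f := dot mu (fun x => secA m x * p.[x.2]) f.
pose dB m p f := dot mu (fun x => secB m x * p.[x.2]) f.
have sp p : smooth (fun x : space3 R => p.[x.2]) by exact: smooth_horner3.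
have XA m p : X3 (fun x => secA m x * p.[x.2]) = fun x => - m%:R * (secB m x * p.[x.2]).
  have [sA sB] := smooth_sectoral m; apply/funext => x.
  by rewrite (X3M _ sA (sp p)) X3_zonal (X3_sectoral m x).1 mulr0 add0r mulrC mulrA.
have XB m p : X3 (fun x => secB m x * p.[x.2]) = fun x => m%:R * (secA m x * p.[x.2]).
  have [sA sB] := smooth_sectoral m; apply/funext => x.
  by rewrite (X3M _ sB (sp p)) X3_zonal (X3_sectoral m x).2 mulr0 add0r mulrC mulrA.
have rel m p : [/\ - m%:R * dB m p f1 = dA m p f2, - m%:R * dB m p f2 = - dA m p f1,
    m%:R * dA m p f1 = dB m p f2 & m%:R * dA m p f2 = - dB m p f1].
  have [sA sB] := smooth_sectoral m.
  have sAp := smooth_mode p sA; have sBp := smooth_mode p sB.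
  have := w1 _ sAp; have := w2 _ sAp; have := w1 _ sBp; have := w2 _ sBp.
  rewrite XA XB !dotZl//; by [|exact: L2_smooth].
have EA p f : dA 1%N p f = dot mu (zonal1 p) f.
  by apply: eq_Rintegral => x _; rewrite /zonal1 /=; ring.
have EB p f : dB 1%N p f = dot mu (zonal2 p) f.
  by apply: eq_Rintegral => x _; rewrite /zonal2 /=; ring.
have dl f (u : {poly R} -> space3 R -> R) : L2r f -> (forall p, smooth (u p)) ->
    (forall a p q x, u (a *: p + q) x = a * u p x + u q x) ->
    forall a p q, dot mu (u (a *: p + q)) f = a * dot mu (u p) f + dot mu (u q) f.
  move=> fL su ul a p q; rewrite -dot_lin//; [|exact: L2_smooth|exact: L2_smooth].
  by congr dot; apply/funext => x; exact: ul.
have z1l (a : R) p q x : zonal1 (a *: p + q) x = a * zonal1 p x + zonal1 q x.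
  by rewrite /zonal1 hornerD hornerZ; ring.
have z2l (a : R) p q x : zonal2 (a *: p + q) x = a * zonal2 p x + zonal2 q x.
  by rewrite /zonal2 hornerD hornerZ; ring.
have r1 p : dot mu (zonal2 p) f1 = - dot mu (zonal1 p) f2 /\
    dot mu (zonal2 p) f2 = dot mu (zonal1 p) f1.
  have [h1 h2 h3 h4] := rel 1%N p.
  by move: h3 h4; rewrite !EA !EB => h3 h4; split; lra.
have z11 p : dot mu (zonal1 p) f1 = 0.
  move: p; apply: legendre_poly_span; first exact: dl (@smooth_zonal1 R) z1l.
  by move=> n; have := o1 n; have [_ ->] := r1 (legendre_poly R n); exact: dbl0.
have z12 p : dot mu (zonal1 p) f2 = 0.
  move: p; apply: legendre_poly_span; first exact: dl (@smooth_zonal1 R) z1l.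
  by move=> n; have := o2 n; have [-> _] := r1 (legendre_poly R n); rewrite opprK; exact: dbl0.
have main m p : [/\ dA m p f1 = 0, dB m p f1 = 0, dA m p f2 = 0 & dB m p f2 = 0].
  have [->|m1] := eqVneq m 1%N.
    by rewrite !EA !EB; have [-> ->] := r1 p; rewrite !z11 !z12 oppr0.
  have [h1 h2 h3 h4] := rel m p.
  have n0 : (1 - m%:R ^+ 2 : R) != 0.
    rewrite subr_eq0 -natrX eq_sym pnatr_eq1; apply/eqP; move/eqP: m1; move: {h1 h2 h3 h4} m; exact: sqr_neq1.
  have a1 : dA m p f1 = 0.
    by apply: (mulfI n0); rewrite mulr0; exact: mode0 h3 h2.
  have a2 : dA m p f2 = 0.
    by apply: (mulfI n0); rewrite mulr0; apply: mode0 h4 _; rewrite mulrN h1.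
  split=> //; first by move: h4; rewrite a2 mulr0 => /esym/eqP; rewrite oppr_eq0 => /eqP.
  by rewrite -h3 a1 mulr0.
by split; apply: no_modes_ae0 => // m p; have [] := main m p.
Qed.

End RotationModes.

(** * The space X_3 f = i f *)

(** Conditions in the sense of distributions are orthogonality relations, and
these cut out closed subspaces that are unions of classes. *)
Section Annihilator.
Variables (R : realType) (E : lmodType R) (W : set E) (ip : E -> E -> R).
Hypotheses (WS : submodule W) (si : semi_inner W ip).
Variable T : set E.
Hypothesis TW : T `<=` W.

Definition annihilator : set E := [set f | W f /\ forall t, T t -> ip f t = 0].

Lemma annihilator_submodule : submodule annihilator.
Proof.
split=> [|a f g [Wf Tf] [Wg Tg]].
  by split=> [|t Tt]; [exact: WS.(subsp0)|rewrite (ip0l WS si)//; exact: TW].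
split=> [|t Tt]; first exact: WS.(subspS).
by rewrite si.(si_lin)//; [rewrite Tf// Tg// mulr0 addr0|exact: TW].
Qed.

Lemma annihilator_eqv f g : annihilator f -> W g -> ip (g - f) (g - f) = 0 -> annihilator g.
Proof.
move=> [Wf Tf] Wg gf; split=> // t Tt.
have Wgf : W (g - f) by exact: (subspB WS).
by rewrite -[g](subrK f) (ipDl si Wgf Wf (TW Tt)) (null_ip WS si Wgf (TW Tt) gf) add0r Tf.
Qed.

Lemma annihilator_closed u f : (forall n, annihilator (u n)) -> W f ->
  (fun n => ip (u n - f) (u n - f)) @ \oo --> (0 : R) -> annihilator f.
Proof.
move=> au Wf uf; split=> // t Tt; have Wt := TW Tt.
apply/eqP; rewrite -sqrf_eq0; apply/eqP/le_anti; rewrite sqr_ge0 andbT.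
have cv : (fun n => ip (u n - f) (u n - f) * ip t t) @ \oo --> (0 * ip t t : R).
  by apply: cvgM => //; exact: cvg_cst.
rewrite mul0r in cv; apply: (ler_cvg_to (cvg_cst _) cv).
apply: nearW => n; have [Wu Tu] := au n.
have -> : ip f t ^+ 2 = ip (u n - f) t ^+ 2.
  by rewrite (ipBl WS si)// Tu// sub0r sqrrN.
by apply: (cauchy_schwarz WS si) => //; exact: (subspB WS).
Qed.

End Annihilator.

Section Pairs.
Variable R : realType.
Notation mu := (@area R).
Notation L2r f := (f \in Lfun (@area R) 2%:E).
Implicit Types Phi : space3 R -> R.

(** Complex-valued functions as pairs of real and imaginary parts, a real vector
space on which multiplication by i is the map rot90. *)
Definition cfun : lmodType R := ((space3 R -> R^o) * (space3 R -> R^o))%type.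
Implicit Types f g h : cfun.

Definition L2c : set cfun := [set f | L2r f.1 /\ L2r f.2].
Definition cdot f g : R := dot mu f.1 g.1 + dot mu f.2 g.2.
Definition rot90 f : cfun := (- f.2, f.1).
Definition mulx3 f : cfun := (fun x => x.2 * f.1 x, fun x => x.2 * f.2 x).

Lemma L2c_submodule : submodule L2c.
Proof.
split; first by split; exact: L2_0.
by move=> a f g [f1 f2] [g1 g2]; split; exact: L2_lin.
Qed.

Lemma cdot_semi_inner : semi_inner L2c cdot.
Proof.
split=> [a f g h [f1 f2] [g1 g2] [h1 h2]|f g _ _|f _].
- by rewrite /cdot (dot_lin a f1 g1 h1) (dot_lin a f2 g2 h2) /=; ring.
- by rewrite /cdot dotC [X in _ + X]dotC.
- by apply: addr_ge0; exact: dot_ge0.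
Qed.

Lemma cdot_complete : complete_for L2c cdot.
Proof.
move=> u uL uC.
have [f1 f1L c1] : exists2 f1, L2r f1 &
    (fun n => dot mu (fun x => (u n).1 x - f1 x) (fun x => (u n).1 x - f1 x)) @ \oo --> (0 : R).
  apply: L2_complete => [n|e e0]; first by have [] := uL n.
  have [N NP] := uC e e0; exists N => m n Nm Nn.
  by apply: le_lt_trans (NP m n Nm Nn); rewrite /cdot lerDl; exact: dot_ge0.
have [f2 f2L c2] : exists2 f2, L2r f2 &
    (fun n => dot mu (fun x => (u n).2 x - f2 x) (fun x => (u n).2 x - f2 x)) @ \oo --> (0 : R).
  apply: L2_complete => [n|e e0]; first by have [] := uL n.
  have [N NP] := uC e e0; exists N => m n Nm Nn.
  by apply: le_lt_trans (NP m n Nm Nn); rewrite /cdot lerDr; exact: dot_ge0.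
exists (f1, f2) => //; rewrite -[0 in X in _ --> X](addr0 (0 : R)).
exact: cvgD c1 c2.
Qed.

Lemma dotNl (f g : space3 R -> R) : L2r f -> L2r g -> dot mu (fun x => - f x) g = - dot mu f g.
Proof.
move=> fL gL; rewrite -[RHS]mulN1r -(dotZl _ fL gL).
by congr dot; apply/funext => x; rewrite mulN1r.
Qed.

Lemma L2N (f : space3 R -> R) : L2r f -> L2r (fun x => - f x).
Proof.
move=> fL; have := L2Z (-1) fL; rewrite (_ : (fun x => _) = (fun x => - f x))//.
by apply/funext => x; rewrite mulN1r.
Qed.

Lemma L2c_rot90 f : L2c f -> L2c (rot90 f).
Proof. by case=> f1 f2; split => //; exact: L2N. Qed.

Lemma L2c_mulx3 f : L2c f -> L2c (mulx3 f).
Proof. by case=> f1 f2; split; apply: L2_continuous_mul => //; exact: continuous_x3. Qed.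

Lemma cdot_rot90 f g : L2c f -> L2c g -> cdot (rot90 f) g = - cdot f (rot90 g).
Proof.
move=> [f1 f2] [g1 g2]; rewrite /cdot /= (dotNl f2 g1) [dot mu f.1 (- g.2)]dotC.
by rewrite (dotNl g2 f1) [dot mu g.2 _]dotC opprD opprK addrC.
Qed.

Lemma rot90K f : rot90 (rot90 f) = - f.
Proof. by []. Qed.

Lemma cdot_mulx3 f g : cdot (mulx3 f) g = cdot f (mulx3 g).
Proof. by congr (_ + _); apply: eq_Rintegral => x _ /=; ring. Qed.

Lemma mulx3_rot90 f : mulx3 (rot90 f) = rot90 (mulx3 f).
Proof. by congr (_, _); apply/funext => x /=; rewrite mulrN. Qed.

Lemma rot90_linear : linear rot90.
Proof.
move=> a f g; congr (_, _); apply/funext => x.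
change (- (a * f.2 x + g.2 x) = a * - f.2 x - g.2 x); ring.
Qed.

Lemma mulx3_linear : linear mulx3.
Proof.
move=> a f g; congr (_, _); apply/funext => x.
  change (x.2 * (a * f.1 x + g.1 x) = a * (x.2 * f.1 x) + x.2 * g.1 x); ring.
change (x.2 * (a * f.2 x + g.2 x) = a * (x.2 * f.2 x) + x.2 * g.2 x); ring.
Qed.

Lemma dot_mulx3_le (f : space3 R -> R) : L2r f ->
  dot mu (fun x => x.2 * f x) (fun x => x.2 * f x) <= dot mu f f.
Proof.
move=> fL; have gL : L2r (fun x => x.2 * f x) by apply: L2_continuous_mul; first exact: continuous_x3.
rewrite -lee_fin !dotE//; apply: ae_ge0_le_integral => //.
- by move=> x _; rewrite lee_fin sqr_ge0.
- by apply/measurable_EFinP; apply: measurable_funX; exact: L2_measurable gL.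
- by move=> x _; rewrite lee_fin sqr_ge0.
- by apply/measurable_EFinP; apply: measurable_funX; exact: L2_measurable fL.
- apply: filterS (@ae_x3_le1 R) => x x1 _; rewrite lee_fin exprMn ler_piMl ?sqr_ge0//.
  by rewrite -real_normK ?num_real// exprn_ile1.
Qed.

Lemma mulx3_le f : L2c f -> cdot (mulx3 f) (mulx3 f) <= cdot f f.
Proof. by case=> f1 f2; apply: lerD; exact: dot_mulx3_le. Qed.

(** The real and imaginary parts of X_3 f = i f, tested against Phi. *)
Definition mode1_tests : set cfun :=
  [set t | exists2 Phi, smooth Phi & t = (X3 Phi, - (Phi : _ -> R^o)) \/ t = (Phi, X3 Phi)].
Definition mode1 : set cfun := annihilator L2c cdot mode1_tests.

Lemma mode1_tests_L2c : mode1_tests `<=` L2c.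
Proof.
move=> _ [Phi sPhi [->|->]]; split => /=.
- by apply: continuous_L2; exact: continuous_X3.
- by apply: L2N; exact: L2_smooth.
- exact: L2_smooth.
- by apply: continuous_L2; exact: continuous_X3.
Qed.

Lemma mode1P f : mode1 f <-> L2c f /\ forall Phi, smooth Phi ->
  dot mu (X3 Phi) f.1 = dot mu Phi f.2 /\ dot mu (X3 Phi) f.2 = - dot mu Phi f.1.
Proof.
have E Phi : smooth Phi -> L2c f ->
    cdot f (X3 Phi, - (Phi : _ -> R^o)) = dot mu (X3 Phi) f.1 - dot mu Phi f.2 /\
    cdot f (Phi, X3 Phi) = dot mu (X3 Phi) f.2 + dot mu Phi f.1.
  move=> sPhi [f1 f2]; rewrite /cdot /= ![dot mu f.1 _]dotC ![dot mu f.2 _]dotC.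
  by rewrite (dotNl (L2_smooth sPhi) f2); split=> //; rewrite addrC.
split=> [[Wf Tf]|[Wf Tf]]; split=> //.
  move=> Phi sPhi; have [E1 E2] := E _ sPhi Wf; split.
    by apply/eqP; rewrite -subr_eq0 -E1 Tf//; exists Phi => //; left.
  by apply/eqP; rewrite -addr_eq0 -E2 Tf//; exists Phi => //; right.
move=> _ [Phi sPhi [->|->]].
- by rewrite (E _ sPhi Wf).1 (Tf _ sPhi).1 subrr.
- by rewrite (E _ sPhi Wf).2 (Tf _ sPhi).2 addNr.
Qed.

Lemma mode1_submodule : submodule mode1.
Proof.
by apply: annihilator_submodule; [exact: L2c_submodule|exact: cdot_semi_inner|exact: mode1_tests_L2c].
Qed.

Lemma mode1_L2c : mode1 `<=` L2c. Proof. by move=> f []. Qed.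

Lemma mode1_closed u f : (forall n, mode1 (u n)) -> L2c f ->
  (fun n => cdot (u n - f) (u n - f)) @ \oo --> (0 : R) -> mode1 f.
Proof.
apply: annihilator_closed; [exact: L2c_submodule|exact: cdot_semi_inner|exact: mode1_tests_L2c].
Qed.

(** X_3 annihilates x_3, so that x_3 Phi can be taken as a test function. *)
Lemma mode1_mulx3 f : mode1 f -> mode1 (mulx3 f).
Proof.
move=> /mode1P [Wf Tf]; apply/mode1P; split; first exact: L2c_mulx3.
move=> Phi sPhi; have s3 := @smooth_x3 R; have s3P := smoothM s3 sPhi.
have E : X3 (fun x => x.2 * Phi x) = fun x => x.2 * X3 Phi x.
  apply/funext => x; rewrite (X3M _ s3 sPhi).
  have := X3_zonal 'X x; under [X in X3 X]eq_fun do rewrite hornerX.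
  by move=> ->; rewrite mulr0 addr0.
have A (u v : space3 R -> R) : dot mu u (fun x => x.2 * v x) = dot mu (fun x => x.2 * u x) v.
  by apply: eq_Rintegral => x _; ring.
by rewrite /mulx3 /= !A -E; exact: Tf.
Qed.

Lemma mode1_rot90 f : mode1 f -> mode1 (rot90 f).
Proof.
move=> /mode1P [Wf Tf]; apply/mode1P; split; first exact: L2c_rot90.
move=> Phi sPhi; have [f1 f2] := Wf; have [h1 h2] := Tf _ sPhi.
have N (u v : space3 R -> R) : L2r u -> L2r v -> dot mu u (- (v : _ -> R^o)) = - dot mu u v.
  by move=> uL vL; rewrite dotC (dotNl vL uL) dotC.
have P2 := L2_smooth sPhi.
have X2 : L2r (X3 Phi) by apply: continuous_L2; exact: continuous_X3.
by rewrite /rot90 /= !N// h1 h2 !opprK.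
Qed.

End Pairs.

(** * An orthogonal basis and the inverse Laplacian *)

Local Open Scope complex_scope.

Section OrderOneHarmonics.
Variable R : realType.
Notation mu := (@area R).
Notation L2r f := (f \in Lfun (@area R) 2%:E).
Implicit Types (Phi Psi : space3 R -> R) (f g h : cfun R).
Notation leg n := (legendre_poly R n).

(** (x_1 + i x_2) q_n(x_3), a multiple of zeta_{n+1}. *)
Definition harmonic1 n : cfun R := (zonal1 (leg n), zonal2 (leg n)).
Notation e := (zJ harmonic1 (@rot90 R)).

Lemma L2_zonal1 q : L2r (zonal1 q). Proof. by apply: L2_smooth; exact: smooth_zonal1. Qed.
Lemma L2_zonal2 q : L2r (zonal2 q). Proof. by apply: L2_smooth; exact: smooth_zonal2. Qed.

Lemma harmonic1_mode1 n : mode1 (harmonic1 n).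
Proof.
apply/mode1P; split; first by split; [exact: L2_zonal1|exact: L2_zonal2].
move=> Phi sPhi; split.
  rewrite dotC [LHS](X3_x1 (leg n) sPhi) [RHS]dotC -[RHS]opprK.
  rewrite -(dotNl (L2_zonal2 (leg n)) (L2_smooth sPhi)); congr (- _).
  by apply: eq_Rintegral => x _; rewrite /zonal2 mulNr.
by rewrite dotC [dot mu Phi _]dotC; exact: (X3_x2 (leg n) sPhi).
Qed.

Lemma basis_mode1 n : mode1 (e n).
Proof. by rewrite /zJ; case: ifP => _; [apply: mode1_rot90|]; exact: harmonic1_mode1. Qed.

Lemma green_zonal1 n Phi Psi : smooth Phi -> smooth Psi -> laplace_beltrami Phi Psi ->
  dot mu Psi (zonal1 (leg n)) = legendre_eig R n * dot mu Phi (zonal1 (leg n)).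
Proof.
move=> sPhi sPsi lb; rewrite -dotZl; [|exact: L2_smooth|exact: L2_zonal1].
rewrite dotC [LHS](green_x1 (leg n) sPhi (smooth_continuous sPsi) lb).
by apply: eq_Rintegral => x _; rewrite legendre1_legendre_poly hornerZ /zonal1; ring.
Qed.

Lemma green_zonal2 n Phi Psi : smooth Phi -> smooth Psi -> laplace_beltrami Phi Psi ->
  dot mu Psi (zonal2 (leg n)) = legendre_eig R n * dot mu Phi (zonal2 (leg n)).
Proof.
move=> sPhi sPsi lb; rewrite -dotZl; [|exact: L2_smooth|exact: L2_zonal2].
rewrite dotC [LHS](green_x2 (leg n) sPhi (smooth_continuous sPsi) lb).
by apply: eq_Rintegral => x _; rewrite legendre1_legendre_poly hornerZ /zonal2; ring.
Qed.

Lemma eigen_orth (a b c : R) : a * c = b * c -> a != b -> c = 0.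
Proof.
move=> /eqP; rewrite -subr_eq0 -mulrBl mulf_eq0 subr_eq0 => /orP[/eqP ->|/eqP //].
by rewrite eqxx.
Qed.

(** Green's formula applied to two eigenfunctions. *)
Lemma zonal1_orth m n : m != n -> dot mu (zonal1 (leg m)) (zonal1 (leg n)) = 0.
Proof.
move=> mn; apply: (@eigen_orth (legendre_eig R m) (legendre_eig R n)); last first.
  by apply: contra mn => /eqP/legendre_eig_inj ->.
have lb := laplacian_zonal1 (leg m).
rewrite -(green_zonal1 n (smooth_zonal1 _) (smooth_zonal1 _) lb).
rewrite -dotZl; [|exact: L2_zonal1|exact: L2_zonal1].
by apply: eq_Rintegral => x _; rewrite legendre1_legendre_poly /zonal1 hornerZ; ring.
Qed.

Lemma zonal2_orth m n : m != n -> dot mu (zonal2 (leg m)) (zonal2 (leg n)) = 0.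
Proof.
move=> mn; apply: (@eigen_orth (legendre_eig R m) (legendre_eig R n)); last first.
  by apply: contra mn => /eqP/legendre_eig_inj ->.
have lb := laplacian_zonal2 (leg m).
rewrite -(green_zonal2 n (smooth_zonal2 _) (smooth_zonal2 _) lb).
rewrite -dotZl; [|exact: L2_zonal2|exact: L2_zonal2].
by apply: eq_Rintegral => x _; rewrite legendre1_legendre_poly /zonal2 hornerZ; ring.
Qed.

Lemma harmonic1_orth m n : m != n -> cdot (harmonic1 m) (harmonic1 n) = 0.
Proof. by move=> mn; rewrite /cdot /= zonal1_orth// zonal2_orth// addr0. Qed.

(** Both products are the integral of x_1 x_2 q_m(x_3) q_n(x_3). *)
Lemma harmonic1_rot90_orth m n : cdot (harmonic1 m) (rot90 (harmonic1 n)) = 0.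
Proof.
have L1 := L2_zonal1; have L2 := L2_zonal2.
rewrite /cdot /= dotC (dotNl (L2 _) (L1 _)) dotC; apply/eqP; rewrite addrC subr_eq0; apply/eqP.
by apply: eq_Rintegral => x _; rewrite /zonal1 /zonal2; ring.
Qed.

Lemma basis_orth m n : m != n -> cdot (e m) (e n) = 0.
Proof.
have HL k : L2c (harmonic1 k) by exact: mode1_L2c (harmonic1_mode1 k).
have JL k : L2c (rot90 (harmonic1 k)) by exact: L2c_rot90.
have si := cdot_semi_inner R.
move=> mn; rewrite /zJ; have [om|om] := boolP (odd m); have [on|on] := boolP (odd n).
- rewrite (cdot_rot90 (HL _) (JL _)) rot90K (ipNr (L2c_submodule R) si (HL _) (HL _)) opprK harmonic1_orth//.
  by apply: contra mn => /eqP h; rewrite -(odd_double_half m) -(odd_double_half n) om on h.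
- by rewrite si.(si_sym)//; exact: harmonic1_rot90_orth.
- exact: harmonic1_rot90_orth.
- rewrite harmonic1_orth//.
  by apply: contra mn => /eqP h; rewrite -(odd_double_half m) -(odd_double_half n) (negPf om) (negPf on) h.
Qed.

Lemma L2_ae0_dot (f : space3 R -> R) : L2r f -> {ae mu, forall x, f x = 0} -> dot mu f f = 0.
Proof. by move=> fL /(dot_eq0 fL). Qed.

Lemma basis_total f : mode1 f -> (forall n, cdot f (e n) = 0) -> cdot f f = 0.
Proof.
move=> /mode1P [[f1 f2] Tf] f0.
have o1 n := f0 n.*2; have o2 n := f0 n.*2.+1.
have L1 := L2_zonal1; have L2 := L2_zonal2.
have [||n|n|z1 z2] := rotation_total f1 f2.
- by move=> Phi sPhi; have [] := Tf _ sPhi.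
- by move=> Phi sPhi; have [] := Tf _ sPhi.
- have := o1 n; rewrite /zJ odd_double doubleK /cdot /= => <-.
  by rewrite dotC [dot mu (zonal2 _) _]dotC.
- have := o2 n; rewrite /zJ /= odd_double /= uphalf_double /cdot /= => <-.
  by rewrite [dot mu f.1 _]dotC (dotNl (L2 _) f1) [RHS]addrC dotC.
by rewrite /cdot !L2_ae0_dot// addr0.
Qed.

(** x_3 zeta_1 is a multiple of zeta_2, since q_0 = 1 and q_1 = - 4 X. *)
Lemma mulx3_harmonic1_0 : mulx3 (harmonic1 0) = - (4^-1) *: harmonic1 1.
Proof.
rewrite /harmonic1 legendre_poly0 legendre_poly1; congr (_, _); apply/funext => x.
  change (x.2 * (x.1.1 * (1 : {poly R}).[x.2]) =
    - 4^-1 * (x.1.1 * (- 4 *: 'X : {poly R}).[x.2])).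
  by rewrite hornerZ hornerX hornerC; field.
change (x.2 * (x.1.2 * (1 : {poly R}).[x.2]) =
  - 4^-1 * (x.1.2 * (- 4 *: 'X : {poly R}).[x.2])).
by rewrite hornerZ hornerX hornerC; field.
Qed.

(** Delta u = f in the sense of distributions, componentwise. *)
Definition poisson (u f : cfun R) := forall Phi Psi, smooth Phi -> smooth Psi ->
  laplace_beltrami Phi Psi ->
  dot mu Psi u.1 = dot mu Phi f.1 /\ dot mu Psi u.2 = dot mu Phi f.2.

Lemma legendre_eigE n : legendre_eig R n = - (n.+1 * n.+2)%:R.
Proof. by []. Qed.

Lemma basis_green n Phi Psi : smooth Phi -> smooth Psi -> laplace_beltrami Phi Psi ->
  dot mu Psi (e n).1 = legendre_eig R n./2 * dot mu Phi (e n).1 /\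
  dot mu Psi (e n).2 = legendre_eig R n./2 * dot mu Phi (e n).2.
Proof.
move=> sPhi sPsi lb; have g1 k := green_zonal1 k sPhi sPsi lb.
have g2 k := green_zonal2 k sPhi sPsi lb.
have P := L2_smooth sPhi; have P' := L2_smooth sPsi.
rewrite /zJ; case: ifP => _ //=; rewrite g1; split=> //.
rewrite ![dot mu _ (- _)]dotC (dotNl (L2_zonal2 _) P') (dotNl (L2_zonal2 _) P).
by rewrite dotC g2 mulrN dotC.
Qed.

(** u is diagonal in the basis. By Parseval's identity, the weak equation tested
against Phi and Psi = Delta Phi reduces to the coefficients of Phi and Psi on the
basis, which Green's formula relates by the same eigenvalues. *)
Lemma poisson_exists f : mode1 f -> exists2 u, mode1 u & poisson u f.
Proof.
move=> Vf; have WS := L2c_submodule R; have si := cdot_semi_inner R.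
have cW := @cdot_complete R; have VS := mode1_submodule R.
have VW := @mode1_L2c R; have Vcl := @mode1_closed R.
have lam0 n : legendre_eig R n != 0 by rewrite oppr_eq0 pnatr_eq0.
have ka n : `|(legendre_eig R n./2)^-1| <= 1.
  rewrite legendre_eigE invrN normrN ger0_norm ?invr_ge0// invf_le1 ?ltr0n//.
  by rewrite ler1n.
have [u Vu uE] := diagonal_exists WS si cW VS VW Vcl basis_mode1 basis_orth ka Vf.
exists u => // Phi Psi sPhi sPsi lb.
have P := L2_smooth sPhi; have P' := L2_smooth sPsi; have Z := L2_0 mu.
have c1 (g : space3 R -> R) h : cdot h (g, fun=> 0) = dot mu g h.1.
  by rewrite /cdot /= [dot mu h.2 _]dotC dot0l addr0 dotC.
have c2 (g : space3 R -> R) h : cdot h (fun=> 0, g) = dot mu g h.2.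
  by rewrite /cdot /= dotC dot0l add0r dotC.
have K (w w' : cfun R) : L2c w -> L2c w' ->
    (forall k, cdot w (e k) = legendre_eig R k./2 * cdot w' (e k)) -> cdot u w = cdot f w'.
  move=> Ww Ww' ww; apply: (parseval_eq WS si cW VS VW Vcl basis_mode1 basis_orth
    basis_total Vu Vf Ww Ww') => k.
  by rewrite uE ww mulrACA mulVf// mul1r.
have eL k : L2c (e k) by exact: VW (basis_mode1 k).
split.
  rewrite -!c1; apply: K => // k; rewrite !(si.(si_sym) (f := (_, _)))// !c1.
  exact: (basis_green k sPhi sPsi lb).1.
rewrite -!c2; apply: K => // k; rewrite !(si.(si_sym) (f := (_, _)))// !c2.
exact: (basis_green k sPhi sPsi lb).2.
Qed.

Lemma poisson_unique u u' f : L2c u -> L2c u' -> poisson u f -> poisson u' f ->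
  \int[mu]_x u.1 x = 0 -> \int[mu]_x u.2 x = 0 ->
  \int[mu]_x u'.1 x = 0 -> \int[mu]_x u'.2 x = 0 ->
  cdot (u - u') (u - u') = 0.
Proof.
move=> [u1 u2] [u'1 u'2] pu pu' i1 i2 i'1 i'2.
have K (v v' : space3 R -> R) : L2r v -> L2r v' -> \int[mu]_x v x = 0 -> \int[mu]_x v' x = 0 ->
    (forall Phi Psi, smooth Phi -> smooth Psi -> laplace_beltrami Phi Psi ->
      dot mu Psi v = dot mu Psi v') ->
    dot mu (fun x => v x - v' x) (fun x => v x - v' x) = 0.
  move=> vL v'L iv iv' vv'.
  have wL : L2r (fun x => v x - v' x).
    have := L2_lin (-1) v'L vL; rewrite (_ : (fun x => _) = (fun x => v x - v' x))//.
    by apply/funext => x; rewrite mulN1r addrC.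
  have D (g : space3 R -> R) : L2r g -> dot mu g (fun x => v x - v' x) = dot mu g v - dot mu g v'.
    move=> gL; rewrite dotC -[RHS]addrC -mulN1r ![dot mu g _]dotC -dot_lin//.
    by congr dot; apply/funext => x; rewrite mulN1r addrC.
  apply/(dot_eq0 wL)/laplacian_injective => // [|Phi Psi sPhi sPsi lb].
    have E (g : space3 R -> R) : \int[mu]_x g x = dot mu (fun=> 1) g.
      by apply: eq_Rintegral => x _; rewrite mul1r.
    by rewrite E D ?Lfun_cst// -!E iv iv' subrr.
  rewrite (_ : \int[mu]_x _ = dot mu Psi (fun x => v x - v' x)); last exact: dotC.
  by rewrite D ?(vv' _ _ sPhi sPsi lb) ?subrr//; exact: L2_smooth.
rewrite /cdot (K _ _ u1 u'1)// ?(K _ _ u2 u'2) ?addr0// => Phi Psi sPhi sPsi lb.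
  by rewrite (pu _ _ sPhi sPsi lb).2 (pu' _ _ sPhi sPsi lb).2.
by rewrite (pu _ _ sPhi sPsi lb).1 (pu' _ _ sPhi sPsi lb).1.
Qed.

End OrderOneHarmonics.

(** * Spectrum of the operator *)

Section Resolvent.
Variable R : realType.
Notation mu := (@area R).
Notation L2r f := (f \in Lfun (@area R) 2%:E).
Implicit Types (Phi Psi : space3 R -> R) (f g h : cfun R) (zeta : space3 R -> R[i]).
Notation e := (@zJ R (cfun R) (@harmonic1 R) (@rot90 R)).

Definition to_cfun zeta : cfun R := (fun x => complex.Re (zeta x), fun x => complex.Im (zeta x)).
Definition of_cfun f : space3 R -> R[i] := fun x => f.1 x +i* f.2 x.

Lemma to_cfunK zeta : of_cfun (to_cfun zeta) = zeta.
Proof. by apply/funext => x; rewrite /of_cfun /=; case: (zeta x). Qed.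
Lemma of_cfunK f : to_cfun (of_cfun f) = f.
Proof. by case: f. Qed.

Lemma integral_sphereM zeta Phi : integral_sphere (fun x => zeta x * (Phi x)%:C) =
  dot mu Phi (to_cfun zeta).1 +i* dot mu Phi (to_cfun zeta).2.
Proof.
congr (_ +i* _); apply: eq_Rintegral => x _ /=; case: (zeta x) => a b /=; ring.
Qed.

Lemma complex_eqP (a b c d : R) : a +i* b = c +i* d <-> a = c /\ b = d.
Proof. by split=> [[]|[-> ->]]. Qed.

Lemma dot1 (f : space3 R -> R) : dot mu (fun=> 1) f = \int[mu]_x f x.
Proof. by apply: eq_Rintegral => x _; rewrite mul1r. Qed.

Lemma mode1_mean0 f : mode1 f -> \int[mu]_x f.1 x = 0 /\ \int[mu]_x f.2 x = 0.
Proof.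
move=> /mode1P [_ Tf]; have [] := Tf _ (smooth_cst 1).
have -> : X3 (fun=> 1 : R) = fun=> 0 by apply/funext => x; exact: X3_cst.
rewrite !dot0l !dot1 => <- /esym/eqP; rewrite oppr_eq0 => /eqP ->.
by [].
Qed.

(** The test function 1 gives the condition of mean zero. *)
Lemma V1P zeta : @V1 R zeta <-> mode1 (to_cfun zeta).
Proof.
have E Phi : L2c (to_cfun zeta) -> smooth Phi ->
    - integral_sphere (fun x => (0 +i* 1) * zeta x * (Phi x)%:C) =
    dot mu Phi (to_cfun zeta).2 +i* (- dot mu Phi (to_cfun zeta).1).
  move=> [f1 f2] /L2_smooth PL; rewrite integral_sphereM.
  have -> : to_cfun (fun x => (0 +i* 1) * zeta x) =
      ((fun x => - (to_cfun zeta).2 x), (to_cfun zeta).1).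
    by congr (_, _); apply/funext => x /=; case: (zeta x) => a b /=; ring.
  rewrite /= dotC (dotNl f2 PL) dotC; apply/complex_eqP.
  by rewrite /= opprK.
split=> [[zL _ zX]|zV].
  apply/mode1P; split=> // Phi sPhi.
  by have := zX Phi sPhi; rewrite E// integral_sphereM => /complex_eqP.
have [i1 i2] := mode1_mean0 zV; have /mode1P[zL Tz] := zV.
split=> // [|Phi sPhi]; first exact/complex_eqP.
by rewrite E// integral_sphereM; apply/complex_eqP; exact: Tz.
Qed.

Lemma weak_laplacianP u zeta : @weak_laplacian R u zeta <-> poisson (to_cfun u) (to_cfun zeta).
Proof.
split=> H Phi Psi sPhi sPsi lb; have := H _ _ sPhi sPsi lb.
  by rewrite !integral_sphereM => /complex_eqP.
by rewrite !integral_sphereM => ?; exact/complex_eqP.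
Qed.

(** The chosen solution of Delta u = f is almost everywhere equal to the one built
from the basis, hence it satisfies X_3 u = i u as well. *)
Lemma inv_laplacianP zeta : V1 zeta ->
  mode1 (to_cfun (inv_laplacian zeta)) /\
  poisson (to_cfun (inv_laplacian zeta)) (to_cfun zeta).
Proof.
move=> zV; have zm : mode1 (to_cfun zeta) by exact/V1P.
have [u um up] := poisson_exists zm; have [u1 u2] := mode1_mean0 um.
have m0 : (fun x => zeta x - mean zeta) = zeta.
  by case: zV => _ z0 _; apply/funext => x; rewrite /mean z0 mul0r subr0.
have [] : [set w | [/\ @L2 R w, integral_sphere w = 0 &
    weak_laplacian w (fun x => zeta x - mean zeta)]] (inv_laplacian zeta).
  apply: xgetPex; exists (of_cfun u); rewrite m0; split.
  - exact: mode1_L2c um.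
  - exact/complex_eqP.
  - by apply/weak_laplacianP; rewrite of_cfunK.
rewrite m0 => wL /complex_eqP[w1 w2] /weak_laplacianP wp; split=> //.
have wL' : L2c (to_cfun (inv_laplacian zeta)) by exact: wL.
apply: (annihilator_eqv (L2c_submodule R) (cdot_semi_inner R) (@mode1_tests_L2c R) um wL').
exact: (poisson_unique wL' (mode1_L2c um) wp up).
Qed.

Definition cinv_laplacian f : cfun R := to_cfun (inv_laplacian (of_cfun f)).
Notation K := cinv_laplacian.

Lemma cinv_laplacianP f : mode1 f -> mode1 (K f) /\ poisson (K f) f.
Proof.
move=> Vf; have : V1 (of_cfun f) by apply/V1P; rewrite of_cfunK.
by move=> /inv_laplacianP; rewrite of_cfunK.
Qed.

(** The functions x_1 q_n(x_3) and x_2 q_n(x_3) are smooth eigenfunctions, hence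
admissible as test functions. *)
Lemma cinv_laplacian_coef f n : mode1 f ->
  cdot (K f) (e n) = - (n./2.+1 * n./2.+2)%:R^-1 * cdot f (e n).
Proof.
move=> Vf; have [VK p] := cinv_laplacianP Vf; move: (K f) VK p => u Vu p.
have [u1 u2] := mode1_L2c Vu; have [f1 f2] := mode1_L2c Vf.
have L2 := @L2_zonal2 R.
have K (v w : space3 R -> R) m : L2r v ->
    (forall Phi Psi, smooth Phi -> smooth Psi -> laplace_beltrami Phi Psi ->
      dot mu Psi v = dot mu Phi w) ->
    legendre_eig R m * dot mu (zonal1 (legendre_poly R m)) v =
      dot mu (zonal1 (legendre_poly R m)) w /\
    legendre_eig R m * dot mu (zonal2 (legendre_poly R m)) v =
      dot mu (zonal2 (legendre_poly R m)) w.
  move=> vL vw; split.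
    rewrite -(vw _ _ (smooth_zonal1 _) (smooth_zonal1 _) (laplacian_zonal1 _)).
    rewrite legendre1_legendre_poly -dotZl//; last exact: L2_zonal1.
    by apply: eq_Rintegral => x _; rewrite /zonal1 hornerZ; ring.
  rewrite -(vw _ _ (smooth_zonal2 _) (smooth_zonal2 _) (laplacian_zonal2 _)).
  rewrite legendre1_legendre_poly -dotZl//.
  by apply: eq_Rintegral => x _; rewrite /zonal2 hornerZ; ring.
have [p11 p21] := K _ _ n./2 u1 (fun _ _ sP sP' lb => (p _ _ sP sP' lb).1).
have [p12 p22] := K _ _ n./2 u2 (fun _ _ sP sP' lb => (p _ _ sP sP' lb).2).
have l0 : legendre_eig R n./2 != 0 by rewrite oppr_eq0 pnatr_eq0.
have -> : - (n./2.+1 * n./2.+2)%:R^-1 = (legendre_eig R n./2)^-1 by rewrite invrN.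
apply: (mulfI l0); rewrite mulrA divff// mul1r /zJ /cdot.
case: ifP => _ /=; rewrite ![dot mu u.1 _]dotC ![dot mu u.2 _]dotC ![dot mu f.1 _]dotC ![dot mu f.2 _]dotC.
  rewrite (dotNl (L2 _) u1) (dotNl (L2 _) f1) mulrDr mulrN p21 p12.
  by [].
by rewrite mulrDr p11 p22.
Qed.

(** For Omega = 0 one has B(x_3) = 6 x_3, and the operator is x_3 (1 + 6 K). *)
Lemma shiftedE (a b : R) zeta : to_cfun (shifted (M1 0) (a +i* b) zeta) =
  Ml (@rot90 R) (@mulx3 R) K a b (to_cfun zeta).
Proof.
rewrite /Ml /Mop /K to_cfunK; congr (_, _); apply/funext => x.
  change (complex.Re (shifted (M1 0) (a +i* b) zeta x) =
    x.2 * (complex.Re (zeta x) + 6 * complex.Re (inv_laplacian zeta x))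
    - a * complex.Re (zeta x) - b * - complex.Im (zeta x)).
  rewrite /shifted /M1 /Defs.coefA /Defs.coefB.
  by case: (zeta x) (inv_laplacian zeta x) => r1 r2 [s1 s2] /=; ring.
change (complex.Im (shifted (M1 0) (a +i* b) zeta x) =
  x.2 * (complex.Im (zeta x) + 6 * complex.Im (inv_laplacian zeta x))
  - a * complex.Im (zeta x) - b * complex.Re (zeta x)).
rewrite /shifted /M1 /Defs.coefA /Defs.coefB.
by case: (zeta x) (inv_laplacian zeta x) => r1 r2 [s1 s2] /=; ring.
Qed.

Lemma ae_equalP zeta1 zeta2 : L2 zeta1 -> L2 zeta2 ->
  @ae_equal R zeta1 zeta2 <->
  cdot (to_cfun zeta1 - to_cfun zeta2) (to_cfun zeta1 - to_cfun zeta2) = 0.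
Proof.
move=> z1 z2; set d := to_cfun zeta1 - to_cfun zeta2.
have [d1 d2] : L2c d by apply: (subspB (L2c_submodule R)).
split=> [h|].
  rewrite /cdot !L2_ae0_dot ?addr0//.
    by apply: filterS h => x hx; change (complex.Im (zeta1 x) - complex.Im (zeta2 x) = 0); rewrite hx subrr.
  by apply: filterS h => x hx; change (complex.Re (zeta1 x) - complex.Re (zeta2 x) = 0); rewrite hx subrr.
move=> /eqP; rewrite paddr_eq0 ?dot_ge0// => /andP[/eqP/(dot_eq0 d1) a1 /eqP/(dot_eq0 d2) a2].
apply: filterS2 a1 a2 => x.
change (complex.Re (zeta1 x) - complex.Re (zeta2 x) = 0 ->
  complex.Im (zeta1 x) - complex.Im (zeta2 x) = 0 -> zeta1 x = zeta2 x).
move=> /eqP; rewrite subr_eq0 => /eqP + /eqP; rewrite subr_eq0 => + /eqP.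
by case: (zeta1 x) (zeta2 x) => r1 r2 [s1 s2] /= -> ->.
Qed.

Lemma L2normE zeta : L2 zeta -> @L2norm R zeta = Num.sqrt (cdot (to_cfun zeta) (to_cfun zeta)).
Proof.
move=> [z1 z2]; rewrite /L2norm unlock /Lnorm.
have -> : (\int[mu]_x (`|(Normc.normc (zeta x))%:E| `^ 2))%E =
    (cdot (to_cfun zeta) (to_cfun zeta))%:E.
  rewrite /cdot EFinD !dotE// -ge0_integralD//.
  - apply: eq_integral => x _ /=; case: (zeta x) => r s /=.
    rewrite ger0_norm ?sqrtr_ge0// powR_mulrn ?sqrtr_ge0// sqr_sqrtr ?addr_ge0 ?sqr_ge0//.
  - by move=> x _; rewrite lee_fin sqr_ge0.
  - by apply/measurable_EFinP; apply: measurable_funX; exact: L2_measurable z1.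
  - by move=> x _; rewrite lee_fin sqr_ge0.
  - by apply/measurable_EFinP; apply: measurable_funX; exact: L2_measurable z2.
by rewrite poweR_EFin /= powR12_sqrt//; apply: (cdot_semi_inner R).(si_ge0).
Qed.

(** The abstract resolvent estimates, translated back to functions: the bound
gives injectivity and the norm of the inverse, with C replaced by its square
root. *)
Lemma nonreal_resolvent (a b : R) : b != 0 -> resolvent_set (@V1 R) (M1 0) (a +i* b).
Proof.
move=> b0; have WS := L2c_submodule R; have si := cdot_semi_inner R.
have cW := @cdot_complete R; have VS := mode1_submodule R.
have VW := @mode1_L2c R; have Vcl := @mode1_closed R.
have VK f : mode1 f -> mode1 (K f) by move=> /cinv_laplacianP[].
have Xsym f g : mode1 f -> mode1 g -> cdot (mulx3 f) g = cdot f (mulx3 g).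
  by move=> _ _; exact: cdot_mulx3.
have Jasym f g : mode1 f -> mode1 g -> cdot (rot90 f) g = - cdot f (rot90 g).
  by move=> Vf Vg; apply: cdot_rot90; exact: VW.
have Xle f : mode1 f -> cdot (mulx3 f) (mulx3 f) <= cdot f f.
  by move=> Vf; apply: mulx3_le; exact: VW.
pose M := Ml (@rot90 R) (@mulx3 R) K a b.
have VM f : mode1 f -> mode1 (M f).
  move=> Vf; apply: (subspB VS); first apply: (subspB VS).
  - by apply: mode1_mulx3; apply: (subspD VS) => //; apply: (subspZ VS); exact: VK.
  - exact: (subspZ VS).
  - by apply: (subspZ VS); exact: mode1_rot90.
have onto := Ml_onto WS si cW VS VW Vcl (@mode1_mulx3 R) (@mode1_rot90 R) VK Xsym Jasym
  (@rot90K R) (@mulx3_rot90 R) Xle (@mulx3_linear R) (@rot90_linear R) (@harmonic1_mode1 R)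
  (@basis_orth R) (@basis_total R) cinv_laplacian_coef (mulx3_harmonic1_0 R) a b0.
have [C C0 bound] := Ml_bound WS si cW VS VW Vcl (@mode1_mulx3 R) (@mode1_rot90 R) VK Xsym Jasym
  (@rot90K R) (@mulx3_rot90 R) Xle (@mulx3_linear R) (@rot90_linear R) (@harmonic1_mode1 R)
  (@basis_orth R) (@basis_total R) cinv_laplacian_coef (mulx3_harmonic1_0 R) a b0.
have msub := Ml_sub WS si cW VS VW Vcl (@mode1_mulx3 R) (@mode1_rot90 R) VK Xsym Jasym
  (@harmonic1_mode1 R) (@basis_orth R) (@basis_total R) cinv_laplacian_coef a b.
have null := Ml_null WS si cW VS VW Vcl (@mode1_mulx3 R) (@mode1_rot90 R) VK Xsym Jasym
  (@harmonic1_mode1 R) (@basis_orth R) (@basis_total R) cinv_laplacian_coef a b.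
have siV : semi_inner (@mode1 R) (@cdot R).
  split=> [r f g h Vf Vg Vh|f g Vf Vg|f Vf].
  - by apply: si.(si_lin); exact: VW.
  - by apply: si.(si_sym); exact: VW.
  - by apply: si.(si_ge0); exact: VW.
have SV zeta : V1 zeta -> V1 (shifted (M1 0) (a +i* b) zeta).
  by move=> /V1P zV; apply/V1P; rewrite shiftedE; exact: VM.
have VL zeta : V1 zeta -> L2 zeta by case.
split=> //.
- move=> z1 z2 V1z1 V1z2; have /V1P m1 := V1z1; have /V1P m2 := V1z2.
  rewrite (ae_equalP (VL _ (SV _ V1z1)) (VL _ (SV _ V1z2))) (ae_equalP (VL _ V1z1) (VL _ V1z2)).
  rewrite !shiftedE -/M.
  have Vd : mode1 (to_cfun z1 - to_cfun z2) by exact: (subspB VS).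
  have VMd : mode1 (M (to_cfun z1) - M (to_cfun z2)).
    by apply: (subspB VS); exact: VM.
  have <- : cdot (M (to_cfun z1 - to_cfun z2)) (M (to_cfun z1 - to_cfun z2)) =
      cdot (M (to_cfun z1) - M (to_cfun z2)) (M (to_cfun z1) - M (to_cfun z2)).
    exact: (eqv_Q siV (VM _ Vd) VMd (@msub _ _ m1 m2)).
  split=> [h|]; last exact: null.
  apply/le_anti; rewrite siV.(si_ge0)// andbT.
  by apply: le_trans (bound _ Vd) _; rewrite -/M h mulr0.
- move=> g V1g; have /V1P gm := V1g; have [f fm fg] := onto _ gm.
  have V1f : V1 (of_cfun f) by apply/V1P; rewrite of_cfunK.
  exists (of_cfun f) => //; apply/(ae_equalP (VL _ (SV _ V1f)) (VL _ V1g)).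
  rewrite shiftedE of_cfunK -/M.
  exact/(eqvP VS siV (VM _ fm) gm).
- exists (Num.sqrt C) => f V1f; have /V1P fm := V1f.
  rewrite (L2normE (VL _ V1f)) (L2normE (VL _ (SV _ V1f))) shiftedE -sqrtrM//.
  by apply: ler_wsqrtr; exact: bound.
Qed.

End Resolvent.

Theorem proposition5p1p1 (R : realType) (Omega : R) :
  Omega = 0 ->
  forall lambda : R[i], spectrum (@V1 R) (M1 Omega) lambda -> complex.Im lambda = 0.
Proof.
move=> -> [a b] sp /=; apply/eqP/negPn/negP => b0.
by apply: sp; exact: nonreal_resolvent.
Qed.
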